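(* For $A\in(0,1)$ enumerate the positive band functions of the Mathieu–Hankel operator $\mathbf H(A)$ as $E^+_0(k;A)>E^+_1(k;A)>\cdots>0$ for all $k\in\mathbb R$. Then for each $n\ge0$ there is $A_n>0$ such that for all $A\in(0,A_n)$ the function $k\mapsto E^+_n(k;A)$ is decreasing on $(0,\omega/2)$.
   Context: Fix $T>0$, $\omega=2\pi/T$. For $A\in\mathbb R$, $\mathbf H(A)$ is the Hankel operator on $L^2(\mathbb R_+)$ with kernel $p_A(\log t)/t$, $p_A(\xi)=A+\operatorname{Re}(\Gamma(1-i\omega)e^{i\omega\xi})$. Its fiber operators are $H(k;A)$ on $\ell^2(\mathbb Z)$ with matrix $[H(k;A)]_{n,m}=\overline{\gamma_n(k)}\,\mathfrak s_{n-m}\,\gamma_m(k)$, $\gamma_n(k)=\Gamma(\frac12+i(\omega n+k))$, $\mathfrak s_0=A$, $\mathfrak s_{\pm1}=\frac12$, $\mathfrak s_j=0$ otherwise. Band functions: the (unique up to ordering) list, repetitions allowed, of non-vanishing real analytic real functions on $\mathbb R$ such that for every $k$ the non-zero eigenvalues of $H(k;A)$ with multiplicity are exactly the values of the listed functions at $k$, counted with repetition. For $A\in(0,1)$ there are infinitely many positive band functions and distinct band functions never take equal values, so the stated enumeration is possible. *)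

(* Defs.v *)
From HB Require Import structures.
From mathcomp Require Import all_boot all_order all_algebra.
From mathcomp Require Import all_classical all_reals all_analysis.
From mathcomp Require Import complex.
Set Implicit Arguments. Unset Strict Implicit. Unset Printing Implicit Defensive.
Import Order.TTheory GRing.Theory Num.Theory.
Import numFieldNormedType.Exports.
Local Open Scope classical_set_scope.
Local Open Scope ring_scope.

Section MathieuHankel.
Variable R : realType.

(* Euler's integral for the complex Gamma function, valid for Re z > 0:
   Gamma z = \int_0^oo t^(z-1) e^(-t) dt, with
   t^(z-1) = t^(complex.Re z - 1) (cos (Im z ln t) + i sin (Im z ln t)). *)
Definition GammaC (z : R[i]) : R[i] :=
  Complex
    (Rintegral lebesgue_measure `]0%R, +oo[
       (fun t : R => powR t (complex.Re z - 1) * expR (- t) * cos (complex.Im z * ln t)))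
    (Rintegral lebesgue_measure `]0%R, +oo[
       (fun t : R => powR t (complex.Re z - 1) * expR (- t) * sin (complex.Im z * ln t))).

Definition omega (T : R) : R := 2 * pi / T.

Definition gammaMH (T k : R) (n : int) : R[i] :=
  GammaC (Complex (2^-1) (omega T * n%:~R + k)).

Definition sMH (A : R) (j : int) : R :=
  if j == 0 then A else if (j == 1) || (j == -1) then 2^-1 else 0.

Definition Hmat (T A k : R) (n m : int) : R[i] :=
  (conjc (gammaMH T k n) * (sMH A (n - m))%:C * gammaMH T k m)%C.

(* action of the matrix on a sequence x : Z -> C; the matrix is
   tridiagonal (Hmat n m = 0 unless |n - m| <= 1), so this finite sum is the
   full matrix product sum_m H_{n,m} x_m *)
Definition Happly (T A k : R) (x : int -> R[i]) (n : int) : R[i] :=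
  \sum_(j <- [:: -1; 0; 1]) Hmat T A k n (n + j) * x (n + j).

Definition sqmod (z : R[i]) : R := complex.Re z ^+ 2 + complex.Im z ^+ 2.

Definition l2Z (x : int -> R[i]) : Prop :=
  cvgn (series (fun n : nat => sqmod (x n%:Z) + sqmod (x (- (n.+1)%:Z)))).

Definition is_eigvec (T A k lam : R) (x : int -> R[i]) : Prop :=
  l2Z x /\ forall n, Happly T A k x n = lam%:C%C * x n.

Definition eig_mult_ge (T A k lam : R) (m : nat) : Prop :=
  exists v : 'I_m -> int -> R[i],
    (forall i, is_eigvec T A k lam (v i)) /\
    (forall c : 'I_m -> R[i],
        (forall n, \sum_(i < m) c i * v i n = 0) -> forall i, c i = 0).

Definition real_analytic (f : R -> R) : Prop :=
  forall x0 : R, exists2 r : R, 0 < r & exists c : nat -> R,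
    forall x : R, `|x - x0| < r ->
      series (fun j : nat => c j * (x - x0) ^+ j) @ \oo --> f x.

(* E is the enumeration E_0 > E_1 > ... > 0 of the positive band functions
   of H(A): real analytic positive functions whose values at each k are,
   with multiplicity, exactly the positive eigenvalues of H(k;A). *)
Definition positive_band_enum (T A : R) (E : nat -> R -> R) : Prop :=
  [/\ forall n, real_analytic (E n),
      forall n k, 0 < E n k,
      forall n k, E n.+1 k < E n k &
      forall k lam, 0 < lam -> forall m : nat,
        eig_mult_ge T A k lam m <->
        exists f : 'I_m -> nat, injective f /\ forall i, E (f i) k = lam].

End MathieuHankel.

(* Main.v *)
(* Put h = pi omega and z = pi k.  Since |Gamma(1/2 + iy)|^2 = C / cosh(pi y),
   the substitution u_n = gamma_n x_n turns the eigenvalue equation into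
   u(n+1) + u(n-1) + 2 A u(n) = 2 mu cosh(z + n h) u(n) with lambda = C mu.
   Partial fractions in tanh and sech show that its characteristic determinant
   is D_A(z) = F + G Phi(z), where Phi(z) = sum_n sech(z + n h) is positive and
   strictly decreasing on [0, h/2], and where A -> - A fixes F and negates G.

   Let z1 < z2 in [0, h/2] and let e be the n-th eigenvalue at (z2, A).  From
   D_A(z2) = 0 and Phi(z1) > Phi(z2) > - Phi(z1) it follows that D_A(z1) and
   D_{-A}(z1) have opposite signs, so e is an eigenvalue at (z1, A') for some A'
   in [-A, A).  For A = 0 the spectrum does not depend on z; hence, for A small
   compared with the gap below its n top elements, n eigenvalues at (z1, A')
   exceed e.  By the variational principle all eigenvalues strictly increase
   from A' to A, so that n + 1 eigenvalues at (z1, A) exceed e. *)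

Require Import Defs.
From HB Require Import structures.
From mathcomp Require Import all_boot all_order all_algebra.
From mathcomp Require Import all_classical all_reals all_analysis.
From mathcomp Require Import complex measurable_realfun ring lra zify.
Set Implicit Arguments. Unset Strict Implicit. Unset Printing Implicit Defensive.
Import Order.TTheory GRing.Theory Num.Theory.
Import numFieldNormedType.Exports.
Local Open Scope classical_set_scope.
Local Open Scope ring_scope.

(** * Hyperbolic functions and sums over the integers *)

Section Hyperbolic.
Variable R : realType.
Implicit Types x y : R.

(** The monotonicity of [Phi] rests on a Landen transformation. Up to scaling [Phi h] is the
    elliptic function dn; [Phi (2 * h) z * Phi (2 * h) (z + h)] is a constant C, so [Phi h z] equals
    a + C / a with a = [Phi (2 * h) z]. On the half period in question a^2 >= C, hence monotonicity
    passes from spacing 2 h to spacing h; for large h it is visible term by term. Only the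
    dependence of the determinant on z is explicit, not that on the eigenvalue. A move in z is
    therefore traded for a move in A at a fixed eigenvalue e, and the order of eigenvalues comes
    back from the variational principle at one fixed z. This is where A must be small: A' may be as
    low as - A, and the n eigenvalues above e have to survive that move. Eigenvalues are produced by
    maximising a form over a ball that is compact for pointwise convergence: the weight cosh makes
    the tails of the form uniformly small. The identity for |Gamma(1/2 + iy)|^2 comes from comparing
    the recursion of Gamma with a Wallis-type product for cosh; the constant C of the overview is
    Gamma(1/2)^2. *)

Definition coshR x : R := (expR x + expR (- x)) / 2.
Definition sinhR x : R := (expR x - expR (- x)) / 2.
Definition sechR x : R := (coshR x)^-1.
Definition tanhR x : R := sinhR x / coshR x.

Lemma coshN x : coshR (- x) = coshR x.
Proof. by rewrite /coshR opprK addrC. Qed.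

Lemma sinhN x : sinhR (- x) = - sinhR x.
Proof. rewrite /sinhR opprK; lra. Qed.

Lemma cosh0 : coshR 0 = 1.
Proof. rewrite /coshR oppr0 expR0; lra. Qed.

Lemma expRNK x : expR x * expR (- x) = 1.
Proof. by rewrite -expRD subrr expR0. Qed.

Lemma coshD x y : coshR (x + y) = coshR x * coshR y + sinhR x * sinhR y.
Proof. by rewrite /coshR /sinhR opprD !expRD; field. Qed.

Lemma sinhD x y : sinhR (x + y) = sinhR x * coshR y + coshR x * sinhR y.
Proof. by rewrite /coshR /sinhR opprD !expRD; field. Qed.

Lemma cosh_sqr x : coshR x ^+ 2 = 1 + sinhR x ^+ 2.
Proof. have := expRNK x; rewrite /coshR /sinhR => e; lra. Qed.

Lemma cosh_gt0 x : 0 < coshR x.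
Proof. by rewrite /coshR divr_gt0 // addr_gt0 // expR_gt0. Qed.

Lemma cosh_neq0 x : coshR x != 0.
Proof. by rewrite gt_eqF // cosh_gt0. Qed.

Lemma cosh_ge1 x : 1 <= coshR x.
Proof.
have := cosh_sqr x; have := cosh_gt0 x; have := sqr_ge0 (sinhR x); nra.
Qed.

Lemma sinh_gt0 x : 0 < x -> 0 < sinhR x.
Proof.
move=> x0; rewrite /sinhR divr_gt0 // subr_gt0 ltr_expR; lra.
Qed.

Lemma sinh_neq0 x : x != 0 -> sinhR x != 0.
Proof.
move=> x0; have [xlt|xgt|xe] := ltgtP x 0.
- by rewrite -[x]opprK sinhN oppr_eq0 gt_eqF // sinh_gt0 // oppr_gt0.
- by rewrite gt_eqF // sinh_gt0.
- by rewrite xe eqxx in x0.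
Qed.

Lemma ltr_cosh x y : 0 <= x -> x < y -> coshR x < coshR y.
Proof.
move=> x0 xy; rewrite -subr_gt0.
have -> : coshR y - coshR x = 2 * (sinhR ((y + x) / 2) * sinhR ((y - x) / 2)).
  set a := (y + x) / 2; set b := (y - x) / 2.
  have -> : y = a + b by rewrite /a /b; lra.
  have -> : x = a - b by rewrite /a /b; lra.
  rewrite !coshD coshN sinhN; lra.
by do 2 ?apply: mulr_gt0 => //; rewrite ?sinh_gt0 //; lra.
Qed.

Lemma ler_cosh x y : 0 <= x -> x <= y -> coshR x <= coshR y.
Proof.
move=> x0; rewrite le_eqVlt => /predU1P[->//|xy]; exact/ltW/ltr_cosh.
Qed.

Lemma cosh_abs x : coshR `|x| = coshR x.
Proof. by have [//|x0] := ger0P x; rewrite ?coshN. Qed.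

Lemma sechN x : sechR (- x) = sechR x.
Proof. by rewrite /sechR coshN. Qed.

Lemma sech_gt0 x : 0 < sechR x.
Proof. by rewrite /sechR invr_gt0 cosh_gt0. Qed.

Lemma sech_ge0 x : 0 <= sechR x.
Proof. exact/ltW/sech_gt0. Qed.

Lemma sech_le1 x : sechR x <= 1.
Proof. by rewrite /sechR invf_le1 ?cosh_gt0 // cosh_ge1. Qed.

Lemma sech_le_exp x : sechR x <= 2 * expR (- x).
Proof.
rewrite /sechR -[leLHS]mul1r ler_pdivrMr ?cosh_gt0 // /coshR.
have := expRNK x; have := expR_gt0 x; have := expR_gt0 (- x); nra.
Qed.

Lemma sech_le_exp_abs x : sechR x <= 2 * expR (- `|x|).
Proof. by rewrite /sechR -cosh_abs; exact: sech_le_exp. Qed.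

Lemma tanhN x : tanhR (- x) = - tanhR x.
Proof. by rewrite /tanhR sinhN coshN mulNr. Qed.

Lemma tanh_sech_exp x : 1 - tanhR x = expR (- x) * sechR x.
Proof.
rewrite /tanhR /sechR; have := cosh_neq0 x; rewrite /sinhR => c0.
by apply: (mulIf c0); rewrite mulrBl !divfK // /coshR; lra.
Qed.

(** The addition formula for sinh (x - y), divided by cosh x cosh y. It turns products of sech into
    differences of tanh, which telescope along a lattice. *)
Lemma mul_sech x y : x != y ->
  sechR x * sechR y = (tanhR x - tanhR y) / sinhR (x - y).
Proof.
move=> xy; have s0 : sinhR (x - y) != 0 by rewrite sinh_neq0 // subr_eq0.
rewrite sinhD coshN sinhN in s0 *.
rewrite /tanhR /sechR; field.
by rewrite s0 !cosh_neq0.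
Qed.

Lemma mul_tanh_sech x y : x != y ->
  tanhR x * sechR y = coshR (x - y) / sinhR (x - y) * sechR y
                      - sechR x / sinhR (x - y).
Proof.
move=> xy; have s0 : sinhR (x - y) != 0 by rewrite sinh_neq0 // subr_eq0.
have e : coshR y = coshR (x - y) * coshR x - sinhR (x - y) * sinhR x.
  by rewrite -[y in LHS](_ : x - (x - y) = y) ?[LHS]coshD ?coshN ?sinhN; [ring|lra].
have -> : tanhR x = (coshR (x - y) * coshR x - coshR y) / sinhR (x - y) / coshR x.
  by rewrite /tanhR [in RHS]e; field; rewrite s0 cosh_neq0.
by rewrite /sechR; field; rewrite s0 !cosh_neq0.
Qed.

End Hyperbolic.

(** * Symmetric partial sums over the integers and dominated convergence of series *)

Section WindowSums.
Variable R : realType.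
Implicit Types (f g : int -> R) (N : nat).

(** Since [Negz i] is - i - 1, the window is -N, ..., N - 1, symmetric about -1/2 and not about
    0. *)
Definition psum f N : R := \sum_(0 <= i < N) (f (Posz i) + f (Negz i)).

Definition bsum f := exists M : R, forall N, psum f N <= M.

Lemma psum0 f : psum f 0 = 0.
Proof. by rewrite /psum big_geq. Qed.

Lemma psumS f N : psum f N.+1 = psum f N + (f (Posz N) + f (Negz N)).
Proof. by rewrite /psum big_nat_recr. Qed.

Lemma psumD f g N : psum (fun n => f n + g n) N = psum f N + psum g N.
Proof. by rewrite /psum -big_split; apply: eq_bigr => i _ /=; ring. Qed.

Lemma psumZ a f N : psum (fun n => a * f n) N = a * psum f N.
Proof. by rewrite /psum big_distrr; apply: eq_bigr => i _ /=; ring. Qed.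

Lemma psumN f N : psum (fun n => - f n) N = - psum f N.
Proof. by rewrite -mulN1r -psumZ; apply: eq_bigr => i _; rewrite !mulN1r. Qed.

Lemma psumB f g N : psum (fun n => f n - g n) N = psum f N - psum g N.
Proof. by rewrite psumD psumN. Qed.

Lemma psum_sum m (F : nat -> int -> R) N :
  psum (fun n => \sum_(0 <= j < m) F j n) N = \sum_(0 <= j < m) psum (F j) N.
Proof. by rewrite /psum exchange_big; apply: eq_bigr => i _ /=; rewrite big_split. Qed.

Lemma eq_psum f g N : f =1 g -> psum f N = psum g N.
Proof. by move=> fg; apply: eq_bigr => i _; rewrite !fg. Qed.

Lemma ler_psum f g N : (forall n, f n <= g n) -> psum f N <= psum g N.
Proof. by move=> fg; apply: ler_sum => i _; rewrite lerD. Qed.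

Lemma psum_ge0 f N : (forall n, 0 <= f n) -> 0 <= psum f N.
Proof. by move=> f0; apply: sumr_ge0 => i _; rewrite addr_ge0. Qed.

Lemma psum_nondecreasing f : (forall n, 0 <= f n) -> nondecreasing_seq (psum f).
Proof.
move=> f0; apply/nondecreasing_seqP => N; rewrite psumS lerDl addr_ge0 //.
Qed.

Lemma psum_le f : (forall n, 0 <= f n) -> forall m N, (m <= N)%N -> psum f m <= psum f N.
Proof. by move=> f0 m N; apply: psum_nondecreasing. Qed.

Lemma term_le_psum f n : (forall n, 0 <= f n) -> exists N0, forall N, (N0 <= N)%N -> f n <= psum
  f N.
Proof.
move=> f0; have H i N : (i.+1 <= N)%N -> f (Posz i) <= psum f N /\ f (Negz i) <= psum f N.
  move=> iN; have := psum_le f0 iN; rewrite psumS.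
  have := psum_ge0 i f0; have := f0 (Posz i); have := f0 (Negz i); split; lra.
by case: n => i; exists i.+1 => N /H[].
Qed.

Lemma bsum_term_le f M n : (forall n, 0 <= f n) -> (forall N, psum f N <= M) -> f n <= M.
Proof.
move=> f0 fM; have [N0 H] := term_le_psum n f0.
exact: le_trans (H N0 (leqnn _)) (fM N0).
Qed.

Lemma psum_telescope f N : psum (fun n => f (n + 1) - f n) N = f (Posz N) - f (- Posz N).
Proof.
elim: N => [|N IH]; first by rewrite psum0 oppr0 subrr.
rewrite psumS IH NegzE.
have -> : Posz N + 1 = Posz N.+1 by rewrite -addn1.
have -> : - Posz N.+1 + 1 = - Posz N by rewrite -addn1 PoszD; lra.
ring.
Qed.

Lemma psum_shift f N : psum (fun n => f (n + 1)) N = psum f N + f (Posz N) - f (- Posz N).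
Proof. by have := psum_telescope f N; rewrite psumB; lra. Qed.

Lemma psum_flip f N : psum (fun n => f (- n - 1)) N = psum f N.
Proof.
apply: eq_bigr => i _.
have -> : - Posz i - 1 = Negz i by rewrite NegzE -addn1 PoszD; lra.
have -> : - Negz i - 1 = Posz i by rewrite NegzE opprK -addn1 PoszD; lra.
by rewrite addrC.
Qed.

Lemma bsumD f g : bsum f -> bsum g -> bsum (fun n => f n + g n).
Proof.
move=> [M fM] [M' gM]; exists (M + M') => N; rewrite psumD lerD //.
Qed.

Lemma bsumZ a f : 0 <= a -> bsum f -> bsum (fun n => a * f n).
Proof. by move=> a0 [M fM]; exists (a * M) => N; rewrite psumZ ler_wpM2l. Qed.

Lemma bsum_le f g : (forall n, f n <= g n) -> bsum g -> bsum f.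
Proof. by move=> fg [M gM]; exists M => N; apply: le_trans (ler_psum _ fg) (gM N). Qed.

Lemma bsum_cvg f : (forall n, 0 <= f n) -> bsum f -> cvgn (psum f).
Proof.
move=> f0 [M fM]; apply: nondecreasing_is_cvgn; first exact: psum_nondecreasing.
by exists M => _ [N _ <-].
Qed.

(** Monotone convergence applies to f + g and to g, and f is their difference. *)
Lemma dom_cvg f g : (forall n, `|f n| <= g n) -> bsum g -> cvgn (psum f).
Proof.
move=> fg bg.
have -> : psum f = psum (fun n => f n + g n) \- psum g.
  by apply/funext => N /=; rewrite psumD addrK.
have g0 n : 0 <= g n := le_trans (normr_ge0 _) (fg n).
apply: is_cvgB; last exact: bsum_cvg.
apply: bsum_cvg.
  by move=> n; have := fg n; rewrite ler_norml => /andP[+ _]; lra.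
apply: (@bsum_le _ (fun n => 2 * g n)); last exact: bsumZ.
by move=> n; have := fg n; rewrite ler_norml => /andP[_ +]; lra.
Qed.

Lemma bsum_tail g : (forall n, 0 <= g n) -> bsum g -> forall e, 0 < e ->
  exists M, forall N, (M <= N)%N -> psum g N - psum g M <= e.
Proof.
move=> g0 bg e e0; have /cvgrPdist_le/(_ e e0)[M _ HM] := bsum_cvg g0 bg.
exists M => N MN; have := HM M (leqnn _).
have := nondecreasing_cvgn_le (psum_nondecreasing g0) (bsum_cvg g0 bg) N.
have := nondecreasing_cvgn_le (psum_nondecreasing g0) (bsum_cvg g0 bg) M.
by rewrite /= => h1 h2; rewrite ger0_norm; lra.
Qed.

Lemma dom_tail f g : (forall n, `|f n| <= g n) -> forall M N, (M <= N)%N ->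
  `|psum f N - psum f M| <= psum g N - psum g M.
Proof.
move=> fg M N MN; rewrite -(subnKC MN); elim: (N - M)%N => [|k IH].
  by rewrite addn0 !subrr normr0.
rewrite addnS !psumS.
have h1 := fg (Posz (M + k)); have h2 := fg (Negz (M + k)).
have := ler_normD (f (Posz (M + k))) (f (Negz (M + k))).
have := ler_normD (psum f (M + k) - psum f M) (f (Posz (M + k)) + f (Negz (M + k))).
have -> : psum f (M + k) - psum f M + (f (Posz (M + k)) + f (Negz (M + k))) =
  psum f (M + k) + (f (Posz (M + k)) + f (Negz (M + k))) - psum f M by ring.
lra.
Qed.

Lemma dom_tail_lim f g l : (forall n, `|f n| <= g n) -> psum f @ \oo --> l ->
  forall M e, (forall N, (M <= N)%N -> psum g N - psum g M <= e) ->
  `|l - psum f M| <= e.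
Proof.
move=> fg fl M e He.
have h : (fun N => `|psum f N - psum f M|) @ \oo --> `|l - psum f M|.
  by apply: cvg_norm; apply: cvgB => //; exact: cvg_cst.
apply: (closed_cvg (fun x => x <= e) (@closed_le _ e) _ _ h).
near=> N; apply: le_trans (dom_tail fg _) (He _ _); near: N; exact: nbhs_infty_ge.
Unshelve. all: by end_near. Qed.

(** Outside a window fixed by the tail of g both sums move by at most e / 3, uniformly in k; inside
    it only finitely many terms have to converge. *)
Lemma tannery (F : nat -> int -> R) f g (c : nat -> R) (l : R) : bsum g ->
  (forall k n, `|F k n| <= g n) -> (forall n, F k n @[k --> \oo] --> f n) ->
  (forall k, psum (F k) @ \oo --> c k) -> psum f @ \oo --> l -> c @ \oo --> l.
Proof.
move=> bg Fg Ff Fc fl.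
have g0 n : 0 <= g n := le_trans (normr_ge0 _) (Fg 0%N n).
have fg n : `|f n| <= g n.
  apply: (closed_cvg (fun x => x <= g n) (@closed_le _ (g n)) _ _ (cvg_norm (Ff n))).
  by apply: nearW => k; exact: Fg.
apply/cvgrPdist_le => e e0.
have e3 : 0 < e / 3 by lra.
have [M HM] := bsum_tail g0 bg e3.
have FM : (fun k => psum (F k) M) @ \oo --> psum f M.
  elim: M {HM} => [|M IH].
    by rewrite psum0; under eq_cvg do rewrite psum0; exact: cvg_cst.
  rewrite psumS; under eq_cvg do rewrite psumS.
  by apply: cvgD => //; apply: cvgD; exact: Ff.
move/cvgrPdist_le/(_ _ e3) : FM; apply: filterS => k hk.
have h1 := dom_tail_lim fg fl HM; have h2 := dom_tail_lim (Fg k) (Fc k) HM.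
have -> : l - c k = (l - psum f M) - (c k - psum (F k) M) + (psum f M - psum (F k) M) by ring.
have := ler_normD (l - psum f M - (c k - psum (F k) M)) (psum f M - psum (F k) M).
have := ler_normB (l - psum f M) (c k - psum (F k) M).
lra.
Qed.

End WindowSums.

(** * Monotonicity of the periodized hyperbolic secant *)

Section Lattice.
Variables (R : realType) (h : R).
Hypothesis h0 : 0 < h.
Implicit Types (z x : R) (n : int).

Lemma expNh_lt1 : `|expR (- h)| < 1.
Proof. by rewrite ger0_norm ?expR_ge0 // expR_lt1 oppr_lt0. Qed.

Lemma cvg_expNh z : expR (- (z + N%:R * h)) @[N --> \oo] --> (0 : R).
Proof.
rewrite -(mulr0 (expR (- z))).
have E N : expR (- (z + N%:R * h)) = expR (- z) * expR (- h) ^+ N.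
  by rewrite opprD expRD -expRM_natr; congr (_ * expR _); ring.
under eq_cvg do rewrite E.
by apply: cvgM; [exact: cvg_cst|exact: (cvg_expr expNh_lt1)].
Qed.

Lemma cvg_tanh_pos z : tanhR (z + N%:R * h) @[N --> \oo] --> (1 : R).
Proof.
have lo N : 1 - expR (- (z + N%:R * h)) <= tanhR (z + N%:R * h).
  have := tanh_sech_exp (z + N%:R * h); have := sech_le1 (z + N%:R * h).
  have := expR_gt0 (- (z + N%:R * h)); nra.
have hi N : tanhR (z + N%:R * h) <= 1.
  have := tanh_sech_exp (z + N%:R * h); have := sech_gt0 (z + N%:R * h).
  have := expR_gt0 (- (z + N%:R * h)); nra.
apply: (@squeeze_cvgr _ _ _ _ (fun N => 1 - expR (- (z + N%:R * h))) (fun=> 1)).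
- by apply: nearW => N; rewrite lo hi.
- rewrite -[X in _ --> X]subr0; apply: cvgB; [exact: cvg_cst|exact: cvg_expNh].
- exact: cvg_cst.
Qed.

Lemma cvg_tanh_neg z : tanhR (z - N%:R * h) @[N --> \oo] --> (-1 : R).
Proof.
have -> : (fun N : nat => tanhR (z - N%:R * h)) = (fun N => - tanhR (- z + N%:R * h)).
  by apply/funext => N; rewrite -tanhN opprD opprK.
by apply: cvgN; exact: cvg_tanh_pos.
Qed.

Lemma cvg_sech_pos z : sechR (z + N%:R * h) @[N --> \oo] --> (0 : R).
Proof.
apply: (@squeeze_cvgr _ _ _ _ (fun=> 0) (fun N => 2 * expR (- (z + N%:R * h)))).
- by apply: nearW => N; rewrite sech_ge0 sech_le_exp.
- exact: cvg_cst.
- by rewrite -(mulr0 2); apply: cvgM; [exact: cvg_cst|exact: cvg_expNh].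
Qed.

Lemma cvg_sech_neg z : sechR (z - N%:R * h) @[N --> \oo] --> (0 : R).
Proof.
have -> : (fun N : nat => sechR (z - N%:R * h)) = (fun N => sechR (- z + N%:R * h)).
  by apply/funext => N; rewrite -sechN opprB addrC.
exact: cvg_sech_pos.
Qed.

Definition lat z (f : R -> R) n : R := f (z + n%:~R * h).

Lemma lat_shift z f n : lat (z + h) f n = lat z f (n + 1).
Proof. by rewrite /lat intrD; congr f; ring. Qed.

Lemma sech_lat_bound z : exists M, forall N, psum (lat z (@sechR R)) N <= M.
Proof.
set q := expR (- h); have q1 : q < 1 by rewrite /q expR_lt1 oppr_lt0.
have q0 : 0 < q by exact: expR_gt0.
exists (4 * expR `|z| / (1 - q)) => N.
have H n (i : nat) : i%:R * h <= `|n%:~R * h| -> sechR (z + n%:~R * h) <= 2 * expR `|z| * q ^+ i.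
  move=> hi; apply: (le_trans (sech_le_exp_abs _)).
  rewrite -mulrA ler_pM2l // -expRM_natr -expRD ler_expR.
  have := ler_normB (z + n%:~R * h) z; rewrite addrAC subrr add0r; lra.
rewrite /psum; apply: (@le_trans _ _ (\sum_(0 <= i < N) 4 * expR `|z| * q ^+ i)).
  apply: ler_sum => i _.
  have h1 : i%:R * h <= `|(Posz i)%:~R * h| by rewrite ger0_norm // mulr_ge0 // ?ler0z // ltW.
  have h2 : i%:R * h <= `|(Negz i)%:~R * h|.
    rewrite NegzE mulrNz mulNr normrN ger0_norm; last by rewrite mulr_ge0 // ltW.
    by rewrite ler_pM2r // ler_nat.
  have := H _ _ h1; have := H _ _ h2; rewrite /lat; lra.
rewrite -big_distrr /= ler_wpM2l ?mulr_ge0 ?expR_ge0 //.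
rewrite -[leRHS]mul1r ler_pdivlMr ?subr_gt0 //.
have -> : (\sum_(0 <= i < N) q ^+ i) * (1 - q) = 1 - q ^+ N.
  elim: N => [|N IH]; first by rewrite big_geq // mul0r expr0 subrr.
  by rewrite big_nat_recr //= mulrDl IH exprS; ring.
by rewrite gerBl exprn_ge0 // ltW.
Qed.

Lemma bsum_sech z : bsum (lat z (@sechR R)).
Proof. exact: sech_lat_bound. Qed.

Definition Phi z : R := limn (psum (lat z (@sechR R))).

Lemma cvg_Phi z : psum (lat z (@sechR R)) @ \oo --> Phi z.
Proof.
apply: bsum_cvg; [by move=> n; exact: sech_ge0|exact: bsum_sech].
Qed.

Lemma psum_le_Phi z N : psum (lat z (@sechR R)) N <= Phi z.
Proof.
apply: nondecreasing_cvgn_le; last exact: cvg_Phi.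
by apply: psum_nondecreasing => n; exact: sech_ge0.
Qed.

Lemma Phi_gt0 z : 0 < Phi z.
Proof.
apply: lt_le_trans (psum_le_Phi z 1); rewrite psumS psum0 add0r.
by rewrite addr_gt0 ?sech_gt0.
Qed.

Lemma cvg_lat_shift z (f : R -> R) l a b : psum (lat z f) @ \oo --> l ->
  f (z + N%:R * h) @[N --> \oo] --> a -> f (z - N%:R * h) @[N --> \oo] --> b ->
  psum (lat (z + h) f) @ \oo --> l + a - b.
Proof.
move=> fl fa fb.
have -> : psum (lat (z + h) f) = fun N => psum (lat z f) N + f (z + N%:R * h) - f (z - N%:R * h).
  apply/funext => N; rewrite (eq_psum _ (lat_shift z f)) psum_shift.
  by rewrite /lat mulrNz mulNr.
by apply: cvgB => //; apply: cvgD.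
Qed.

Lemma Phi_shift z : Phi (z + h) = Phi z.
Proof.
apply/cvg_lim => //; rewrite -[X in _ --> X]addr0 -[X in _ --> X]subr0.
by apply: cvg_lat_shift; [exact: cvg_Phi|exact: cvg_sech_pos|exact: cvg_sech_neg].
Qed.

Lemma Phi_shiftn z (j : nat) : Phi (z - j%:R * h) = Phi z.
Proof.
elim: j => [|j IH]; first by rewrite mul0r subr0.
by rewrite -IH -Phi_shift; congr Phi; ring.
Qed.

Lemma Phi_shiftz z n : Phi (z + n%:~R * h) = Phi z.
Proof.
case: n => n; last by rewrite NegzE mulrNz mulNr; exact: Phi_shiftn.
by rewrite -(Phi_shiftn _ n); congr Phi; ring.
Qed.

Lemma PhiN z : Phi (- z) = Phi z.
Proof.
rewrite -[RHS]Phi_shift /Phi; congr (limn _); apply/funext => N.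
rewrite -psum_flip; apply: eq_psum => n; rewrite /lat -sechN; congr sechR.
by rewrite intrB intrN; ring.
Qed.

(** Each shift by h telescopes and contributes 2, the total variation of tanh from -1 to 1. The
    limit no longer depends on z, which is the source of every constant below. *)
Lemma lat_tanh_cvg z (j : nat) :
  psum (fun n => tanhR (z + n%:~R * h) - tanhR (z - j%:R * h + n%:~R * h)) @ \oo --> (2 * j%:R :
    R).
Proof.
elim: j => [|j IH].
  rewrite mulr0 (_ : psum _ = fun=> 0); first exact: cvg_cst.
  by apply/funext => N; rewrite mul0r subr0 (psumB (lat z (@tanhR R))) subrr.
pose w := z - j.+1%:R * h.
have e : z - j%:R * h = w + h by rewrite /w; ring.
have -> : psum (fun n => tanhR (z + n%:~R * h) - tanhR (w + n%:~R * h)) =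
  fun N => psum (fun n => tanhR (z + n%:~R * h) - tanhR (z - j%:R * h + n%:~R * h)) N
    + (tanhR (w + N%:R * h) - tanhR (w - N%:R * h)).
  apply/funext => N; have := psum_telescope (lat w (@tanhR R)) N.
  rewrite /lat mulrNz mulNr => <-; rewrite -psumD; apply: eq_psum => n.
  rewrite e intrD (_ : w + h + _ = w + (n%:~R + 1%:~R) * h); first by ring.
  by rewrite mulrDl mul1r; ring.
rewrite -[j.+1%:R]natr1 mulrDr mulr1; apply: cvgD => //.
rewrite (_ : 2 = 1 - (-1)); last by lra.
by apply: cvgB; [exact: cvg_tanh_pos|exact: cvg_tanh_neg].
Qed.

(** The product is the double sum over sech times sech. Summed first over the offset between the two
    factors it becomes a sum of tanh differences, and each of these has a lattice sum independent of
    z. *)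
Lemma landen_mul : exists C, forall z, Phi z * Phi (z - h / 2) = C.
Proof.
pose s i : R := sinhR ((i%:R + 2^-1) * h).
pose c N := \sum_(0 <= i < N) (s i)^-1 * (2 * (2 * i + 1)%:R) : R.
exists (limn c) => z; apply/esym/cvg_lim => //.
pose f k x := psum (lat x (@sechR R)) k * sechR (x - h / 2).
apply: (@tannery _ (fun k => lat z (f k)) (lat z (fun x => Phi x * sechR (x - h / 2)))
          (fun n => Phi z * lat (z - h / 2) (@sechR R) n)).
- by apply: bsumZ; [exact/ltW/Phi_gt0|exact: bsum_sech].
- move=> k n; rewrite /lat /f ger0_norm; last first.
    by rewrite mulr_ge0 ?sech_ge0 //; apply: psum_ge0 => m; exact: sech_ge0.
  rewrite addrAC; apply: ler_wpM2r; first exact: sech_ge0.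
  by rewrite -(Phi_shiftz z n); exact: psum_le_Phi.
- move=> n; rewrite /lat /f; apply: cvgM; [exact: cvg_Phi|exact: cvg_cst].
- move=> k.
  have E n : lat z (f k) n = \sum_(0 <= i < k) (s i)^-1 *
     (tanhR (z + i%:R * h + n%:~R * h) - tanhR (z + i%:R * h - (2 * i + 1)%:R * h + n%:~R * h)).
    rewrite /lat /f /psum big_distrl; apply: eq_bigr => i _; rewrite /lat /=.
    have p : 0 < (i%:R + 2^-1) * h by rewrite mulr_gt0 // ltr_wpDl // invr_gt0.
    have sE : s i = sinhR ((i%:R + 2^-1) * h) by [].
    have -> : (Negz i)%:~R = - (i%:R + 1) :> R by rewrite NegzE mulrNz -pmulrn natr1.
    rewrite natrD natrM.
    (* The two sites of a window pair lie at opposite distances from the site of the other factor,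
       so its tanh cancels between them. *)
    have d1 : z + n%:~R * h + i%:R * h - (z + n%:~R * h - h / 2) = (i%:R + 2^-1) * h by field.
    have d2 : z + n%:~R * h + - (i%:R + 1) * h - (z + n%:~R * h - h / 2) = - ((i%:R + 2^-1) * h).
      by field.
    rewrite mulrDl !mul_sech; last 2 first.
    + by rewrite -subr_eq0 d2 oppr_eq0 gt_eqF.
    + by rewrite -subr_eq0 d1 gt_eqF.
    rewrite d1 d2 sinhN -sE.
    rewrite (_ : z + i%:R * h - _ + _ = z + n%:~R * h + - (i%:R + 1) * h); last by ring.
    rewrite (_ : z + i%:R * h + _ = z + n%:~R * h + i%:R * h); last by ring.
    by field; rewrite sE sinh_neq0 // gt_eqF.
  rewrite (_ : psum _ = fun N => \sum_(0 <= i < k) (s i)^-1 * psum (fun n => tanhR (z + i%:R * h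
    + n%:~R * h) - tanhR (z + i%:R * h - (2 * i + 1)%:R * h + n%:~R * h)) N); last first.
    apply/funext => N; rewrite (eq_psum _ E) psum_sum; apply: eq_bigr => i _; exact: psumZ.
  rewrite /c; elim: k {E} => [|k IH].
    by rewrite big_geq //; under eq_cvg do rewrite big_geq //; exact: cvg_cst.
  rewrite big_nat_recr //=; under eq_cvg do rewrite big_nat_recr //=.
  by apply: cvgD => //; apply: cvgM; [exact: cvg_cst|exact: lat_tanh_cvg].
- rewrite (_ : psum _ = fun N => Phi z * psum (lat (z - h / 2) (@sechR R)) N); last first.
    apply/funext => N; rewrite -psumZ; apply: eq_psum => n.
    by rewrite /lat Phi_shiftz addrAC.
  by apply: cvgM; [exact: cvg_cst|exact: cvg_Phi].
Qed.

End Lattice.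

Arguments cvg_Phi {R h} h0 z.

(** * Landen doubling and the case of large spacing *)

Section PhiMonotone.
Variable R : realType.
Implicit Types (h y z p q : R).

(** Even and odd sites: the window of size 2 N at spacing h is exactly the union of two windows of
    size N at spacing 2 h. *)
Lemma landen_add h z : 0 < h -> Phi h z = Phi (2 * h) z + Phi (2 * h) (z + h).
Proof.
move=> h0; have h20 : 0 < 2 * h by rewrite mulr_gt0.
have E N : psum (lat h z (@sechR R)) N.*2 =
    psum (lat (2 * h) z (@sechR R)) N + psum (lat (2 * h) (z + h) (@sechR R)) N.
  elim: N => [|N IH]; first by rewrite !psum0 addr0.
  rewrite doubleS !psumS IH /lat !NegzE !mulrNz -!pmulrn.
  rewrite -[N.*2.+2%:R]natr1 -[N.*2.+1%:R]natr1 -[N.+1%:R]natr1 -muln2 natrM.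
  have -> : z + N%:R * 2 * h = z + N%:R * (2 * h) by ring.
  have -> : z + - (N%:R * 2 + 1) * h = z + h + - (N%:R + 1) * (2 * h) by ring.
  have -> : z + (N%:R * 2 + 1) * h = z + h + N%:R * (2 * h) by ring.
  have -> : z + - (N%:R * 2 + 1 + 1) * h = z + - (N%:R + 1) * (2 * h) by ring.
  ring.
have h1 : psum (lat h z (@sechR R)) N.*2 @[N --> \oo] --> Phi h z.
  have dd : (fun N => N.*2) @ \oo --> \oo.
    move=> P [M _ HM]; exists M => // N /= MN.
    by apply: HM; rewrite /= -addnn; apply: leq_trans MN (leq_addr _ _).
  exact: cvg_comp dd (cvg_Phi h0 z).
apply: (cvg_unique _ h1) => //.
by rewrite /=; under eq_cvg do rewrite E; apply: cvgD; exact: cvg_Phi.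
Qed.

(** Two sites symmetric about a centre depend on q through cosh q alone, so that monotonicity in the
    site can be studied in one algebraic variable. *)
Lemma sech_pair p q : sechR (p + q) + sechR (p - q) =
  2 * coshR p * coshR q / (coshR p ^+ 2 + coshR q ^+ 2 - 1).
Proof.
rewrite /sechR !coshD coshN sinhN.
have e : (coshR p * coshR q + sinhR p * sinhR q) * (coshR p * coshR q + sinhR p * - sinhR q)
    = coshR p ^+ 2 + coshR q ^+ 2 - 1.
  have := cosh_sqr p; have := cosh_sqr q.
  move: (coshR p) (coshR q) (sinhR p) (sinhR q) => P Q A B eq ep.
  have -> : (P * Q + A * B) * (P * Q + A * - B) = P ^+ 2 * Q ^+ 2 - A ^+ 2 * B ^+ 2 by ring.
  have -> : A ^+ 2 = P ^+ 2 - 1 by lra.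
  have -> : B ^+ 2 = Q ^+ 2 - 1 by lra.
  ring.
rewrite -e; have := cosh_neq0 (p + q); have := cosh_neq0 (p - q).
rewrite !coshD coshN sinhN => a b; field.
by rewrite a.
Qed.

(** The sign is that of (b - a) (sinh^2 p - a b): a pair increases with cosh q only while a b stays
    below sinh^2 p. *)
Lemma sech_pair_diff (P a b : R) : 1 <= P -> 1 <= a -> 1 <= b ->
  2 * P * b / (P ^+ 2 + b ^+ 2 - 1) - 2 * P * a / (P ^+ 2 + a ^+ 2 - 1) =
  2 * P * (b - a) * (P ^+ 2 - 1 - a * b) / ((P ^+ 2 + a ^+ 2 - 1) * (P ^+ 2 + b ^+ 2 - 1)).
Proof.
by move=> P1 a1 b1; field; rewrite !gt_eqF //; nra.
Qed.

Definition Phi_decreasing h := forall y z, 0 <= y -> y < z -> z <= h / 2 ->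
  Phi h z < Phi h y.

Lemma Phi_decreasing_half h : 0 < h -> Phi_decreasing (2 * h) -> Phi_decreasing h.
Proof.
move=> h0 dec y z y0 yz zh; have h20 : 0 < 2 * h by rewrite mulr_gt0.
have [C HC] := landen_mul h20.
have hh : 2 * h / 2 = h by lra.
have E x : Phi (2 * h) (x + h) = C / Phi (2 * h) x.
  rewrite -(HC (x + h)) hh addrK; field; rewrite gt_eqF //; exact: Phi_gt0.
rewrite (landen_add y h0) (landen_add z h0) !E.
set a := Phi _ y; set b := Phi _ z.
have ab : b < a by apply: dec => //; lra.
have b0 : 0 < b by exact: Phi_gt0.
have Cb : C <= b * b.
  have -> : C = b * Phi (2 * h) (h - z).
    by rewrite -(HC z) hh -/b -(PhiN h20 (h - z)) opprB.
  rewrite (ler_wpM2l (ltW b0)) //.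
  have [e|zz] := eqVneq z (h - z); first by rewrite -e.
  by apply: ltW; apply: dec; lra.
rewrite -subr_gt0.
have -> : a + C / a - (b + C / b) = (a - b) * (a * b - C) / (a * b).
  by field; rewrite !gt_eqF //; lra.
by rewrite divr_gt0 ?mulr_gt0 //; nra.
Qed.

(** Limits keep only weak inequalities; the margin d, uniform in N, restores strictness. *)
Lemma ltr_lim (u v : nat -> R) a b d : 0 < d -> u @ \oo --> a -> v @ \oo --> b ->
  (forall N, (0 < N)%N -> u N + d <= v N) -> a < b.
Proof.
move=> d0 ua vb H; apply: (@lt_le_trans _ _ (a + d)); first lra.
have ud : u N + d @[N --> \oo] --> a + d by apply: cvgD => //; exact: cvg_cst.
apply: (ler_cvg_to ud vb).
by exists 1%N => // N /= N1; apply: H.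
Qed.

Section LargeSpacing.
Variable h : R.
(** The factor 16 serves two estimates: 4 exp 1 <= exp (h / 2) for sites beyond 1, and 4 q exp 2 < 1
    - q with q = exp (- h) for sites in [0, 1]. *)
Hypothesis hbig : 16 * expR 2 + 1 <= expR h.

Let e1 : 2 <= expR 1 :> R.
Proof. have := expR_ge1Dx (1 : R); lra. Qed.

Let h0 : 0 < h.
Proof. rewrite -expR_gt1; apply: lt_le_trans hbig; rewrite ltrDr.
by rewrite mulr_gt0 ?expR_gt0. Qed.

Let E2 : expR 2 = expR 1 * expR 1 :> R.
Proof. rewrite -expRD; congr expR; lra. Qed.

Let EX : expR h = expR (h / 2) * expR (h / 2).
Proof. rewrite -expRD; congr expR; lra. Qed.

Let X4 : 4 * expR 1 <= expR (h / 2).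
Proof. have := hbig; rewrite E2 EX; have := expR_gt0 (h / 2); have := e1; nra. Qed.

(** With centre distance p = (i + 1/2) h and q = h / 2 - x every pair decreases separately, because
    x >= 1 keeps cosh q below sinh (h / 2). The first pair provides the margin. *)
Let far y z : 1 <= y -> y < z -> z <= h / 2 -> Phi h z < Phi h y.
Proof.
move=> y1 yz zh.
pose P i := coshR ((i%:R + 2^-1) * h); pose Q x := coshR (h / 2 - x).
have T x i : lat h x (@sechR R) (Posz i) + lat h x (@sechR R) (Negz i) =
    2 * P i * Q x / (P i ^+ 2 + Q x ^+ 2 - 1).
  rewrite -sech_pair addrC /lat NegzE mulrNz -[X in X + _ = _]sechN; congr (sechR _ + sechR _).
    by rewrite -pmulrn -[i.+1%:R]natr1; lra.
  by rewrite /=; lra.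
have P1 i : 1 <= P i by exact: cosh_ge1.
have Q1 x : 1 <= Q x by exact: cosh_ge1.
have Qyz : Q z < Q y by apply: ltr_cosh; lra.
have Q0P : Q y ^+ 2 <= P 0%N ^+ 2 - 1.
  have -> : P 0%N ^+ 2 - 1 = sinhR ((0%:R + 2^-1) * h) ^+ 2 by rewrite /P cosh_sqr; ring.
  suff : Q y <= sinhR ((0%:R + 2^-1) * h) by have := Q1 y; nra.
  apply: (@le_trans _ _ (coshR (h / 2 - 1))); first by apply: ler_cosh; lra.
  rewrite /coshR /sinhR add0r [2^-1 * h]mulrC expRD opprB expRD.
  have := expRNK (h / 2); have := expRNK (1 : R); have := X4; have := e1.
  move: (expR 1) (expR (-1)) (expR (h / 2)) (expR (- (h / 2))) => a a' X Y a2 aX XY aa.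
  have a'h : a' <= 1 / 2 by nra.
  have Yh : Y <= 1 / 8 by nra.
  have aY : a * Y <= 1 / 4 by nra.
  have Xa' : X * a' <= X / 2 by nra.
  lra.
have PP i : P 0%N <= P i.
  apply: ler_cosh; first by rewrite add0r mulr_ge0 ?invr_ge0 ?ltW.
  by rewrite ler_pM2r // lerD2r ler0n.
have QP i : Q z * Q y < P i ^+ 2 - 1.
  have := PP i; have := P1 0%N; have := P1 i; have := Q1 z; nra.
pose D i := 2 * P i * Q y / (P i ^+ 2 + Q y ^+ 2 - 1) - 2 * P i * Q z / (P i ^+ 2 + Q z ^+ 2 - 1).
have D0 i : 0 < D i.
  rewrite /D sech_pair_diff //; have := P1 i; have := Q1 y; have := Q1 z.
  have := QP i => qp a b c.
  have pa : 0 < P i ^+ 2 + Q z ^+ 2 - 1 by nra.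
  have pb : 0 < P i ^+ 2 + Q y ^+ 2 - 1 by nra.
  rewrite divr_gt0 ?(mulr_gt0 pa pb) // mulr_gt0 ?subr_gt0 // mulr_gt0 ?subr_gt0 //; lra.
apply: (ltr_lim (D0 0%N) (cvg_Phi h0 z) (cvg_Phi h0 y)) => N N0.
rewrite /psum; under eq_bigr do rewrite T; under [leRHS]eq_bigr do rewrite T.
case: N N0 => // N _; rewrite !big_nat_recl //= /D.
have : \sum_(0 <= i < N) 2 * P i.+1 * Q z / (P i.+1 ^+ 2 + Q z ^+ 2 - 1) <=
       \sum_(0 <= i < N) 2 * P i.+1 * Q y / (P i.+1 ^+ 2 + Q y ^+ 2 - 1).
  by apply: ler_sum => i _; have := D0 i.+1; rewrite /D; lra.
lra.
Qed.

(** Near 0 the sites are paired as x + (i + 1) h and x - (i + 1) h, leaving sech x alone. The pairs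
    may now increase, but by less than sech x decreases. *)
Let near y z : 0 <= y -> y < z -> z <= 1 -> Phi h z < Phi h y.
Proof.
move=> y0 yz z1.
pose P i := coshR (i.+1%:R * h); pose Q x := coshR x : R.
(* The extra term at N completes the window to -N, ..., N, symmetric about 0; it vanishes in the
   limit. *)
pose S x N := psum (lat h x (@sechR R)) N + sechR (x + N%:R * h).
have SE x N : S x N = sechR x + \sum_(0 <= i < N) 2 * P i * Q x / (P i ^+ 2 + Q x ^+ 2 - 1).
  elim: N => [|N IH]; first by rewrite /S psum0 big_geq // mul0r !addr0 add0r.
  rewrite big_nat_recr //= addrA -IH /S psumS -sech_pair /lat NegzE mulrNz -pmulrn.
  rewrite -(sechN (N.+1%:R * h - x)) opprB (addrC (N.+1%:R * h) x) mulNr; ring.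
have Scvg x : S x @ \oo --> Phi h x.
  by rewrite -[Phi h x]addr0; apply: cvgD; [exact: (cvg_Phi h0)|exact: (cvg_sech_pos h0)].
have P1 i : 1 <= P i by exact: cosh_ge1.
have Q1 x : 1 <= Q x by exact: cosh_ge1.
have Qyz : Q y < Q z by apply: ltr_cosh.
have Qe : Q z <= expR 1.
  apply: (@le_trans _ _ (coshR 1)); first by apply: ler_cosh; lra.
  rewrite /coshR; have := expRNK (1 : R); have := e1; have := expR_gt0 (-1 : R); nra.
have Pq i : (P i)^-1 <= 2 * expR (- h) ^+ i.+1.
  apply: (le_trans (sech_le_exp _)); rewrite -expRM_natr.
  by rewrite (_ : - (i.+1%:R * h) = - h * i.+1%:R) //; ring.
pose q := expR (- h).
have q1 : q * expR h = 1 by rewrite mulrC expRNK.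
have q0 : 0 < q by exact: expR_gt0.
have sP N : \sum_(0 <= i < N) (P i)^-1 <= 2 * q / (1 - q).
  apply: (@le_trans _ _ (\sum_(0 <= i < N) 2 * q ^+ i.+1)).
    by apply: ler_sum => i _; exact: Pq.
  have qq : q < 1 by rewrite /q expR_lt1 oppr_lt0.
  rewrite ler_pdivlMr ?subr_gt0 // -subr_ge0.
  have -> : 2 * q - (\sum_(0 <= i < N) 2 * q ^+ i.+1) * (1 - q) = 2 * q ^+ N.+1.
    elim: N => [|N IH]; first by rewrite big_geq //; ring.
    rewrite big_nat_recr //= [(_ + _) * (1 - q)]mulrDl opprD addrA IH.
    by rewrite (exprS q N.+1); ring.
  by rewrite mulr_ge0 ?exprn_ge0 ?ltW.
(* A pair grows at rate at most 2 / P in cosh q, since both denominators are at least P^2. *)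
have dP i : 2 * P i * Q z / (P i ^+ 2 + Q z ^+ 2 - 1) <=
    2 * P i * Q y / (P i ^+ 2 + Q y ^+ 2 - 1) + 2 * (Q z - Q y) * (P i)^-1.
  rewrite -lerBlDl sech_pair_diff //.
  have := P1 i; have := Q1 z; have := Q1 y => a b c.
  rewrite ler_pdivrMr; last by rewrite mulr_gt0 //; nra.
  have -> : 2 * (Q z - Q y) / P i * ((P i ^+ 2 + Q y ^+ 2 - 1) * (P i ^+ 2 + Q z ^+ 2 - 1)) =
     2 * (Q z - Q y) / P i * P i ^+ 4 + 2 * (Q z - Q y) / P i * (P i ^+ 2 * (Q y ^+ 2 - 1) + P i
       ^+ 2 * (Q z ^+ 2 - 1) + (Q y ^+ 2 - 1) * (Q z ^+ 2 - 1)) by ring.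
  have -> : 2 * (Q z - Q y) / P i * P i ^+ 4 = 2 * (Q z - Q y) * P i * P i ^+ 2.
    by field; rewrite gt_eqF //; lra.
  have : 0 <= 2 * (Q z - Q y) / P i * (P i ^+ 2 * (Q y ^+ 2 - 1) + P i ^+ 2 * (Q z ^+ 2 - 1) + (Q
    y ^+ 2 - 1) * (Q z ^+ 2 - 1)).
    have y2 : 0 <= Q y ^+ 2 - 1 by nra.
    have z2 : 0 <= Q z ^+ 2 - 1 by nra.
    apply: mulr_ge0; first by rewrite divr_ge0 //; lra.
    by rewrite !addr_ge0 // mulr_ge0 // sqr_ge0.
  have : 0 <= 2 * (Q z - Q y) * P i * (1 + Q y * Q z).
    by rewrite !mulr_ge0 //; nra.
  lra.
(* The decrease of the central term minus the geometric bound on the growth of all the pairs. *)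
pose d := (Q z - Q y) * ((Q y * Q z)^-1 - 4 * q / (1 - q)).
have qs : 16 * (expR 1 * expR 1) * q <= 1 - q.
  have := hbig; rewrite E2 -(ler_pM2l q0) q1; lra.
have qlt : 0 < 1 - q by have := expR_gt0 (1 : R); nra.
have d0 : 0 < d.
  have := Q1 y; have := Q1 z => a b; have ab : 0 < Q y * Q z by nra.
  rewrite /d mulr_gt0 ?subr_gt0 //.
  rewrite -subr_gt0 (_ : _ - _ = (1 - q - 4 * q * (Q y * Q z)) / (Q y * Q z * (1 - q))).
    rewrite divr_gt0 ?(mulr_gt0 ab) //.
    have : Q y * Q z <= expR 1 * expR 1 by nra.
    have : 0 < expR 1 * expR 1 :> R by rewrite mulr_gt0 ?expR_gt0.
    nra.
  by field; rewrite !gt_eqF //; lra.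
apply: (ltr_lim d0 (Scvg z) (Scvg y)) => N _; rewrite !SE.
have H : \sum_(0 <= i < N) 2 * P i * Q z / (P i ^+ 2 + Q z ^+ 2 - 1) <=
   \sum_(0 <= i < N) 2 * P i * Q y / (P i ^+ 2 + Q y ^+ 2 - 1) + 2 * (Q z - Q y) * \sum_(0 <= i <
     N) (P i)^-1.
  by rewrite big_distrr -big_split /=; apply: ler_sum => i _; exact: dP.
have : sechR y - sechR z = (Q z - Q y) / (Q y * Q z).
  by rewrite /sechR -/(Q y) -/(Q z); field; rewrite !gt_eqF //; have := Q1 y; have := Q1 z; lra.
have := sP N; rewrite -(@ler_pM2l _ (2 * (Q z - Q y))); last lra.
rewrite /d; lra.
Qed.

Lemma Phi_decreasing_large : Phi_decreasing h.
Proof.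
move=> y z y0 yz zh.
have [z1|z1] := leP z 1; first exact: near.
have [y1|y1] := leP 1 y; first exact: far.
by apply: (@lt_trans _ _ (Phi h 1)); [exact: far|apply: near => //; exact/ltW].
Qed.

End LargeSpacing.

(** Finitely many doublings reach the large-spacing case; the induction on their number m then
    descends back to h. *)
Lemma Phi_lt h y z : 0 < h -> 0 <= y -> y < z -> z <= h / 2 -> Phi h z < Phi h y.
Proof.
move=> h0.
suff H m g : 0 < g -> 16 * expR 2 + 1 <= expR (2 ^+ m * g) -> Phi_decreasing g.
  have [m Hm] : exists m : nat, 16 * expR 2 + 1 <= expR (2 ^+ m * h).
    exists (Num.bound ((16 * expR 2 + 1) / h)).
    apply: le_trans (expR_ge1Dx _).
    set x := _ / h; have := archi_boundP (x := x); set m := Num.bound x => hm.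
    have x0 : 0 <= x by rewrite divr_ge0 ?addr_ge0 ?mulr_ge0 ?expR_ge0 // ltW.
    have xm : x < 2 ^+ m.
      by apply: lt_trans (hm x0) _; rewrite -natrX ltr_nat ltn_expl.
    have : x * h = 16 * expR 2 + 1 by rewrite divfK // gt_eqF.
    by move: xm; rewrite -(ltr_pM2r h0); lra.
  exact: H Hm y z.
elim: m g => [|m IH] g g0 Hg; first by apply: Phi_decreasing_large; rewrite expr0 mul1r in Hg.
apply: Phi_decreasing_half => //; apply: IH; first by rewrite mulr_gt0.
by rewrite mulrA -exprSr.
Qed.

End PhiMonotone.

(** * The characteristic determinant *)

Section GeometricTails.
Variable R : realType.

Lemma geo_cvg (a : nat -> R) (C q : R) : 0 <= C -> 0 < q -> q < 1 ->
  (forall i, `|a i.+1 - a i| <= C * q ^+ i) ->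
  cvgn a /\ forall N, `|limn a - a N| <= C * q ^+ N / (1 - q).
Proof.
move=> C0 q0 q1 H; have q1' : 0 < 1 - q by rewrite subr_gt0.
have step N k : `|a (N + k)%N - a N| <= C * q ^+ N / (1 - q) - C * q ^+ (N + k) / (1 - q).
  elim: k => [|k IH]; first by rewrite addn0 !subrr normr0.
  rewrite addnS; have := ler_normD (a (N + k).+1 - a (N + k)%N) (a (N + k)%N - a N).
  rewrite addrA subrK; have := H (N + k)%N.
  have : C * q ^+ (N + k) / (1 - q) - C * q ^+ (N + k).+1 / (1 - q) = C * q ^+ (N + k).
    by rewrite exprS; field; rewrite gt_eqF.
  lra.
have step' N k : `|a (N + k)%N - a N| <= C * q ^+ N / (1 - q).
  apply: (le_trans (step N k)); rewrite gerBl divr_ge0 ?mulr_ge0 ?exprn_ge0 //; exact: ltW.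
have tail0 : C * q ^+ N / (1 - q) @[N --> \oo] --> (0 : R).
  rewrite -(mul0r (1 - q)^-1) -(mulr0 C).
  apply: cvgM; last exact: cvg_cst.
  apply: cvgM; first exact: cvg_cst.
  by apply: cvg_expr; rewrite ger0_norm ?ltW.
have ca : cvgn a.
  apply: cauchy_cvg; apply/cauchy_ballP => e e0.
  have e2 : 0 < e / 2 by lra.
  have /cvgrPdist_lt/(_ _ e2)[M _ HM] := tail0.
  near_simpl; exists ([set n | (M <= n)%N], [set n | (M <= n)%N]).
    by split; exists M.
  move=> [m n] /= [Mm Mn]; rewrite /ball /=.
  have h1 := step' M (m - M)%N; rewrite subnKC // in h1.
  have h2 := step' M (n - M)%N; rewrite subnKC // in h2.
  have := HM M (leqnn _); rewrite /= sub0r normrN ger0_norm; last first.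
    by rewrite divr_ge0 ?mulr_ge0 ?exprn_ge0 //; exact: ltW.
  have := ler_normB (a m - a M) (a n - a M); rewrite opprB addrA subrK; lra.
split => // N.
have : (fun k => `|a (N + k)%N - a N|) @ \oo --> `|limn a - a N|.
  apply: cvg_norm; apply: cvgB; last exact: cvg_cst.
  exact: cvg_comp (@cvg_addnl N) ca.
move=> h; apply: (closed_cvg (fun x => x <= _) (@closed_le _ _) _ _ h).
by apply: nearW => k; exact: step'.
Qed.

Lemma cvg_sum_nat (F : nat -> nat -> R) (l : nat -> R) n :
  (forall j, F j N @[N --> \oo] --> l j) ->
  \sum_(0 <= j < n) F j N @[N --> \oo] --> \sum_(0 <= j < n) l j.
Proof.
move=> H; elim: n => [|n IH].
  by rewrite big_geq // (_ : (fun N : nat => _) = fun=> 0); [exact: cvg_cst|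
    apply/funext => N; rewrite big_geq].
rewrite big_nat_recr //= (_ : (fun N : nat => _) = fun N => \sum_(0 <= j < n) F j N + F n N).
  exact: cvgD.
by apply/funext => N; rewrite big_nat_recr.
Qed.

End GeometricTails.

Section Continuant.
Variables (R : realType) (h : R).
Hypothesis h0 : 0 < h.
Implicit Types (A b z : R) (N : nat).

(* [KJ b A N z] is the pair (K, J) where K is the determinant of the N x N
   tridiagonal matrix with diagonal 1 - 2 A b sech(x) and off-diagonal products
   b^2 sech(x) sech(x - h) over the sites x = z, z - h, ..., z - (N-1) h, and
   J is sech(z) times the determinant with the first site removed. *)
Fixpoint KJ b A N z : R * R :=
  if N is N'.+1 then
    let p := KJ b A N' (z - h) in
    (p.1 - b * sechR z * (2 * A * p.1 + b * p.2), sechR z * p.1)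
  else (1, 0).

Definition K b A N z := (KJ b A N z).1.
Definition J b A N z := (KJ b A N z).2.

Lemma K0 b A z : K b A 0 z = 1. Proof. by []. Qed.
Lemma J0 b A z : J b A 0 z = 0. Proof. by []. Qed.
Lemma KS b A N z : K b A N.+1 z =
  K b A N (z - h) - b * sechR z * (2 * A * K b A N (z - h) + b * J b A N (z - h)).
Proof. by []. Qed.
Lemma JS b A N z : J b A N.+1 z = sechR z * K b A N (z - h).
Proof. by []. Qed.

(* Partial fractions.  The second function is obtained from the first by the
   sign change sech -> - sech, which encodes the parity in [A]. *)
Definition pfrac n (a : R) (f f' : R -> R) := exists be ga : nat -> R,
  (forall z, f z = a + \sum_(0 <= j < n)
     (be j * tanhR (z - j%:R * h) + ga j * sechR (z - j%:R * h))) /\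
  (forall z, f' z = a + \sum_(0 <= j < n)
     (be j * tanhR (z - j%:R * h) - ga j * sechR (z - j%:R * h))).

Lemma pfrac_cst n a : pfrac n a (fun=> a) (fun=> a).
Proof.
exists (fun=> 0), (fun=> 0); split => z; rewrite big1 ?addr0 // => i _; ring.
Qed.

Lemma pfracD n a a' f f' g g' c : pfrac n a f f' -> pfrac n a' g g' ->
  pfrac n (a + c * a') (fun z => f z + c * g z) (fun z => f' z + c * g' z).
Proof.
move=> [be [ga [Hf Hf']]] [be' [ga' [Hg Hg']]].
exists (fun j => be j + c * be' j), (fun j => ga j + c * ga' j).
split => z; rewrite ?(Hf, Hf') ?(Hg, Hg') mulrDr addrACA big_distrr -big_split /=;
  by congr (_ + _); apply: eq_bigr => j _; ring.
Qed.

Lemma shift_site z j : z - h - j%:R * h = z - j.+1%:R * h.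
Proof. by rewrite -[j.+1%:R]natr1; ring. Qed.

Lemma pfrac_shift n a f f' : pfrac n a f f' ->
  pfrac n.+1 a (fun z => f (z - h)) (fun z => f' (z - h)).
Proof.
move=> [be [ga [Hf Hf']]].
exists (fun j => if j is j'.+1 then be j' else 0), (fun j => if j is j'.+1 then ga j' else 0).
split => z; rewrite ?(Hf, Hf') big_nat_recl //= !mul0r ?(addr0, subr0) add0r;
  by congr (_ + _); apply: eq_bigr => j _; rewrite shift_site.
Qed.

Lemma sech_mul_tanh z j : sechR z * tanhR (z - j.+1%:R * h) =
  - (coshR (j.+1%:R * h) / sinhR (j.+1%:R * h)) * sechR z
  + (sinhR (j.+1%:R * h))^-1 * sechR (z - j.+1%:R * h).
Proof.
have p : 0 < j.+1%:R * h by rewrite mulr_gt0.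
have e : z - j.+1%:R * h - z = - (j.+1%:R * h) by ring.
rewrite mulrC mul_tanh_sech; last by rewrite -subr_eq0 e oppr_eq0 gt_eqF.
by rewrite e coshN sinhN; field; rewrite sinh_neq0 // gt_eqF.
Qed.

Lemma sech_mul_sech z j : sechR z * sechR (z - j.+1%:R * h) =
  (sinhR (j.+1%:R * h))^-1 * tanhR z
  - (sinhR (j.+1%:R * h))^-1 * tanhR (z - j.+1%:R * h).
Proof.
have p : 0 < j.+1%:R * h by rewrite mulr_gt0.
have e : z - (z - j.+1%:R * h) = j.+1%:R * h by ring.
rewrite mul_sech; last by rewrite -subr_eq0 e gt_eqF.
by rewrite e; field; rewrite sinh_neq0 // gt_eqF.
Qed.

(** Multiplication by sech sends constants and tanh terms to sech terms and sech terms to tanh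
    terms. The class is thus preserved and the two parities are exchanged, whence the sign on the
    companion function. *)
Lemma pfrac_mul_sech n a f f' : pfrac n a f f' ->
  pfrac n.+1 0 (fun z => sechR z * f (z - h)) (fun z => - (sechR z * f' (z - h))).
Proof.
move=> [be [ga [Hf Hf']]]; pose s j := (sinhR (j.+1%:R * h))^-1.
exists (fun j => if j is j'.+1 then - (ga j' * s j')
                 else \sum_(0 <= i < n) ga i * s i),
       (fun j => if j is j'.+1 then be j' * s j'
                 else a - \sum_(0 <= i < n) be i * (coshR (i.+1%:R * h) * s i)).
have E z i : sechR z * tanhR (z - h - i%:R * h) =
    - (coshR (i.+1%:R * h) * s i) * sechR z + s i * sechR (z - i.+1%:R * h).
  by rewrite shift_site sech_mul_tanh.
have E' z i : sechR z * sechR (z - h - i%:R * h) =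
    s i * tanhR z - s i * tanhR (z - i.+1%:R * h).
  by rewrite shift_site sech_mul_sech.
split => z; rewrite ?(Hf, Hf') big_nat_recl //= mul0r subr0 add0r {Hf Hf'}.
  elim: n => [|n IH]; first by rewrite !big_geq //; ring.
  rewrite !big_nat_recr //= addrA mulrDr IH mulrDr [_ * (be n * _)]mulrCA E.
  by rewrite [_ * (ga n * _)]mulrCA E'; ring.
elim: n => [|n IH]; first by rewrite !big_geq //; ring.
rewrite !big_nat_recr //= addrA mulrDr opprD IH mulrBr [_ * (be n * _)]mulrCA E.
by rewrite [_ * (ga n * _)]mulrCA E'; ring.
Qed.

Lemma pfrac_ext n a f f' g g' : pfrac n a f f' -> f =1 g -> f' =1 g' -> pfrac n a g g'.
Proof.
by move=> [be [ga [H H']]] e e'; exists be, ga; split => z; rewrite -?e -?e'.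
Qed.

(** Flip the sign of sech and of A together: in the recursion 2 A sech K keeps its sign, J changes
    sign, and so sech J keeps its sign. Hence K is fixed and J is negated. *)
Lemma pfrac_KJ b A N : exists a, pfrac N a (K b A N) (K b (- A) N) /\
  pfrac N 0 (J b A N) (fun z => - J b (- A) N z).
Proof.
elim: N => [|N [a [HK HJ]]].
  exists 1; split; first exact: pfrac_cst.
  by apply: pfrac_ext (pfrac_cst 0 0) _ _ => z //; rewrite J0 oppr0.
have HJ' := pfrac_mul_sech HJ; have HK' := pfrac_mul_sech HK.
exists a; split; last by apply: pfrac_ext HK' _ _ => z.
have := pfracD (- b * (2 * A)) (pfrac_shift HK) HK'.
move=> /(pfracD (- b * b))/(_ HJ'); rewrite !mulr0 !addr0 => H.
by apply: pfrac_ext H _ _ => z; rewrite KS; ring.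
Qed.

(** The increment caused by adjoining the site z at the front. The constant terms cancel, so these
    increments can be summed over the lattice, where they rebuild the full determinant minus 1. *)
Definition T b A N z := K b A N.+1 z - K b A N (z - h).

Lemma pfrac_T b A N : pfrac N.+1 0 (T b A N) (T b (- A) N).
Proof.
have [a [HK HJ]] := pfrac_KJ b A N.
have := pfracD (- b * b) (pfrac_cst N.+1 0) (pfrac_mul_sech HJ).
move=> /(pfracD (- b * (2 * A)))/(_ (pfrac_mul_sech HK)) H.
rewrite !mulr0 !addr0 in H.
by apply: pfrac_ext H _ _ => z; rewrite /T KS; ring.
Qed.

(** At + oo each tanh tends to 1 and each sech to 0, so decay forces the tanh coefficients to sum to
    0. The tanh part then telescopes to the constant c, and the sech part is a multiple g of [Phi];
    the companion differs only in the sign of g. *)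
Lemma pfrac_lat n f f' B : pfrac n 0 f f' -> (forall N, `|f (0 + N%:R * h)| <= B * sechR (0 +
  N%:R * h)) ->
  exists c g, forall z, psum (lat h z f) @ \oo --> c + g * Phi h z /\
                        psum (lat h z f') @ \oo --> c - g * Phi h z.
Proof.
move=> [be [ga [Hf Hf']]] dec.
have f0 : f (0 + N%:R * h) @[N --> \oo] --> (0 : R).
  apply/norm_cvg0P; apply: (@squeeze_cvgr _ _ _ _ (fun=> 0) (fun N => B * sechR (0 + N%:R * h))).
  - by apply: nearW => N; rewrite normr_ge0 dec.
  - exact: cvg_cst.
  - by rewrite -(mulr0 B); apply: cvgM; [exact: cvg_cst|exact: cvg_sech_pos].
have sb : \sum_(0 <= j < n) be j = 0.
  apply: (cvg_unique _ _ f0) => //.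
  rewrite /= (_ : (fun N : nat => _) = fun N : nat => \sum_(0 <= j < n)
     (be j * tanhR (- (j%:R * h) + N%:R * h) + ga j * sechR (- (j%:R * h) + N%:R * h))).
    apply: cvg_sum_nat => j.
    have L : be j * tanhR (- (j%:R * h) + N%:R * h) + ga j * sechR (- (j%:R * h) + N%:R * h)
        @[N --> \oo] --> be j * 1 + ga j * 0.
      apply: cvgD; apply: cvgM; try exact: cvg_cst.
        exact: cvg_tanh_pos.
      exact: cvg_sech_pos.
    by rewrite mulr1 mulr0 addr0 in L.
  apply/funext => N; rewrite Hf add0r; apply: eq_bigr => j _.
  by rewrite add0r (addrC (N%:R * h)).
pose F s z j m := be j * (tanhR (z - j%:R * h + m%:~R * h) - tanhR (z + m%:~R * h))
   + s * ga j * sechR (z - j%:R * h + m%:~R * h).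
have Fcvg s z : psum (fun m => \sum_(0 <= j < n) F s z j m) @ \oo -->
   \sum_(0 <= j < n) (- (be j * (2 * j%:R)) + s * ga j * Phi h z).
  rewrite (_ : psum _ = fun N => \sum_(0 <= j < n) psum (F s z j) N); last first.
    by apply/funext => N; rewrite psum_sum.
  apply: cvg_sum_nat => j.
  rewrite (_ : psum _ = fun N => - be j * psum (fun m => tanhR (z + m%:~R * h) - tanhR (z - j%:R
    * h + m%:~R * h)) N
     + s * ga j * psum (lat h (z - j%:R * h) (@sechR R)) N); last first.
    apply/funext => N; rewrite -!psumZ -psumD; apply: eq_psum => m; rewrite /F /lat; ring.
  rewrite -(mulNr (be j)); apply: cvgD; apply: cvgM; try exact: cvg_cst.
    exact: lat_tanh_cvg.
  by rewrite -(Phi_shiftn h0 z j); exact: cvg_Phi.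
exists (\sum_(0 <= j < n) - (be j * (2 * j%:R))), (\sum_(0 <= j < n) ga j) => z.
have E s (k : R -> R) : (forall z, k z = 0 + \sum_(0 <= j < n)
     (be j * tanhR (z - j%:R * h) + s * (ga j * sechR (z - j%:R * h)))) ->
   psum (lat h z k) @ \oo --> \sum_(0 <= j < n) - (be j * (2 * j%:R)) + s * (\sum_(0 <= j < n) ga
     j) * Phi h z.
  move=> Hk; rewrite (_ : psum _ = psum (fun m => \sum_(0 <= j < n) F s z j m)).
    by have := Fcvg s z; rewrite big_split /= -mulr_suml -mulr_sumr.
  apply/funext => N; apply: eq_psum => m; rewrite /lat Hk add0r.
  have e : \sum_(0 <= j < n) be j * tanhR (z + m%:~R * h) = 0 by rewrite -mulr_suml sb mul0r.
  apply/eqP; rewrite -subr_eq0 -sumrB; apply/eqP; apply: etrans e.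
  by apply: eq_bigr => j _; rewrite /F (addrAC z); ring.
split; first by rewrite -[X in X * _]mul1r; apply: E => x; rewrite Hf; congr (_ + _);
  apply: eq_bigr => j _; rewrite mul1r.
by rewrite -mulNr -mulN1r; apply: E => x; rewrite Hf'; congr (_ + _); apply: eq_bigr => j _;
  rewrite mulN1r.
Qed.

Definition ssum N z := \sum_(0 <= j < N) sechR (z - j%:R * h).

Lemma ssumS N z : ssum N.+1 z = sechR z + ssum N (z - h).
Proof.
rewrite /ssum big_nat_recl // mul0r subr0; congr (_ + _).
by apply: eq_bigr => j _; rewrite shift_site.
Qed.

Lemma ssum_le_Phi N z : ssum N z <= Phi h z.
Proof.
rewrite -(Phi_shift h0 z); apply: le_trans (psum_le_Phi h0 _ N).
apply: ler_sum => j _; rewrite /lat NegzE mulrNz -pmulrn mulNr.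
have -> : z + h - j.+1%:R * h = z - j%:R * h by rewrite -[j.+1%:R]natr1; ring.
by rewrite lerDr sech_ge0.
Qed.

Let q := expR (- h).
Let q0 : 0 < q. Proof. exact: expR_gt0. Qed.
Let q1 : q < 1. Proof. by rewrite /q expR_lt1 oppr_lt0. Qed.

Lemma sech_sub_le z j : sechR (z - j%:R * h) <= 2 * expR z * q ^+ j.
Proof.
rewrite -sechN; apply: (le_trans (sech_le_exp _)).
by rewrite opprK expRD -expRM_natr mulrA (_ : - (j%:R * h) = - h * j%:R) //; ring.
Qed.

Lemma sech_add_le z j : sechR (z + j%:R * h) <= 2 * expR (- z) * q ^+ j.
Proof. by rewrite -sechN opprD; exact: sech_sub_le. Qed.

Section Bounds.
Variables (b r : R).
Hypothesis b0 : 0 < b.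
Hypothesis r0 : 0 <= r.

(** For |A| <= r, one site at x enlarges the bound on (K, J) by a factor at most 1 + [kap] sech x <=
    exp ([kap] sech x), so the bounds multiply to an exponential of a sum of sech. *)
Definition kap := b * (2 * r + b).

Lemma kap_ge0 : 0 <= kap.
Proof. by rewrite /kap mulr_ge0 ?addr_ge0 ?mulr_ge0 // ltW. Qed.

Lemma step_bound A s k j E : `|A| <= r -> 0 <= s -> s <= 1 -> `|k| <= E -> `|j| <= E ->
  `|k - b * s * (2 * A * k + b * j)| <= expR (kap * s) * E.
Proof.
move=> Ar s0 s1 kE jE; have E0 : 0 <= E by exact: le_trans (normr_ge0 _) kE.
apply: (@le_trans _ _ (E * (1 + kap * s))); last first.
  by rewrite mulrC ler_wpM2r // expR_ge1Dx.
apply: (le_trans (ler_normB _ _)); rewrite !normrM (gtr0_norm b0) (ger0_norm s0).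
have : `|2 * A * k + b * j| <= 2 * r * E + b * E.
  apply: (le_trans (ler_normD _ _)); rewrite !normrM (gtr0_norm b0) normr_nat.
  by rewrite lerD ?ler_pM2l // -!mulrA ler_pM2l // ler_pM.
move=> /(ler_wpM2l (mulr_ge0 (ltW b0) s0)); rewrite /kap; lra.
Qed.

Lemma expR_ge1 x : 0 <= x -> 1 <= expR x :> R.
Proof. by move=> x0; apply: le_trans (expR_ge1Dx x); rewrite lerDl. Qed.

Lemma expR_ssumS N z :
  expR (kap * ssum N.+1 z) = expR (kap * sechR z) * expR (kap * ssum N (z - h)).
Proof. by rewrite ssumS [kap * (_ + _)]mulrDr expRD. Qed.

Lemma KJ_bound A N z : `|A| <= r ->
  `|K b A N z| <= expR (kap * ssum N z) /\ `|J b A N z| <= expR (kap * ssum N z).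
Proof.
move=> Ar; elim: N z => [|N IH] z.
  by rewrite K0 J0 normr1 normr0 /ssum big_geq // mulr0 expR0.
have [HK HJ] := IH (z - h); rewrite KS JS expR_ssumS; split.
  by apply: step_bound => //; [exact: sech_ge0|exact: sech_le1].
rewrite normrM (ger0_norm (sech_ge0 z)) ler_pM //; first exact: sech_ge0.
by apply: (le_trans (sech_le1 z)); apply: expR_ge1; rewrite mulr_ge0 ?kap_ge0 ?sech_ge0.
Qed.

(** The recursion is linear, so the effect of one more site at the far end is carried through the N
    steps with the same growth factors. *)
Lemma KJ_diff_bound A N z : `|A| <= r ->
  `|K b A N.+1 z - K b A N z| <= expR (kap * ssum N z) * ((1 + kap) * sechR (z - N%:R * h)) /\
  `|J b A N.+1 z - J b A N z| <= expR (kap * ssum N z) * ((1 + kap) * sechR (z - N%:R * h)).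
Proof.
move=> Ar; have k0 := kap_ge0; elim: N z => [|N IH] z.
  rewrite /ssum big_geq // mulr0 expR0 mul1r mul0r subr0 KS JS !K0 !J0.
  have s0 := sech_ge0 z; split.
    rewrite mulr0 addr0 mulr1 addrAC subrr add0r normrN !normrM (gtr0_norm b0) (ger0_norm s0).
    rewrite normr_nat mulrAC ler_wpM2r // /kap.
    have : b * (2 * `|A|) <= b * (2 * r) by rewrite !ler_pM2l.
    have : 0 <= b * b by rewrite mulr_ge0 // ltW.
    lra.
  by rewrite mulr1 subr0 (ger0_norm s0) ler_peMl // lerDl.
have [HK HJ] := IH (z - h); rewrite shift_site in HK HJ.
rewrite expR_ssumS -mulrA (KS b A N.+1 z) (KS b A N z) (JS b A N.+1 z) (JS b A N z); split.
  rewrite (_ : _ - _ = K b A N.+1 (z - h) - K b A N (z - h) - b * sechR z *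
    (2 * A * (K b A N.+1 (z - h) - K b A N (z - h)) + b * (J b A N.+1 (z - h) - J b A N (z -
      h))));
    last by ring.
  by apply: step_bound => //; [exact: sech_ge0|exact: sech_le1].
rewrite -mulrBr normrM (ger0_norm (sech_ge0 z)) ler_pM //; first exact: sech_ge0.
by apply: (le_trans (sech_le1 z)); apply: expR_ge1; rewrite mulr_ge0 ?sech_ge0.
Qed.

(** A bound uniform in N; being h-periodic, it is also uniform along a lattice. *)
Definition Bd z := expR (kap * Phi h z).

Lemma expR_ssum_le N z : expR (kap * ssum N z) <= Bd z.
Proof. by rewrite ler_expR ler_wpM2l ?kap_ge0 // ssum_le_Phi. Qed.

(** The factor exp z matters beyond convergence in N: it makes the error at N = 0 vanish as z tends
    to - oo, which gives the limit 1 there. *)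
Lemma K_geo A z : `|A| <= r -> cvgn (fun N => K b A N z) /\ forall N,
  `|limn (fun N => K b A N z) - K b A N z| <= (1 + kap) * Bd z * (2 * expR z) * q ^+ N / (1 - q).
Proof.
move=> Ar; have k0 := kap_ge0; apply: geo_cvg => //.
  by rewrite !mulr_ge0 ?addr_ge0 ?expR_ge0.
move=> N; apply: (le_trans (KJ_diff_bound N z Ar).1).
have a := sech_sub_le z N; have c := expR_ssum_le N z.
rewrite [leRHS](_ : _ = Bd z * ((1 + kap) * (2 * expR z * q ^+ N))); last by ring.
apply: ler_pM; rewrite ?expR_ge0 ?mulr_ge0 ?sech_ge0 ?addr_ge0 //.
by rewrite ler_wpM2l // addr_ge0.
Qed.

Lemma T_bound A N z : `|A| <= r -> `|T b A N z| <= kap * Bd z * sechR z.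
Proof.
move=> Ar; rewrite /T KS addrAC subrr add0r normrN.
have [HK HJ] := KJ_bound N (z - h) Ar.
have Bz : Bd (z - h) = Bd z by rewrite /Bd -(Phi_shift h0 (z - h)) subrK.
have := le_trans HK (expR_ssum_le N (z - h)); have := le_trans HJ (expR_ssum_le N (z - h)).
rewrite Bz => hJ hK; rewrite !normrM (gtr0_norm b0) (ger0_norm (sech_ge0 z)).
rewrite [leRHS](_ : _ = b * sechR z * ((2 * r + b) * Bd z)); last by rewrite /kap; ring.
apply: ler_wpM2l; first exact: mulr_ge0 (ltW b0) (sech_ge0 z).
apply: (le_trans (ler_normD _ _)); rewrite !normrM (gtr0_norm b0) normr_nat.
have e1 := ler_pM (normr_ge0 _) (normr_ge0 _) Ar hK.
have e2 := ler_wpM2l (ltW b0) hJ.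
rewrite [leRHS]mulrDl -!mulrA; apply: lerD; last exact: e2.
by apply: ler_wpM2l; [exact: ler0n|exact: e1].
Qed.

End Bounds.

Section Limits.
Variable b : R.
Hypothesis b0 : 0 < b.

(* [P A z] is the determinant over the sites z - j h, j >= 0, and [D A z], which
   is h-periodic in z, the one over the whole lattice. *)
Definition P A z := limn (fun N => K b A N z).

Lemma cvg_K A z : K b A N z @[N --> \oo] --> P A z.
Proof. exact: (K_geo b0 (normr_ge0 A) z (lexx _)).1. Qed.

Arguments cvg_K : clear implicits.

Lemma Bd_ge0 r z : 0 <= Bd b r z.
Proof. exact: expR_ge0. Qed.

Lemma P_rec A z : P A z = P A (z - h)
  - b * sechR z * (2 * A * P A (z - h) + b * (sechR (z - h) * P A (z - h - h))).
Proof.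
have l1 : K b A (2 + N) z @[N --> \oo] --> P A z by exact: cvg_comp (@cvg_addnl 2) (cvg_K A z).
have l2 : K b A (1 + N) (z - h) @[N --> \oo] --> P A (z - h).
  exact: cvg_comp (@cvg_addnl 1) (cvg_K A (z - h)).
apply: (cvg_unique _ l1) => //=.
rewrite (_ : (fun N => _) = fun N => K b A (1 + N) (z - h) - b * sechR z *
   (2 * A * K b A (1 + N) (z - h) + b * (sechR (z - h) * K b A N (z - h - h)))) //.
apply: cvgB; first exact: l2.
apply: cvgM; first exact: cvg_cst.
apply: cvgD; apply: cvgM; try exact: cvg_cst; first exact: l2.
by apply: cvgM; [exact: cvg_cst|exact: cvg_K].
Qed.

Lemma cvg_T A z : T b A N z @[N --> \oo] --> P A z - P A (z - h).
Proof.
apply: cvgB; last exact: cvg_K.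
exact: cvg_comp (@cvg_addnl 1) (cvg_K A z).
Qed.

Lemma P_diff_bound (r : R) A z : `|A| <= r -> `|P A z - P A (z - h)| <= kap b r * Bd b r z *
  sechR z.
Proof.
move=> Ar; have r0 : 0 <= r := le_trans (normr_ge0 A) Ar.
apply: (closed_cvg (fun x => x <= _) (@closed_le _ _) _ _ (cvg_norm (@cvg_T A z))).
by apply: nearW => N; exact: T_bound.
Qed.

Lemma Bd_shiftz r z n : Bd b r (z + n%:~R * h) = Bd b r z.
Proof. by rewrite /Bd Phi_shiftz. Qed.

Lemma Bd_shiftN r z (n : nat) : Bd b r (z - n%:R * h) = Bd b r z.
Proof. by rewrite /Bd Phi_shiftn. Qed.

Definition D A z := limn (fun n => P A (z - h + n%:R * h)).

Lemma P_geo (r : R) A z : `|A| <= r -> cvgn (fun n => P A (z - h + n%:R * h)) /\ forall N,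
  `|D A z - P A (z - h + N%:R * h)| <= kap b r * Bd b r z * (2 * expR (- z)) * q ^+ N / (1 - q).
Proof.
move=> Ar; have r0 : 0 <= r := le_trans (normr_ge0 A) Ar.
have k0 := kap_ge0 b0 r0; apply: geo_cvg => //.
  by rewrite (mulr_ge0 (mulr_ge0 k0 (Bd_ge0 _ _))) // mulr_ge0 ?expR_ge0.
move=> N; have := P_diff_bound (z + N%:R * h) Ar.
rewrite -[N%:R]/(N%:~R) Bd_shiftz.
have -> : z + N%:R * h - h = z - h + N%:R * h by ring.
have -> : z - h + N.+1%:R * h = z + N%:R * h by rewrite -[N.+1%:R]natr1; ring.
move=> /le_trans; apply; rewrite -[leRHS]mulrA.
by apply: ler_wpM2l; [exact: mulr_ge0 k0 (Bd_ge0 _ _)|exact: sech_add_le].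
Qed.

Lemma cvg_D A z : P A (z - h + n%:R * h) @[n --> \oo] --> D A z.
Proof. exact: (P_geo z (lexx `|A|)).1. Qed.

Lemma P_neg A z : P A (z - N%:R * h) @[N --> \oo] --> (1 : R).
Proof.
have k0 := kap_ge0 b0 (normr_ge0 A).
pose C := (1 + kap b `|A|) * Bd b `|A| z * 2 / (1 - q).
apply/subr_cvg0/norm_cvg0P.
apply: (@squeeze_cvgr _ _ _ _ (fun=> 0) (fun N => C * expR (- (- z + N%:R * h)))).
- apply: nearW => N; rewrite normr_ge0 /=.
  have [_ /(_ 0%N)] := K_geo b0 (normr_ge0 A) (z - N%:R * h) (lexx _).
  by rewrite K0 expr0 Bd_shiftN /C opprD opprK => /le_trans; apply; lra.
- exact: cvg_cst.
- by rewrite -(mulr0 C); apply: cvgM; [exact: cvg_cst|exact: cvg_expNh].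
Qed.

Lemma lat_P_cvg A z : psum (lat h z (fun x => P A x - P A (x - h))) @ \oo --> D A z - 1.
Proof.
pose f n := P A (z - h + n%:~R * h).
rewrite (_ : psum _ = fun N => f (Posz N) - f (- Posz N)).
  apply: cvgB; first exact: cvg_D.
  rewrite /f (_ : (fun N : nat => _) = fun N : nat => P A (z - h - N%:R * h)); first exact: P_neg.
  by apply/funext => N; rewrite mulrNz mulNr.
apply/funext => N; rewrite -psum_telescope; apply: eq_psum => n.
by rewrite /f /lat intrD; congr (P A _ - P A _); ring.
Qed.

Arguments lat_P_cvg : clear implicits.

(** The lattice sums of [T] have the form c_N + g_N Phi at A and c_N - g_N Phi at - A, and by
    dominated convergence they tend to the determinants minus 1. Half sums and half differences
    isolate c_N and g_N; these sequences do not involve z, hence neither do their limits. *)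
Lemma D_affine A : exists F G, forall z, D A z = F + G * Phi h z /\ D (- A) z = F - G * Phi h z.
Proof.
have H N : exists cg : R * R, forall z,
    psum (lat h z (T b A N)) @ \oo --> cg.1 + cg.2 * Phi h z /\
    psum (lat h z (T b (- A) N)) @ \oo --> cg.1 - cg.2 * Phi h z.
  have [|c [g cgH]] := pfrac_lat (B := kap b `|A| * Bd b `|A| 0) (pfrac_T b A N).
    move=> n; rewrite -[n%:R]/(n%:~R) -(Bd_shiftz _ 0 n); exact: T_bound.
  by exists (c, g).
have [cg Hcg] := choice H.
have L A' (s : nat -> R) z : `|A'| <= `|A| ->
    (forall N, psum (lat h z (T b A' N)) @ \oo --> s N) -> s @ \oo --> D A' z - 1.
  move=> hA' Hs; apply: (@tannery _ (fun N => lat h z (T b A' N)) (lat h z (fun x => P A' x - P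
    A' (x - h)))
     (fun n => kap b `|A| * Bd b `|A| z * lat h z (@sechR R) n) _ _ _ _ _ Hs (lat_P_cvg A' z)).
  - apply: bsumZ; last exact: bsum_sech.
    by rewrite mulr_ge0 ?expR_ge0 // kap_ge0.
  - by move=> N n; rewrite /lat -(Bd_shiftz _ z n); exact: T_bound.
  - by move=> n; exact: cvg_T.
have L1 z : (cg N).1 + (cg N).2 * Phi h z @[N --> \oo] --> D A z - 1.
  by apply: L => // N; exact: (Hcg N z).1.
have L2 z : (cg N).1 - (cg N).2 * Phi h z @[N --> \oo] --> D (- A) z - 1.
  by apply: L; rewrite ?normrN // => N; exact: (Hcg N z).2.
have Lc z : (cg N).1 @[N --> \oo] --> (D A z + D (- A) z) / 2 - 1.
  have : ((cg N).1 + (cg N).2 * Phi h z + ((cg N).1 - (cg N).2 * Phi h z)) * 2^-1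
      @[N --> \oo] --> (D A z - 1 + (D (- A) z - 1)) * 2^-1.
    by apply: cvgM; [apply: cvgD|exact: cvg_cst].
  rewrite (_ : (D A z + D (- A) z) / 2 - 1 = (D A z - 1 + (D (- A) z - 1)) / 2); last by lra.
  rewrite (_ : (fun N : nat => (cg N).1) = (fun N : nat => ((cg N).1 + (cg N).2 * Phi h z + ((cg
    N).1 - (cg N).2 * Phi h z)) * 2^-1)) //.
  by apply/funext => N; lra.
have Lg z : (cg N).2 @[N --> \oo] --> (D A z - D (- A) z) / 2 / Phi h z.
  have p := Phi_gt0 h0 z.
  have : ((cg N).1 + (cg N).2 * Phi h z - ((cg N).1 - (cg N).2 * Phi h z)) * (2 * Phi h z)^-1
      @[N --> \oo] --> (D A z - 1 - (D (- A) z - 1)) * (2 * Phi h z)^-1.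
    by apply: cvgM; [apply: cvgB|exact: cvg_cst].
  rewrite (_ : (D A z - D (- A) z) / 2 / Phi h z = (D A z - 1 - (D (- A) z - 1)) / (2 * Phi h
    z)); last first.
    by field; rewrite gt_eqF.
  rewrite (_ : (fun N : nat => (cg N).2) = (fun N : nat => ((cg N).1 + (cg N).2 * Phi h z - ((cg
    N).1 - (cg N).2 * Phi h z)) * (2 * Phi h z)^-1)) //.
  by apply/funext => N; field; rewrite gt_eqF.
exists ((D A 0 + D (- A) 0) / 2), ((D A 0 - D (- A) 0) / 2 / Phi h 0) => z.
have e1 : (D A 0 + D (- A) 0) / 2 - 1 = (D A z + D (- A) z) / 2 - 1.
  exact: (cvg_unique _ (Lc 0) (Lc z)).
have e2 : (D A 0 - D (- A) 0) / 2 / Phi h 0 = (D A z - D (- A) z) / 2 / Phi h z.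
  exact: (cvg_unique _ (Lg 0) (Lg z)).
rewrite e2 divfK ?gt_eqF ?Phi_gt0 //; move: e1 {e2 Lg Lc L1 L2 L Hcg H}.
by move: (D A 0) (D (- A) 0) (D A z) (D (- A) z) => x y u v; split; lra.
Qed.

Lemma continuous_KJ N z : continuous (fun A => K b A N z) /\ continuous (fun A => J b A N z).
Proof.
elim: N z => [|N IH] z; first by split => A; exact: cvg_cst.
have [cK cJ] := IH (z - h); split => A.
  apply: cvgB; first exact: cK.
  apply: cvgM; first exact: cvg_cst.
  apply: cvgD; apply: cvgM; [|exact: cK|exact: cvg_cst|exact: cJ].
  by apply: cvgM; [exact: cvg_cst|exact: cvg_id].
by apply: cvgM; [exact: cvg_cst|exact: cK].
Qed.

(** For |A| <= r the geometric bounds are uniform in A, so [D] is locally a uniform limit of the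
    polynomials K in A. *)
Lemma continuous_D z : continuous (fun A => D A z).
Proof.
move=> A0; apply/cvgrPdist_le => e e0; pose r := `|A0| + 1.
have r0 : 0 <= r by rewrite /r addr_ge0.
have small C : 0 <= C -> exists N, C * q ^+ N / (1 - q) <= e / 5.
  move=> C0; have : C * q ^+ N / (1 - q) @[N --> \oo] --> (0 : R).
    rewrite -(mul0r (1 - q)^-1) -(mulr0 C).
    apply: cvgM; last exact: cvg_cst.
    apply: cvgM; first exact: cvg_cst.
    by apply: cvg_expr; rewrite ger0_norm ?ltW.
  have e5 : 0 < e / 5 by lra.
  move=> /cvgrPdist_le/(_ _ e5)[M _ HM]; exists M.
  have := HM M (leqnn _); rewrite /= sub0r normrN; apply: le_trans; exact: ler_norm.
have k0 := kap_ge0 b0 r0.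
have [|n Hn] := small (kap b r * Bd b r z * (2 * expR (- z))).
  by rewrite (mulr_ge0 (mulr_ge0 k0 (Bd_ge0 _ _))) // mulr_ge0 ?expR_ge0.
set w := z - h + n%:R * h.
have [|N HN] := small ((1 + kap b r) * Bd b r w * (2 * expR w)).
  by rewrite !mulr_ge0 ?addr_ge0 ?expR_ge0 ?Bd_ge0.
have close A : `|A| <= r -> `|D A z - K b A N w| <= e / 5 + e / 5.
  move=> Ar; have [_ /(_ n) h1] := P_geo z Ar; have [_ /(_ N) h2] := K_geo b0 r0 w Ar.
  rewrite -(subrK (P A w) (D A z)) -addrA; apply: le_trans (ler_normD _ _) _.
  exact: lerD (le_trans h1 Hn) (le_trans h2 HN).
have e5 : 0 < e / 5 by rewrite divr_gt0.
clear Hn HN k0 small.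
have /cvgrPdist_le/(_ _ e5) cK := (continuous_KJ N w).1 A0.
near=> A.
have Ar : `|A| <= r.
  have : `|A0 - A| < 1 by near: A; exact: (@nbhsx_ballx _ _ A0 1).
  have := ler_normB A0 (A0 - A); rewrite opprB addrC subrK /r; lra.
have h1 := close A Ar; have h2 : `|D A0 z - K b A0 N w| <= e / 5 + e / 5.
  by apply: close; rewrite /r lerDl.
have h3 : `|K b A0 N w - K b A N w| <= e / 5 by near: A.
have := ler_normD (D A0 z - K b A0 N w) (K b A0 N w - K b A N w); rewrite addrA subrK.
have := ler_normB (D A0 z - K b A N w) (D A z - K b A N w); rewrite opprB addrA subrK.
lra.
Unshelve. all: by end_near. Qed.

End Limits.
End Continuant.

(** * Eigenvectors and the determinant *)

Section BoundedSequences.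
Variable R : realType.

Lemma eventually_nonincreasing_bounded (a : nat -> R) N :
  (forall n, (N <= n)%N -> a n.+1 <= a n) -> exists M, forall n, a n <= M.
Proof.
move=> H.
have [M HM] : exists M, forall n, (n <= N)%N -> a n <= M.
  elim: N {H} => [|N [M HM]]; first by exists (a 0%N) => n; rewrite leqn0 => /eqP ->.
  exists (Num.max M (a N.+1)) => n; rewrite leq_eqVlt ltnS le_max.
  by case/predU1P => [->|/HM ->]; rewrite ?lexx ?orbT.
exists M; elim=> [|n IH]; first exact: HM.
by have [/HM//|nN] := leqP n.+1 N; apply: le_trans (H n _) IH; rewrite -ltnS.
Qed.

Lemma geo_small (C q e : R) : 0 < q -> q < 1 -> 0 < e -> 0 <= C ->
  exists N, forall n, (N <= n)%N -> C * q ^+ n / (1 - q) <= e.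
Proof.
move=> q0 q1 e0 C0; have : C * q ^+ N / (1 - q) @[N --> \oo] --> (0 : R).
  rewrite -(mul0r (1 - q)^-1) -(mulr0 C).
  apply: cvgM; last exact: cvg_cst.
  apply: cvgM; first exact: cvg_cst.
  by apply: cvg_expr; rewrite ger0_norm ?ltW.
move=> /cvgrPdist_le/(_ _ e0)[M _ HM]; exists M => n Mn.
have := HM n Mn; rewrite /= sub0r normrN; apply: le_trans; exact: ler_norm.
Qed.

(** One factor of the Weierstrass inequality: a product of terms 1 - c_i is at least 1 minus their
    sum, the sum being controlled by a telescoping majorant. *)
Lemma shrink_step (a b d c x y : R) : c <= b - d -> 0 <= c -> c <= 1 ->
  0 <= a - b -> 0 <= x -> (1 - (a - b)) * x <= y -> (1 - (a - d)) * x <= (1 - c) * y.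
Proof.
move=> cbd c0 c1 ab x0 xy.
have h : (1 - c) * ((1 - (a - b)) * x) <= (1 - c) * y by rewrite ler_wpM2l // subr_ge0.
by apply: le_trans h; rewrite mulrA ler_wpM2r //; nra.
Qed.

End BoundedSequences.

Section Eigen.
Variables (R : realType) (h : R).
Hypothesis h0 : 0 < h.
Implicit Types (z A mu : R) (u v w : int -> R) (n : int).

(* With u_n = gamma_n x_n the eigenvalue equation H(k; A) x = lambda x becomes
   the recurrence [sol], where z = pi k, h = pi omega, lambda = C mu and
   |gamma_n|^2 = C / cosh (z + n h). *)
Definition sol z A mu u := forall n,
  u (n + 1) + u (n - 1) + 2 * A * u n = 2 * mu * coshR (z + n%:~R * h) * u n.

(** As |x_n|^2 is proportional to cosh (z + n h) u_n^2, the weight makes this the square summability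
    of x. *)
Definition l2 z u := bsum (fun n => coshR (z + n%:~R * h) * u n ^+ 2).

Definition eigvec z A mu u := [/\ exists n, u n != 0, l2 z u & sol z A mu u].

Definition eigval z A mu := exists u, eigvec z A mu u.

Lemma solB z A mu u v c : sol z A mu u -> sol z A mu v ->
  sol z A mu (fun n => v n - c * u n).
Proof. by move=> su sv n; have := congr1 ( *%R c) (su n); have := sv n; lra. Qed.

(** The right side of the recurrence carries a cosh while the left side is bounded. Thus for
    solutions boundedness already implies decay like sech, and in particular membership in [l2]. *)
Lemma sol_decay z A mu u (M : R) : 0 < mu -> sol z A mu u -> (forall n, `|u n| <= M) ->
  forall n, `|u n| <= (1 + `|A|) * M / mu * sechR (z + n%:~R * h).
Proof.
move=> mu0 su uM n; have c0 := cosh_gt0 (z + n%:~R * h).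
rewrite /sechR ler_pdivlMr // ler_pdivlMr // -(ler_pM2l (x := 2)) //.
have -> : 2 * (`|u n| * coshR (z + n%:~R * h) * mu) = `|2 * mu * coshR (z + n%:~R * h) * u n|.
  by rewrite 3!normrM normr_nat (gtr0_norm mu0) (gtr0_norm c0); ring.
rewrite -su.
have a1 := uM (n + 1); have a2 := uM (n - 1).
have a3 : `|2 * A * u n| <= 2 * (`|A| * M).
  by rewrite !normrM normr_nat -mulrA ler_pM2l // ler_wpM2l.
have := ler_normD (u (n + 1) + u (n - 1)) (2 * A * u n).
have := ler_normD (u (n + 1)) (u (n - 1)); lra.
Qed.

Lemma l2_bounded z u : l2 z u -> exists M, forall n, `|u n| <= M.
Proof.
move=> [M HM]; exists (M + 1) => n.
have f0 m : 0 <= coshR (z + m%:~R * h) * u m ^+ 2.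
  by rewrite mulr_ge0 ?sqr_ge0 // ltW ?cosh_gt0.
have := bsum_term_le n f0 HM; have := cosh_ge1 (z + n%:~R * h).
rewrite -[u n ^+ 2]real_normK ?num_real // => c1 H.
have x2 : `|u n| ^+ 2 <= M by apply: le_trans H; rewrite ler_peMl ?sqr_ge0.
have := sqr_ge0 (`|u n| - 1); nra.
Qed.

Lemma bounded_l2 z A mu u (M : R) : 0 < mu -> sol z A mu u -> (forall n, `|u n| <= M) -> l2 z u.
Proof.
move=> mu0 su uM; have H := sol_decay mu0 su uM; set C := (1 + _) * M / mu in H.
apply: (bsum_le (g := fun n => C ^+ 2 * lat h z (@sechR R) n)); last first.
  by apply: bsumZ; [exact: sqr_ge0|exact: bsum_sech].
move=> n; have := H n; rewrite /lat.
have s0 := sech_gt0 (z + n%:~R * h); have : coshR (z + n%:~R * h) * sechR (z + n%:~R * h) = 1.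
  by rewrite mulfV // cosh_neq0.
have c0 := cosh_gt0 (z + n%:~R * h); rewrite -[u n ^+ 2]real_normK ?num_real //.
have := normr_ge0 (u n); move: `|u n| (coshR _) (sechR _) C c0 s0 {H} => x c s C c0 s0 x0 cs xC.
have x2 : x ^+ 2 <= (C * s) ^+ 2 by rewrite ler_sqr ?nnegrE // (le_trans x0).
apply: (le_trans (ler_wpM2l (ltW c0) x2)).
by rewrite exprMn mulrCA expr2 (mulrA c) cs mul1r lexx.
Qed.

Lemma sol_zero z A mu w m : sol z A mu w -> w m = 0 -> w (m + 1) = 0 -> forall n, w n = 0.
Proof.
move=> sw w0 w1.
have up (k : nat) : w (m + k%:Z) = 0 /\ w (m + k%:Z + 1) = 0.
  elim: k => [|k [a b]]; first by rewrite addr0.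
  have -> : m + k.+1%:Z = m + k%:Z + 1 by rewrite -addn1 PoszD addrA.
  by split => //; have := sw (m + k%:Z + 1); rewrite addrK a b; lra.
have dn (k : nat) : w (m - k%:Z) = 0 /\ w (m - k%:Z + 1) = 0.
  elim: k => [|k [a b]]; first by rewrite subr0.
  have e : m - k.+1%:Z + 1 = m - k%:Z by rewrite -addn1 PoszD; ring.
  have e' : m - k.+1%:Z = m - k%:Z - 1 by rewrite -e addrK.
  by rewrite e; split => //; have := sw (m - k%:Z); rewrite a b e'; lra.
move=> n; rewrite -(subrK m n) addrC; case: (n - m) => k; first exact: (up k).1.
by rewrite NegzE; exact: (dn k.+1).1.
Qed.

Lemma int_const (f : int -> R) : (forall n, f n = f (n - 1)) -> forall n, f n = f 0.
Proof.
move=> H; have up (k : nat) : f k%:Z = f 0.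
  elim: k => // k IH; rewrite H -IH; congr f; rewrite -addn1 PoszD; ring.
case=> // k; rewrite NegzE; elim: k => [|k IH]; first by rewrite (H 0) sub0r.
by rewrite -IH (H (- k.+1%:Z)); congr f; rewrite -(addn1 k.+1) (PoszD k.+1); ring.
Qed.

Lemma cvg_sech_Nposz z (C : R) : C * sechR (z + (- Posz N)%:~R * h) @[N --> \oo] --> (0 : R).
Proof.
rewrite -(mulr0 C); apply: cvgM; first exact: cvg_cst.
rewrite (_ : (fun N : nat => _) = fun N : nat => sechR (z - N%:R * h)).
  exact: cvg_sech_neg.
by apply/funext => N; rewrite mulrNz mulNr.
Qed.

(* The Wronskian of two solutions is constant, so it vanishes if one of them
   is bounded and the other one is bounded near -oo. *)
Lemma sol_proportional z A mu u v (M M' : R) : 0 < mu -> sol z A mu u -> sol z A mu v ->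
  (exists n, u n != 0) -> (forall n, `|u n| <= M) -> (forall N : nat, `|v (- N%:Z)| <= M') ->
  exists c, forall n, v n = c * u n.
Proof.
move=> mu0 su sv [m um] uM vM.
pose W n := u n * v (n + 1) - u (n + 1) * v n.
have Wc n : W n = W (n - 1).
  rewrite /W subrK; have := congr1 ( *%R (v n)) (su n).
  by have := congr1 ( *%R (u n)) (sv n); lra.
have W0 n : W n = 0.
  rewrite (int_const Wc).
  have l : W (- Posz N) @[N --> \oo] --> (0 : R).
    apply/norm_cvg0P; pose C := (1 + `|A|) * M / mu.
    apply: (@squeeze_cvgr _ _ _ _ (fun=> 0) (fun N : nat => C * M' * sechR (z + (- Posz N)%:~R *
      h) + C * M' * sechR (z - h + (- Posz N)%:~R * h))).
    - apply: nearW => N; rewrite normr_ge0 /= Wc /W subrK.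
      have a1 := sol_decay mu0 su uM (- Posz N).
      have a2 := sol_decay mu0 su uM (- Posz N - 1).
      have e : - Posz N - 1 = - Posz N.+1 by rewrite -addn1 PoszD; ring.
      have b1 := vM N; have := vM N.+1; rewrite -e => b2.
      have {a2}: `|u (- Posz N - 1)| <= C * sechR (z - h + (- Posz N)%:~R * h).
        have <- : z + (- Posz N - 1)%:~R * h = z - h + (- Posz N)%:~R * h by rewrite intrB; ring.
        exact: a2.
      move: a1; rewrite -/C => a1 a2.
      apply: (le_trans (ler_normB _ _)); rewrite !normrM.
      rewrite addrC; apply: lerD; rewrite mulrAC; exact: ler_pM.
    - exact: cvg_cst.
    - by rewrite -[X in _ --> X]addr0; apply: cvgD; exact: cvg_sech_Nposz.
  apply: (cvg_unique _ _ l) => //; rewrite (_ : (fun N : nat => _) = fun=> W 0) //.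
    exact: cvg_cst.
  by apply/funext => N; exact: int_const.
exists (v m / u m) => n; apply/eqP; rewrite -subr_eq0; apply/eqP.
apply: (sol_zero (m := m) (solB (v m / u m) su sv)); first by rewrite divfK ?subrr.
apply: (mulfI um); rewrite mulr0; rewrite -[RHS](W0 m) /W; field.
exact: um.
Qed.

(** * The solution decaying at - oo and its coefficient of growth at + oo *)

Section Determinant.
Variables (z mu : R).
Hypothesis mu0 : 0 < mu.

Let b := (2 * mu)^-1.
Let b0 : 0 < b. Proof. by rewrite invr_gt0 mulr_gt0. Qed.
Let bE : b^-1 = 2 * mu. Proof. by rewrite invrK. Qed.
Let q := expR (- h).
Let q0 : 0 < q. Proof. exact: expR_gt0. Qed.
Let q1 : q < 1. Proof. by rewrite /q expR_lt1 oppr_lt0. Qed.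

Let ch n := coshR (z + n%:~R * h).

(** The solution of the leading-order recurrence v (n + 1) = 2 mu cosh (z + n h) v n with value 1 at
    0. *)
Definition weight n : R := match n with
  | Posz k => \prod_(0 <= j < k) (ch j / b)
  | Negz k => \prod_(0 <= j < k.+1) (b / ch (Negz j))
  end.

Lemma weight_gt0 n : 0 < weight n.
Proof. by case: n => k; apply: prodr_gt0 => j _; rewrite divr_gt0 ?cosh_gt0. Qed.

Lemma weightS n : weight (n + 1) = weight n * (ch n / b).
Proof.
case: n => [k|[|k]].
- have -> : Posz k + 1 = Posz k.+1 by rewrite -addn1.
  by rewrite /weight big_nat_recr.
- have -> : Negz 0 + 1 = 0 by [].
  have -> : weight 0 = 1 by rewrite -[0]/(Posz 0) /weight big_geq.
  have -> : weight (Negz 0) = b / ch (Negz 0) by rewrite /weight big_ltn // big_geq // mulr1.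
  by field; rewrite cosh_neq0 gt_eqF.
have -> : Negz k.+1 + 1 = Negz k by rewrite !NegzE -(addn1 k.+1) PoszD; ring.
rewrite /weight [in RHS]big_nat_recr //= -mulrA [X in _ * X](_ : _ = 1) ?mulr1 //.
by field; rewrite cosh_neq0 gt_eqF.
Qed.

Lemma weightV n : weight n * (b / ch (n - 1)) = weight (n - 1).
Proof.
have := weightS (n - 1); rewrite subrK => ->.
by field; rewrite cosh_neq0 gt_eqF.
Qed.

Lemma ch_large (C : R) : exists N0, forall n : nat, (N0 <= n)%N -> C <= ch n / b.
Proof.
pose C' := `|C| + 1.
have C0 : 0 < C' by rewrite ltr_wpDl.
have e0 : 0 < (b * C')^-1 by rewrite invr_gt0 mulr_gt0.
have K0 : 0 <= 2 * expR (- z) * (1 - q) by rewrite !mulr_ge0 ?expR_ge0 // subr_ge0 ltW.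
have [N HN] := geo_small q0 q1 e0 K0.
exists N => n /HN; rewrite mulrAC mulfK; last by rewrite subr_eq0 gt_eqF.
move=> H; have := le_trans (sech_add_le h z n) H.
rewrite /sechR lef_pV2 ?posrE ?cosh_gt0 ?(mulr_gt0 b0 C0) // => H'.
rewrite ler_pdivlMr // mulrC.
by apply: le_trans H'; rewrite ler_pM2l // /C'; have := ler_norm C; lra.
Qed.

Lemma ch_large_neg (C : R) : exists N0, forall n : nat, (N0 <= n)%N -> C <= ch (- n%:Z) / b.
Proof.
pose C' := `|C| + 1.
have C0 : 0 < C' by rewrite ltr_wpDl.
have e0 : 0 < (b * C')^-1 by rewrite invr_gt0 mulr_gt0.
have K0 : 0 <= 2 * expR z * (1 - q) by rewrite !mulr_ge0 ?expR_ge0 // subr_ge0 ltW.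
have [N HN] := geo_small q0 q1 e0 K0.
exists N => n /HN; rewrite mulrAC mulfK; last by rewrite subr_eq0 gt_eqF.
move=> H; have := le_trans (sech_sub_le h z n) H.
rewrite /sechR lef_pV2 ?posrE ?cosh_gt0 ?(mulr_gt0 b0 C0) // => H'.
rewrite ler_pdivlMr // mulrC /ch mulrNz mulNr.
by apply: le_trans H'; rewrite ler_pM2l // /C'; have := ler_norm C; lra.
Qed.

Lemma weight_pos_lb : exists2 m, 0 < m & forall n : nat, m <= weight n.
Proof.
have [N HN] := ch_large 1.
have [|M HM] := @eventually_nonincreasing_bounded R (fun n : nat => (weight (Posz n))^-1) N.
  move=> n /HN c1; have -> : Posz n.+1 = Posz n + 1 by rewrite -addn1.
  rewrite weightS invfM; apply: ler_piMr; first by rewrite invr_ge0 ltW // weight_gt0.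
  by rewrite invf_le1 // (lt_le_trans ltr01 c1).
have M0 : 0 < M by apply: lt_le_trans (HM 0%N); rewrite invr_gt0 weight_gt0.
exists M^-1; first by rewrite invr_gt0.
by move=> n; rewrite -[leRHS]invrK lef_pV2 ?posrE ?invr_gt0 ?weight_gt0.
Qed.

Lemma weight_neg_ub : exists M, forall n : nat, weight (- n%:Z) <= M.
Proof.
have [N HN] := ch_large_neg 1.
apply: (@eventually_nonincreasing_bounded R (fun n : nat => weight (- n%:Z)) N) => n Nn.
have c1 : 1 <= ch (- n.+1%:Z) / b by apply: HN; apply: leqW.
have -> : - n%:Z = - n.+1%:Z + 1 by rewrite -(addn1 n) PoszD; ring.
by rewrite weightS ler_peMr // ltW // weight_gt0.
Qed.

Variable A : R.

(** Dividing a solution by [weight] turns the recurrence into the one satisfied by the half-line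
    determinants. The quotient tends to 1 at - oo and to the full determinant at + oo. *)
Definition vminus n := P h b A (z + (n - 1)%:~R * h) * weight n.

Lemma P_bound x : `|P h b A x| <= Bd h b `|A| x.
Proof.
have l : `|K h b A N x| @[N --> \oo] --> `|P h b A x| by apply: cvg_norm; exact: cvg_K.
apply: (closed_cvg (fun y => y <= Bd h b `|A| x) (@closed_le _ _) _ _ l).
apply: nearW => N; apply: le_trans (KJ_bound h b0 (normr_ge0 A) N x (lexx _)).1 _.
exact: expR_ssum_le.
Qed.

Lemma sol_vminus : sol z A mu vminus.
Proof.
move=> n; rewrite /vminus addrK -/(ch n) -bE.
rewrite -(weightV n) weightS.
have e : z + (n - 1)%:~R * h = z + n%:~R * h - h by rewrite intrB; ring.
have e' : z + (n - 1 - 1)%:~R * h = z + n%:~R * h - h - h by rewrite !intrB; ring.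
rewrite /ch e e' (P_rec h0 b0 A (z + n%:~R * h)) /sechR.
by field; rewrite !cosh_neq0 gt_eqF.
Qed.

Lemma vminus_neq0 : exists n, vminus n != 0.
Proof.
have /cvgrPdist_lt/(_ 1 ltr01)[N _ /(_ N (leqnn _))] := P_neg h0 b0 A z.
move=> /= H; exists (- N%:Z + 1); rewrite /vminus addrK.
apply: mulf_neq0; last by rewrite gt_eqF // weight_gt0.
rewrite mulrNz mulNr; apply/eqP => p0; move: H; rewrite p0 subr0 normr1 ltxx //.
Qed.

Lemma vminus_neg_bounded : exists M, forall n : nat, `|vminus (- n%:Z)| <= M.
Proof.
have [M HM] := weight_neg_ub; exists (Bd h b `|A| z * M) => n.
rewrite /vminus normrM ler_pM //; last by rewrite gtr0_norm ?weight_gt0.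
by apply: le_trans (P_bound _) _; rewrite (Bd_shiftz h0).
Qed.

(** By the Wronskian argument [vminus] is a multiple of the eigenvector, so it tends to 0 at + oo,
    while [weight] stays away from 0 there; the quotient therefore has limit 0. *)
Lemma eigval_D0 : eigval z A mu -> D h b A z = 0.
Proof.
move=> [u [u0 lu su]]; have [M uM] := l2_bounded lu.
have [M' vM] := vminus_neg_bounded.
have [c Hc] := sol_proportional mu0 su sol_vminus u0 uM vM.
have [m m0 Hm] := weight_pos_lb.
apply: (cvg_unique _ (@cvg_D _ _ h0 _ b0 A z)) => //; apply/norm_cvg0P.
pose C := `|c| * ((1 + `|A|) * M / mu) / m.
apply: (@squeeze_cvgr _ _ _ _ (fun=> 0) (fun n : nat => C * sechR (z + n%:R * h))).
- apply: nearW => n; rewrite normr_ge0 /=.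
  have w0 := weight_gt0 n.
  have -> : P h b A (z - h + n%:R * h) = c * u n / weight n.
    rewrite -Hc /vminus mulfK ?gt_eqF //; congr (P h b A _).
    by rewrite intrB -pmulrn; ring.
  rewrite 2!normrM [`|_^-1|]gtr0_norm ?invr_gt0 // /C.
  have hu := sol_decay mu0 su uM n; rewrite -pmulrn in hu.
  have wm : (weight n)^-1 <= m^-1 by rewrite lef_pV2 ?posrE.
  rewrite [leRHS](_ : _ = `|c| * ((1 + `|A|) * M / mu * sechR (z + n%:R * h)) / m); last by ring.
  by apply: ler_pM; [exact: mulr_ge0|rewrite invr_ge0 ltW|exact: ler_wpM2l|exact: wm].
- exact: cvg_cst.
- by rewrite -(mulr0 C); apply: cvgM; [exact: cvg_cst|exact: cvg_sech_pos].
Qed.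

Let p (n : nat) : R := P h b A (z + n%:R * h).

Lemma vminusS (n : nat) : vminus n.+1 = p n * weight n.+1.
Proof. by rewrite /vminus /p; congr (P h b A _ * _); rewrite intrB -!pmulrn -[n.+1%:R]natr1;
  ring. Qed.

Let kp : R := 2 * `|A| + 1.
Let kp1 : 1 <= kp. Proof. by rewrite /kp lerDr mulr_ge0. Qed.

(* If |v| increases once beyond the turning point then v dominates [weight],
   up to the convergent product of the factors 1 - kp b / cosh (z + n h). *)
Lemma vminus_growth (n : nat) : 2 * kp <= ch n.+1 / b -> `|vminus n| <= `|vminus n.+1| ->
  `|vminus n.+1| <= `|vminus n.+2| /\ (1 - kp * (b / ch n.+1)) * `|p n| <= `|p n.+1|.
Proof.
move=> big le; pose X := ch n.+1 / b.
have X0 : 0 < X by rewrite divr_gt0 ?cosh_gt0.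
have key : (X - kp) * `|vminus n.+1| <= `|vminus n.+2|.
  have := sol_vminus n.+1; rewrite -bE.
  have -> : (n.+1 : int) + 1 = n.+2 by rewrite -(addn1 n.+1).
  have -> : (n.+1 : int) - 1 = n by rewrite -(addn1 n) PoszD; ring.
  rewrite -/(ch n.+1) [b^-1 * _]mulrC -/X => e.
  have -> : (X - kp) * `|vminus n.+1| = `|X * vminus n.+1| - `|2 * A * vminus n.+1| - `|vminus
    n.+1|.
    by rewrite [`|X * _|]normrM [`|2 * A * _|]normrM [`|2 * A|]normrM normr_nat (gtr0_norm X0)
      /kp; ring.
  rewrite -e.
  have := ler_normD (vminus n.+2 + vminus n) (2 * A * vminus n.+1).
  have := ler_normD (vminus n.+2) (vminus n); lra.
split.
  apply: le_trans key; rewrite ler_peMl //; move: big; rewrite -/X; have := kp1; lra.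
have w0 := weight_gt0 n.+1.
move: key; rewrite !vminusS.
have -> : weight n.+2 = weight n.+1 * X.
  have -> : (n.+2 : int) = n.+1%:Z + 1 by rewrite -(addn1 n.+1).
  exact: weightS.
rewrite [`|p n * _|]normrM [`|p n.+1 * _|]normrM [`|weight _ * X|]gtr0_norm ?(mulr_gt0 w0 X0) //.
rewrite [`|weight n.+1|]gtr0_norm // => key.
rewrite -(ler_pM2r (mulr_gt0 w0 X0)); apply: le_trans key.
have -> : b / ch n.+1 = X^-1 by rewrite /X (invf_div (ch n.+1) b).
rewrite [leLHS](_ : _ = (X - kp) * (`|p n| * weight n.+1)) //.
by field; rewrite gt_eqF.
Qed.

(** If |vminus| increased once beyond the turning point, its quotient by [weight] would stay above
    half of a nonzero value, against the limit 0. So |vminus| is eventually nonincreasing, hence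
    bounded, hence in [l2]. *)
Lemma D0_eigval : D h b A z = 0 -> eigval z A mu.
Proof.
move=> D0.
have [N1 HN1] := ch_large (2 * kp).
pose C : R := kp * b * (2 * expR (- z)); pose t (n : nat) : R := C * q ^+ n / (1 - q).
have kp0 : 0 < kp by exact: lt_le_trans kp1.
have C0 : 0 <= C by rewrite !mulr_ge0 ?expR_ge0 // ltW.
have q1' : 0 < 1 - q by rewrite subr_gt0.
have t0 (n : nat) : 0 <= t n by rewrite divr_ge0 ?mulr_ge0 ?exprn_ge0 // ltW.
have [N2 HN2] := geo_small q0 q1 (e := 2^-1) ltac:(by rewrite invr_gt0) C0.
(* [t] is the tail of a geometric series dominating the terms kp b / cosh; it is at most 1/2 from N2
   on, which yields the factor 1/2 below. *)
have ct (n : nat) : kp * (b / ch n.+1) <= t n.+1 - t n.+2.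
  have -> : t n.+1 - t n.+2 = kp * (b * (2 * expR (- z) * q ^+ n.+1)).
    by rewrite /t /C (exprS q n.+1); field; rewrite gt_eqF.
  by rewrite ler_pM2l // ler_pM2l //; exact: sech_add_le.
have mono (m : nat) : (maxn N1 N2 <= m)%N -> `|vminus m.+1| <= `|vminus m|.
  rewrite geq_max => /andP[m1 m2]; rewrite leNgt; apply/negP => lt.
  have pm : 0 < `|p m|.
    rewrite normr_gt0; apply/eqP => pm0; move: lt.
    by rewrite vminusS pm0 mul0r normr0 ltNge normr_ge0.
  have H (k : nat) : `|vminus (m + k)%N| <= `|vminus (m + k).+1| /\
      (1 - (t m.+1 - t (m + k).+1)) * `|p m| <= `|p (m + k)%N|.
    elim: k => [|k [IH1 IH2]].
      by rewrite addn0 subrr subr0 mul1r; split => //; exact: ltW.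
    have big : 2 * kp <= ch (m + k).+1 / b by apply/HN1/leqW/(leq_trans m1)/leq_addr.
    have [g1 g2] := vminus_growth big IH1; rewrite addnS; split => //.
    apply: le_trans g2.
    have c0 : 0 <= kp * (b / ch (m + k).+1).
      by rewrite mulr_ge0 ?divr_ge0 ?(ltW kp0) ?(ltW b0) ?(ltW (cosh_gt0 _)).
    have c1 : kp * (b / ch (m + k).+1) <= 1.
      have X0 : 0 < ch (m + k).+1 / b by rewrite divr_gt0 ?cosh_gt0.
      by rewrite -(invf_div (ch (m + k).+1) b) ler_pdivrMr // mul1r; move: kp0 big; lra.
    have S0 : 0 <= t m.+1 - t (m + k).+1.
      elim: k {IH1 IH2 big g1 c0 c1} => [|k IH]; first by rewrite addn0 subrr.
      have := ct (m + k)%N; rewrite addnS.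
      have : 0 <= kp * (b / ch (m + k).+1).
        by rewrite mulr_ge0 ?divr_ge0 ?(ltW kp0) ?(ltW b0) ?(ltW (cosh_gt0 _)).
      by move: IH; lra.
    exact: shrink_step (ct (m + k)%N) c0 c1 S0 (ltW pm) IH2.
  have p2 : 0 < `|p m| / 2 by rewrite divr_gt0.
  have := @cvg_D _ _ h0 _ b0 A z; rewrite D0 => /cvgrPdist_lt/(_ _ p2)[M _ HM].
  have := HM (m + M).+1 (leqW (leq_addl _ _)); rewrite /= sub0r normrN.
  have -> : z - h + (m + M).+1%:R * h = z + (m + M)%:R * h by rewrite -[(m + M).+1%:R]natr1; ring.
  rewrite -/(p _); have [_ h1] := H M; have := HN2 m.+1 (leqW m2); have := t0 (m + M).+1.
  rewrite -/(t m.+1) => a1 a2; apply/negP; rewrite -leNgt; apply: le_trans h1.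
  rewrite mulrC ler_pM2r //; move: a1 a2; lra.
have [M1 HM1] := @eventually_nonincreasing_bounded R (fun n : nat => `|vminus n|) _ mono.
have [M2 HM2] := vminus_neg_bounded.
have HM n : `|vminus n| <= Num.max M1 M2.
  by case: n => n; rewrite le_max; apply/orP; [left; exact: HM1|right; rewrite NegzE; exact: HM2].
exists vminus; split; [exact: vminus_neq0| |exact: sol_vminus].
exact: bounded_l2 mu0 sol_vminus HM.
Qed.

End Determinant.
End Eigen.

(** * The variational principle *)

Section Summable.
Variable R : realType.
Implicit Types (f g : int -> R).

Definition smb f := exists2 g : int -> R, (forall n, `|f n| <= g n) & bsum g.

Definition isum f : R := limn (psum f).

Lemma smb_cvg f : smb f -> psum f @ \oo --> isum f.
Proof. by move=> [g fg bg]; exact: dom_cvg fg bg. Qed.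

Lemma smbD f g : smb f -> smb g -> smb (fun n => f n + g n).
Proof.
move=> [f' ff bf] [g' gg bg]; exists (fun n => f' n + g' n); last exact: bsumD.
by move=> n; apply: le_trans (ler_normD _ _) _; apply: lerD.
Qed.

Lemma smbZ c f : smb f -> smb (fun n => c * f n).
Proof.
move=> [g fg bg]; exists (fun n => `|c| * g n); last exact: bsumZ.
by move=> n; rewrite normrM ler_wpM2l.
Qed.

Lemma isumD f g : smb f -> smb g -> isum (fun n => f n + g n) = isum f + isum g.
Proof.
move=> sf sg; apply/cvg_lim => //.
rewrite (_ : psum _ = fun N => psum f N + psum g N); last by apply/funext => N; exact: psumD.
by apply: cvgD; exact: smb_cvg.
Qed.

Lemma isumZ c f : smb f -> isum (fun n => c * f n) = c * isum f.
Proof.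
move=> sf; apply/cvg_lim => //.
rewrite (_ : psum _ = fun N => c * psum f N); last by apply/funext => N; exact: psumZ.
by apply: cvgM; [exact: cvg_cst|exact: smb_cvg].
Qed.

Lemma eq_isum f g : f =1 g -> isum f = isum g.
Proof. by move=> /funext ->. Qed.

Lemma psum_le_isum f N : (forall n, 0 <= f n) -> bsum f -> psum f N <= isum f.
Proof.
move=> f0 bf; apply: nondecreasing_cvgn_le; first exact: psum_nondecreasing.
exact: bsum_cvg.
Qed.

Lemma isum_le f (M : R) : smb f -> (forall N, psum f N <= M) -> isum f <= M.
Proof.
move=> sf H; apply: (closed_cvg (fun x => x <= M) (@closed_le _ _) _ _ (smb_cvg sf)).
exact: nearW.
Qed.

Lemma psum_delta f m : exists N0, forall N, (N0 <= N)%N ->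
  psum (fun n => f n * (n == m)%:R) N = f m.
Proof.
case: m => k; exists k.+1.
  have E N : psum (fun n => f n * (n == Posz k)%:R) N = (k < N)%N%:R * f (Posz k).
    elim: N => [|N IH]; first by rewrite psum0 mul0r.
    rewrite psumS IH mulr0 addr0 eqz_nat (eq_sym N k) [(k < N.+1)%N]ltnS (leq_eqVlt k N).
    by case: eqVneq => [->|_] /=; rewrite ?ltnn ?mul0r ?mulr1 ?mul1r ?add0r ?mulr0 ?addr0.
  by move=> N kN; rewrite E kN mul1r.
have E N : psum (fun n => f n * (n == Negz k)%:R) N = (k < N)%N%:R * f (Negz k).
  elim: N => [|N IH]; first by rewrite psum0 mul0r.
  rewrite psumS IH mulr0 add0r.
  have -> : (Negz N == Negz k) = (k == N) by rewrite eq_sym.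
  rewrite [(k < N.+1)%N]ltnS (leq_eqVlt k N).
  by case: eqVneq => [->|_] /=; rewrite ?ltnn ?mul0r ?mulr1 ?mul1r ?add0r ?mulr0 ?addr0.
by move=> N kN; rewrite E kN mul1r.
Qed.

Lemma isum_delta f m : isum (fun n => f n * (n == m)%:R) = f m.
Proof.
have [N0 H] := psum_delta f m; apply/cvg_lim => //.
apply: cvg_near_cst; exists N0 => // N N0N; exact: H.
Qed.

Lemma bsum_shift f : (forall n, 0 <= f n) -> bsum f -> bsum (fun n => f (n + 1)).
Proof.
move=> f0 [M HM]; exists (M + M) => N; rewrite psum_shift.
have := bsum_term_le (Posz N) f0 HM; have := f0 (- Posz N); have := HM N; lra.
Qed.

End Summable.

Section ContinuousOps.
Variables (R : realType) (T : topologicalType).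
Implicit Types f g : T -> R.

Lemma continuous_add f g : continuous f -> continuous g -> continuous (fun x => f x + g x).
Proof. by move=> cf cg x; apply: cvgD; [exact: cf|exact: cg]. Qed.

Lemma continuous_mul f g : continuous f -> continuous g -> continuous (fun x => f x * g x).
Proof. by move=> cf cg x; apply: cvgM; [exact: cf|exact: cg]. Qed.

Lemma continuous_const (c : R) : continuous (fun _ : T => c).
Proof. by move=> x; exact: cvg_cst. Qed.

End ContinuousOps.

(** * Quadratic forms on the weighted sequence space and their maximisers *)

Section Forms.
Variables (R : realType) (h : R).
Hypothesis h0 : 0 < h.
Variable z : R.
Implicit Types (A mu : R) (u v w : int -> R).

Let ch n := coshR (z + n%:~R * h).
Let ch0 n : 0 < ch n. Proof. exact: cosh_gt0. Qed.
Let ch1 n : 1 <= ch n. Proof. exact: cosh_ge1. Qed.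

Definition lincomb u c v : int -> R := fun n => u n + c * v n.

Lemma l2_lincomb u c v : l2 h z u -> l2 h z v -> l2 h z (lincomb u c v).
Proof.
move=> lu lv; apply: (bsum_le (g := fun n => 2 * (ch n * u n ^+ 2) + 2 * c ^+ 2 * (ch n * v n ^+
  2))).
  move=> n; rewrite /lincomb -/(ch n).
  have := mulr_ge0 (ltW (ch0 n)) (sqr_ge0 (u n - c * v n)); nra.
apply: bsumD; apply: bsumZ => //.
by rewrite mulr_ge0 ?sqr_ge0.
Qed.

Lemma l2_delta m : l2 h z (fun n => (n == m)%:R).
Proof.
have [N0 H] := psum_delta ch m; exists (ch m) => N.
have E n : coshR (z + n%:~R * h) * (n == m)%:R ^+ 2 = ch n * (n == m)%:R.
  by case: (n == m); rewrite ?expr1n // expr0n.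
rewrite (eq_psum _ E) -(H (maxn N0 N) (leq_maxl _ _)).
apply: psum_le (leq_maxr _ _) => n; by rewrite mulr_ge0 // ltW.
Qed.

Definition Bt u v n := ch n * u n * v n.
Definition Ut u v n : R := u n * v n.
(** The off-diagonal part is symmetrised term by term, so that the eigenvalue equation becomes [Sf]
    = mu [Bf] between symmetric forms. *)
Definition St A u v n : R := A * (u n * v n) + (u n * v (n + 1) + u (n + 1) * v n) / 2.

Lemma smb_Bt u v : l2 h z u -> l2 h z v -> smb (Bt u v).
Proof.
move=> lu lv; exists (fun n => ch n * u n ^+ 2 + ch n * v n ^+ 2); last exact: bsumD.
move=> n; rewrite /Bt; have c0 := ltW (ch0 n).
have := mulr_ge0 c0 (sqr_ge0 (u n - v n)); have := mulr_ge0 c0 (sqr_ge0 (u n + v n)).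
have := mulr_ge0 c0 (sqr_ge0 (u n)); have := mulr_ge0 c0 (sqr_ge0 (v n)).
by rewrite ler_norml => *; apply/andP; split; lra.
Qed.

Lemma l2_sqr u : l2 h z u -> bsum (fun n => u n ^+ 2).
Proof. by apply: bsum_le => n; rewrite ler_peMl ?sqr_ge0 ?ch1. Qed.

Lemma smb_mul (f g : int -> R) : bsum (fun n => f n ^+ 2) -> bsum (fun n => g n ^+ 2) ->
  smb (fun n => f n * g n).
Proof.
move=> bf bg; exists (fun n => f n ^+ 2 + g n ^+ 2); last exact: bsumD.
move=> n; have := sqr_ge0 (f n - g n); have := sqr_ge0 (f n + g n).
have := sqr_ge0 (f n); have := sqr_ge0 (g n).
by rewrite ler_norml => *; apply/andP; split; lra.
Qed.

Lemma smb_Ut u v : l2 h z u -> l2 h z v -> smb (Ut u v).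
Proof. by move=> /l2_sqr lu /l2_sqr lv; exact: smb_mul. Qed.

Lemma l2_sqr1 u : l2 h z u -> bsum (fun n => u (n + 1) ^+ 2).
Proof. by move/l2_sqr => lu; apply: (bsum_shift _ lu) => n; exact: sqr_ge0. Qed.

Lemma smb_St A u v : l2 h z u -> l2 h z v -> smb (St A u v).
Proof.
move=> lu lv; apply: smbD; first exact/smbZ/smb_Ut.
rewrite (_ : (fun n => _) = fun n => 2^-1 * (u n * v (n + 1) + u (n + 1) * v n)); last first.
  by apply/funext => n; rewrite mulrC.
by apply/smbZ/smbD; apply: smb_mul; (exact: l2_sqr || exact: l2_sqr1).
Qed.

Definition Bf u v := isum (Bt u v).
Definition Uf u v := isum (Ut u v).
Definition Sf A u v := isum (St A u v).

Lemma BfC u v : Bf u v = Bf v u.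
Proof. by apply: eq_isum => n; rewrite /Bt; ring. Qed.

Lemma SfC A u v : Sf A u v = Sf A v u.
Proof. by apply: eq_isum => n; rewrite /St; ring. Qed.

Lemma Bf_lincomb u c v w : l2 h z u -> l2 h z v -> l2 h z w ->
  Bf (lincomb u c v) w = Bf u w + c * Bf v w.
Proof.
move=> lu lv lw; rewrite /Bf -(isumZ c (smb_Bt lv lw)).
rewrite -(isumD (smb_Bt lu lw) (smbZ c (smb_Bt lv lw))).
by apply: eq_isum => n; rewrite /Bt /lincomb; ring.
Qed.

Lemma Sf_lincomb A u c v w : l2 h z u -> l2 h z v -> l2 h z w ->
  Sf A (lincomb u c v) w = Sf A u w + c * Sf A v w.
Proof.
move=> lu lv lw; rewrite /Sf -(isumZ c (smb_St A lv lw)).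
rewrite -(isumD (smb_St A lu lw) (smbZ c (smb_St A lv lw))).
by apply: eq_isum => n; rewrite /St /lincomb; ring.
Qed.

Lemma Sf_shiftA A A' u : l2 h z u -> Sf A' u u = Sf A u u + (A' - A) * Uf u u.
Proof.
move=> lu; rewrite /Sf /Uf -(isumZ (A' - A) (smb_Ut lu lu)).
rewrite -(isumD (smb_St A lu lu) (smbZ (A' - A) (smb_Ut lu lu))).
by apply: eq_isum => n; rewrite /St /Ut; ring.
Qed.

Lemma Bf_delta u m : Bf u (fun n => (n == m)%:R) = ch m * u m.
Proof. exact: (isum_delta (fun n => ch n * u n)). Qed.

Lemma Sf_delta A u m : l2 h z u ->
  Sf A u (fun n => (n == m)%:R) = A * u m + (u (m - 1) + u (m + 1)) / 2.
Proof.
move=> lu; have ld := l2_delta m.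
have s1 : smb (fun n => A * u n * (n == m)%:R).
  rewrite (_ : (fun n => _) = fun n => A * (u n * (n == m)%:R)).
    exact/smbZ/(smb_Ut lu ld).
  by apply/funext => n; rewrite mulrA.
have s2 : smb (fun n => u n / 2 * (n == m - 1)%:R).
  rewrite (_ : (fun n => _) = fun n => 2^-1 * (u n * (n == m - 1)%:R)).
    exact/smbZ/(smb_Ut lu (l2_delta _)).
  by apply/funext => n; ring.
have s3 : smb (fun n => u (n + 1) / 2 * (n == m)%:R).
  rewrite (_ : (fun n => _) = fun n => 2^-1 * (u (n + 1) * (n == m)%:R)).
    by apply/smbZ/smb_mul; [exact: l2_sqr1|exact: l2_sqr].
  by apply/funext => n; ring.
have -> : Sf A u (fun n => (n == m)%:R) = isum (fun n => A * u n * (n == m)%:R +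
    (u n / 2 * (n == m - 1)%:R + u (n + 1) / 2 * (n == m)%:R)).
  by apply: eq_isum => n; rewrite /St -[m in (n + 1 == m)%:R](subrK 1) (inj_eq (addIr 1)); ring.
by rewrite isumD ?isumD ?isum_delta //; [ring|exact: smbD].
Qed.

Lemma BtE u n : Bt u u n = ch n * u n ^+ 2.
Proof. by rewrite /Bt expr2 mulrA. Qed.

Lemma Bt_ge0 u n : 0 <= Bt u u n.
Proof. by rewrite BtE mulr_ge0 ?sqr_ge0 // ltW. Qed.

Lemma bsum_Bt u : l2 h z u -> bsum (Bt u u).
Proof. by move=> lu; apply: bsum_le lu => n; rewrite BtE. Qed.

Lemma psum_Bt_le u N : l2 h z u -> psum (Bt u u) N <= Bf u u.
Proof. by move=> lu; apply: psum_le_isum; [exact: Bt_ge0|exact: bsum_Bt]. Qed.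

Lemma Bf_gt0 u : l2 h z u -> (exists n, u n != 0) -> 0 < Bf u u.
Proof.
move=> lu [n un]; have tn : 0 < Bt u u n by rewrite BtE mulr_gt0 // exprn_even_gt0.
have [N H] := term_le_psum n (Bt_ge0 u).
exact: lt_le_trans tn (le_trans (H N (leqnn _)) (psum_Bt_le N lu)).
Qed.

Lemma Uf_gt0 u : l2 h z u -> (exists n, u n != 0) -> 0 < Uf u u.
Proof.
move=> lu [n un]; have t0 k : 0 <= Ut u u k by rewrite /Ut -expr2 sqr_ge0.
have tn : 0 < Ut u u n by rewrite /Ut -expr2 exprn_even_gt0.
have [N H] := term_le_psum n t0.
apply: (lt_le_trans tn (le_trans (H N (leqnn _)) _)).
by apply: psum_le_isum => //; apply: bsum_le (l2_sqr lu) => k; rewrite /Ut expr2.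
Qed.

Lemma Uf_le_Bf u : l2 h z u -> Uf u u <= Bf u u.
Proof.
move=> lu; apply: isum_le; first exact: smb_Ut.
move=> N; apply: le_trans (psum_Bt_le N lu); apply: ler_psum => n.
by rewrite BtE /Ut -expr2 ler_peMl ?sqr_ge0.
Qed.

(** Summation by parts: the terms of the difference telescope, and the boundary terms vanish because
    the eigenvector decays and u is bounded. *)
Lemma eigvec_Sf A mu y u : 0 < mu -> eigvec h z A mu y -> l2 h z u -> Sf A u y = mu * Bf u y.
Proof.
move=> mu0 [_ ly sy] lu.
have [My Hy] := l2_bounded ly; have [Mu Hu] := l2_bounded lu.
apply/eqP; rewrite -subr_eq0 -mulNr /Sf /Bf -(isumZ (- mu) (smb_Bt lu ly)).
rewrite -(isumD (smb_St A lu ly) (smbZ (- mu) (smb_Bt lu ly))).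
pose g n := u n * y (n - 1) / 2.
have E n : St A u y n + - mu * Bt u y n = g (n + 1) - g n.
  by rewrite /St /Bt /g addrK; have := congr1 ( *%R (u n)) (sy n); rewrite -/(ch n); lra.
apply/eqP; rewrite (eq_isum E); apply/cvg_lim => //.
rewrite (_ : psum _ = fun N => g (Posz N) - g (- Posz N)); last first.
  by apply/funext => N; exact: psum_telescope.
pose C := Mu * ((1 + `|A|) * My / mu) / 2.
have gb n : `|g n| <= C * sechR (z - h + n%:~R * h).
  rewrite /g 2!normrM [`|2^-1|]ger0_norm ?invr_ge0 // /C.
  have := sol_decay mu0 sy Hy (n - 1).
  have -> : z + (n - 1)%:~R * h = z - h + n%:~R * h by rewrite intrB; ring.
  move=> d; rewrite [leRHS]mulrAC; apply: ler_wpM2r; first by rewrite invr_ge0.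
  by rewrite -[leRHS]mulrA; apply: ler_pM => //; exact: Hu.
have L (s : nat -> int) : (C * sechR (z - h + (s N)%:~R * h) @[N --> \oo] --> (0 : R)) ->
    g (s N) @[N --> \oo] --> (0 : R).
  move=> cs; apply/norm_cvg0P.
  apply: (@squeeze_cvgr _ _ _ _ (fun=> 0) (fun N => C * sechR (z - h + (s N)%:~R * h))) => //.
  - by apply: nearW => N; rewrite normr_ge0 gb.
  - exact: cvg_cst.
rewrite -[X in _ --> X](subr0 0); apply: cvgB; apply: L; last exact: cvg_sech_Nposz.
by rewrite -(mulr0 C); apply: cvgM; [exact: cvg_cst|exact: cvg_sech_pos].
Qed.

Lemma eigvec_orth A mu mu' y y' : 0 < mu -> 0 < mu' -> mu != mu' ->
  eigvec h z A mu y -> eigvec h z A mu' y' -> Bf y y' = 0.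
Proof.
move=> m0 m0' mm ey ey'; have [_ ly _] := ey; have [_ ly' _] := ey'.
have e1 := eigvec_Sf m0' ey' ly; have e2 := eigvec_Sf m0 ey ly'.
rewrite SfC e1 (BfC y') in e2.
apply/eqP; have : (mu' - mu) * Bf y y' = 0 by rewrite mulrBl e2 subrr.
by move/eqP; rewrite mulf_eq0 subr_eq0 eq_sym (negbTE mm).
Qed.

Lemma eigvec_scale A mu y c : c != 0 -> eigvec h z A mu y -> eigvec h z A mu (fun n => c * y n).
Proof.
move=> c0 [[n yn] ly sy]; split.
- by exists n; rewrite mulf_neq0.
- apply: (bsum_le (g := fun n => c ^+ 2 * (coshR (z + n%:~R * h) * y n ^+ 2))).
    by move=> m; rewrite exprMn mulrCA lexx.
  by apply: bsumZ; [exact: sqr_ge0|exact: ly].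
- by move=> m; have := congr1 ( *%R c) (sy m); lra.
Qed.

Lemma eigval_unit A mu : eigval h z A mu -> exists y, eigvec h z A mu y /\ Bf y y = 1.
Proof.
move=> [y ey]; have [y0 ly _] := ey; have b0 := Bf_gt0 ly y0.
pose c := (Num.sqrt (Bf y y))^-1.
have s0 : Num.sqrt (Bf y y) != 0 by rewrite gt_eqF // sqrtr_gt0.
exists (fun n => c * y n); split; first by apply: eigvec_scale ey; rewrite invr_eq0.
rewrite (_ : Bf _ _ = c * (c * Bf y y)).
  by rewrite /c mulrA -expr2 exprVn sqr_sqrtr ?(ltW b0) // mulVf // gt_eqF.
rewrite /Bf -(isumZ c (smb_Bt ly ly)) -(isumZ c (smbZ c (smb_Bt ly ly))).
by apply: eq_isum => n; rewrite /Bt; ring.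
Qed.

Lemma Bf_scale c u v : l2 h z u -> l2 h z v -> Bf (fun n => c * u n) v = c * Bf u v.
Proof.
move=> lu lv; rewrite /Bf -(isumZ c (smb_Bt lu lv)).
by apply: eq_isum => n; rewrite /Bt; ring.
Qed.

Lemma Sf_scale A c u v : l2 h z u -> l2 h z v -> Sf A (fun n => c * u n) v = c * Sf A u v.
Proof.
move=> lu lv; rewrite /Sf -(isumZ c (smb_St A lu lv)).
by apply: eq_isum => n; rewrite /St; ring.
Qed.

Lemma l2_scale c u : l2 h z u -> l2 h z (fun n => c * u n).
Proof.
move=> lu; apply: (bsum_le (g := fun n => c ^+ 2 * (coshR (z + n%:~R * h) * u n ^+ 2))).
  by move=> m; rewrite exprMn mulrCA lexx.
by apply: bsumZ; [exact: sqr_ge0|exact: lu].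
Qed.

Lemma Bf_sqr_scale c u : l2 h z u -> Bf (fun n => c * u n) (fun n => c * u n) = c ^+ 2 * Bf u u.
Proof.
by move=> lu; have lcu := l2_scale c lu; rewrite (Bf_scale c lu lcu) BfC (Bf_scale c lu lu) mulrA
  expr2.
Qed.

Lemma Sf_sqr_scale A c u : l2 h z u ->
  Sf A (fun n => c * u n) (fun n => c * u n) = c ^+ 2 * Sf A u u.
Proof.
by move=> lu; have lcu := l2_scale c lu; rewrite (Sf_scale A c lu lcu) SfC (Sf_scale A c lu lu)
  mulrA expr2.
Qed.

Lemma not_nonzero (w : int -> R) : ~ (exists n, w n != 0) -> w = fun n => 0 * w n.
Proof.
by move=> w0; apply/funext => n; rewrite mul0r; apply/eqP/negPn/negP => wn; apply: w0; exists n.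
Qed.

(** Stated through partial sums, the unit ball of [Bf] is an intersection of closed conditions on
    finitely many coordinates; it lies in a product of copies of [-1, 1] and is thus compact
    pointwise. *)
Definition ball : set {ptws int -> R} := [set u | forall N, psum (Bt u u) N <= 1].

Lemma ball_l2 u : ball u -> l2 h z u.
Proof. by move=> bu; exists 1 => N; apply: le_trans (bu N); apply: ler_psum => n;
  rewrite BtE. Qed.

Lemma cont_coord n : continuous (fun u : {ptws int -> R} => u n).
Proof. exact: (@proj_continuous int (fun=> R) n). Qed.

Lemma cont_prod n m : continuous (fun u : {ptws int -> R} => u n * u m).
Proof.
exact: (@continuous_mul R {ptws int -> R} (fun u => u n) (fun u => u m) (@cont_coord n)
  (@cont_coord m)).
Qed.

Lemma cont_Bt n (f : {ptws int -> R} -> R) : continuous f ->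
  continuous (fun u : {ptws int -> R} => ch n * u n * f u).
Proof.
move=> cf; apply: (@continuous_mul R {ptws int -> R} (fun u => ch n * u n) f _ cf).
apply: (@continuous_mul R {ptws int -> R} (fun=> ch n) (fun u => u n) _ (@cont_coord n)).
exact: (@continuous_const R {ptws int -> R} (ch n)).
Qed.

Lemma cont_psum (F : {ptws int -> R} -> int -> R) N :
  (forall n, continuous (fun u : {ptws int -> R} => F u n)) ->
  continuous (fun u : {ptws int -> R} => psum (F u) N).
Proof.
move=> cF; elim: N => [|N IH].
  rewrite (_ : (fun _ => _) = fun=> 0); first exact: (@continuous_const R {ptws int -> R} 0).
  by apply/funext => v; rewrite psum0.
rewrite (_ : (fun _ => _) = fun v => psum (F v) N + (F v (Posz N) + F v (Negz N))).
  apply: (@continuous_add R {ptws int -> R} (fun v => psum (F v) N)) => //.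
  exact: (@continuous_add R {ptws int -> R} (fun v => F v (Posz N)) (fun v => F v (Negz N))).
by apply/funext => v; rewrite psumS.
Qed.

Lemma ball_coord_le1 u n : ball u -> Bt u u n <= 1.
Proof. by move=> bu; apply: bsum_term_le (Bt_ge0 u) bu. Qed.

Lemma compact_ball : compact ball.
Proof.
apply: (@subclosed_compact _ _ [set u : {ptws int -> R} | forall n, `[-1, 1]%classic (u n)]).
- have -> : ball = \bigcap_(N in setT) [set u : {ptws int -> R} | psum (Bt u u) N <= 1].
    by apply/seteqP; split => u H; [move=> N _; exact: H|move=> N; exact: (H N)].
  apply: closed_bigI => N _.
  apply: (preimage_closed (f := fun u : {ptws int -> R} => psum (Bt u u) N) (D := [set x | x <= 1])).
    move=> u _; apply: cont_psum => n.
    exact: cont_Bt (@cont_coord n).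
  exact: closed_le.
- by apply: (@tychonoff int (fun=> R) (fun=> `[-1, 1]%classic)) => n; exact: segment_compact.
- move=> u bu n /=; rewrite in_itv /= -ler_norml.
  have := ball_coord_le1 n bu; rewrite BtE => H.
  have : u n ^+ 2 <= 1 by apply: le_trans H; rewrite ler_peMl ?sqr_ge0.
  by rewrite -[X in _ <= X -> _](expr1n R 2) -real_normK ?num_real // ler_sqr ?nnegrE.
Qed.

Lemma within_cont_unif (f : {ptws int -> R} -> R) (F : nat -> {ptws int -> R} -> R) :
  (forall N, continuous (F N)) ->
  (forall e, 0 < e -> exists N, forall u, ball u -> `|f u - F N u| <= e) ->
  {within ball, continuous f}.
Proof.
move=> cF H; apply/subspace_continuousP => u bu; apply/cvgrPdist_le => e e0.
have e3 : 0 < e / 3 by rewrite divr_gt0.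
have [N HN] := H _ e3.
have /cvgrPdist_le/(_ _ e3) cN := cF N u.
rewrite near_withinE; apply: filterS cN => v h3 bv.
have h1 := HN _ bu; have h2 := HN _ bv.
have := ler_normD (f u - F N u) (F N u - F N v); rewrite addrA subrK.
have := ler_normB (f u - F N v) (f v - F N v); rewrite opprB addrA subrK.
move: h1 h2 h3; rewrite /from_subspace.
move: (`|_|) (`|_|) (`|_|) (`|_|) => a b c d; lra.
Qed.

(** On the ball u_n^2 <= sech (z + n h), a summable bound independent of u. *)
Lemma within_cont_Sf A : {within ball, continuous (fun u : {ptws int -> R} => Sf A u u)}.
Proof.
apply: (within_cont_unif (F := fun N u => psum (St A u u) N)).
  move=> N; apply: cont_psum => n.
  apply: (@continuous_add R {ptws int -> R} (fun u => A * (u n * u n))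
    (fun u => (u n * u (n + 1) + u (n + 1) * u n) / 2)).
    apply: (@continuous_mul R {ptws int -> R} (fun=> A));
      first exact: (@continuous_const R {ptws int -> R} A).
    exact: cont_prod.
  apply: (@continuous_mul R {ptws int -> R} _ (fun=> 2^-1));
    last exact: (@continuous_const R {ptws int -> R} 2^-1).
  by apply: (@continuous_add R {ptws int -> R} (fun u => u n * u (n + 1))); exact: cont_prod.
pose g n := (`|A| + 1) * (lat h z (@sechR R) n + lat h z (@sechR R) (n + 1)).
have bg : bsum g.
  apply: bsumZ; first by rewrite addr_ge0.
  apply: bsumD; first exact: bsum_sech.
  by apply: bsum_shift; [move=> n; exact: sech_ge0|exact: bsum_sech].
have g0 n : 0 <= g n by rewrite mulr_ge0 ?addr_ge0 ?sech_ge0.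
move=> e e0; have [M HM] := bsum_tail g0 bg e0; exists M => u bu.
have us n : u n ^+ 2 <= lat h z (@sechR R) n.
  have := ball_coord_le1 n bu; rewrite BtE /lat /sechR -/(ch n) => H.
  by rewrite -[leRHS]mul1r ler_pdivlMr // mulrC.
apply: (dom_tail_lim (g := g) _ _ HM); last exact: (smb_cvg (smb_St A (ball_l2 bu) (ball_l2 bu))).
move=> n; rewrite /St /g [leRHS]mulrDl mul1r; apply: (le_trans (ler_normD _ _)).
have a1 := us n; have a2 := us (n + 1); apply: lerD.
  rewrite -expr2 normrM [`|_ ^+ 2|]ger0_norm ?sqr_ge0 // ler_wpM2l //.
  by apply: (le_trans a1); rewrite lerDl sech_ge0.
apply: le_trans (lerD a1 a2); move: (u n) (u (n + 1)) => p q.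
have -> : (p * q + q * p) / 2 = p * q by field.
have := sqr_ge0 (p - q); have := sqr_ge0 (p + q); have := sqr_ge0 p; have := sqr_ge0 q.
by rewrite ler_norml => *; apply/andP; split; lra.
Qed.

Lemma within_cont_Bf y : l2 h z y -> {within ball, continuous (fun u : {ptws int -> R} => Bf u
  y)}.
Proof.
move=> ly; apply: (within_cont_unif (F := fun N u => psum (Bt u y) N)).
  move=> N; apply: cont_psum => n.
  exact: cont_Bt (@continuous_const R {ptws int -> R} (y n)).
move=> e e0; pose d := e / 2; have d0 : 0 < d by rewrite divr_gt0.
have e2 : 0 < d * d by rewrite mulr_gt0.
have [M HM] := bsum_tail (Bt_ge0 y) (bsum_Bt ly) e2; exists M => u bu.
(* Weighted arithmetic-geometric mean: the u part costs at most d as u is in the ball, the tail of y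
   is below d^2 and costs d after division, and 2 d = e. *)
apply: (dom_tail_lim (g := fun n => d * Bt u u n + d^-1 * Bt y y n)); last 2 first.
- exact: (smb_cvg (smb_Bt (ball_l2 bu) ly)).
- move=> N MN; rewrite !psumD !psumZ.
  have := HM N MN; rewrite -(ler_pM2l (x := d^-1)) ?invr_gt0 // mulKf ?gt_eqF // => h1.
  have : d * (psum (Bt u u) N - psum (Bt u u) M) <= d * 1.
    rewrite ler_pM2l //; have := bu N; have := psum_ge0 M (Bt_ge0 u); lra.
  by move: h1; rewrite /d; lra.
move=> n; rewrite !BtE /Bt.
have c0 := ltW (ch0 n); have i0 : 0 < d^-1 by rewrite invr_gt0.
have id1 : d^-1 * d = 1 by rewrite mulVf // gt_eqF.
have k1 := mulr_ge0 (mulr_ge0 c0 (ltW i0)) (sqr_ge0 (d * u n - y n)).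
have k2 := mulr_ge0 (mulr_ge0 c0 (ltW i0)) (sqr_ge0 (d * u n + y n)).
have k3 := mulr_ge0 (mulr_ge0 c0 (ltW d0)) (sqr_ge0 (u n)).
have k4 := mulr_ge0 (mulr_ge0 c0 (ltW i0)) (sqr_ge0 (y n)).
have E1 : ch n * d^-1 * (d * u n - y n) ^+ 2 =
    d * (ch n * u n ^+ 2) + d^-1 * (ch n * y n ^+ 2) - 2 * (ch n * u n * y n).
  by field; rewrite gt_eqF.
have E2 : ch n * d^-1 * (d * u n + y n) ^+ 2 =
    d * (ch n * u n ^+ 2) + d^-1 * (ch n * y n ^+ 2) + 2 * (ch n * u n * y n).
  by field; rewrite gt_eqF.
by rewrite E1 in k1; rewrite E2 in k2; rewrite ler_norml; apply/andP; split; lra.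
Qed.

Lemma within_cont_sum (t : seq R) (Y : R -> int -> R) : (forall mu, mu \in t -> l2 h z (Y mu)) ->
  {within ball, continuous (fun u : {ptws int -> R} =>
     \sum_(mu <- t) mu * (Bf u (Y mu) * Bf u (Y mu)))}.
Proof.
elim: t => [|mu t IH] lt.
  rewrite (_ : (fun _ => _) = fun=> 0); first by move=> u; exact: cvg_cst.
  by apply/funext => v; rewrite big_nil.
rewrite (_ : (fun _ => _) = fun v : {ptws int -> R} => mu * (Bf v (Y mu) * Bf v (Y mu)) +
   \sum_(mu <- t) mu * (Bf v (Y mu) * Bf v (Y mu))); last first.
  by apply/funext => v; rewrite big_cons.
have cB : {within ball, continuous (fun u : {ptws int -> R} => Bf u (Y mu))}.
  by apply: within_cont_Bf; apply: lt; rewrite inE eqxx.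
apply: continuous_add; last by apply: IH => nu nt; apply: lt; rewrite inE nt orbT.
exact: continuous_mul (@continuous_const _ _ mu) (continuous_mul cB cB).
Qed.

(** The first-order condition at a maximum; at t = a / (|b| + 1) the linear term dominates the
    quadratic one. *)
Lemma quadratic_vanish (a b : R) : (forall t, 2 * t * a + t ^+ 2 * b <= 0) -> a = 0.
Proof.
move=> H; have p : 0 < `|b| + 1 by rewrite ltr_wpDl.
have := H (a / (`|b| + 1)).
have -> : 2 * (a / (`|b| + 1)) * a + (a / (`|b| + 1)) ^+ 2 * b =
   a ^+ 2 * (2 * (`|b| + 1) + b) / (`|b| + 1) ^+ 2 by field; rewrite gt_eqF.
rewrite pmulr_lle0 ?invr_gt0 ?exprn_gt0 // pmulr_lle0; last first.
  by have := ler_norm (- b); rewrite normrN; lra.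
by move=> a2; apply/eqP; rewrite -sqrf_eq0 eq_le a2 sqr_ge0.
Qed.

Section Maximum.
Variables (A : R) (s : seq R) (Y : R -> int -> R).
Hypothesis us : uniq s.
Hypothesis s0 : forall mu, mu \in s -> 0 < mu.
Hypothesis eY : forall mu, mu \in s -> eigvec h z A mu (Y mu).
Hypothesis Y1 : forall mu, mu \in s -> Bf (Y mu) (Y mu) = 1.

Let lY mu : mu \in s -> l2 h z (Y mu).
Proof. by move=> /eY[]. Qed.

(* The form S with the known eigenvectors deflated away: a maximiser over the
   unit ball is automatically orthogonal to them. *)
Definition defl u v := Sf A u v - \sum_(mu <- s) mu * (Bf u (Y mu) * Bf v (Y mu)).

Lemma deflC u v : defl u v = defl v u.
Proof. by rewrite /defl SfC; congr (_ - _); apply: eq_bigr => mu _; ring. Qed.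

Lemma defl_lincomb u c v w : l2 h z u -> l2 h z v -> l2 h z w ->
  defl (lincomb u c v) w = defl u w + c * defl v w.
Proof.
move=> lu lv lw; rewrite /defl Sf_lincomb // [c * (_ - _)]mulrBr mulr_sumr.
rewrite [RHS](_ : _ = Sf A u w + c * Sf A v w - (\sum_(mu <- s) mu * (Bf u (Y mu) * Bf w (Y mu)) +
   \sum_(mu <- s) c * (mu * (Bf v (Y mu) * Bf w (Y mu))))); last by ring.
congr (_ - _); rewrite -big_split /= !big_seq; apply: eq_bigr => mu ms.
by rewrite (Bf_lincomb c lu lv (lY ms)); ring.
Qed.

Lemma defl_sqr_lincomb u c v : l2 h z u -> l2 h z v ->
  defl (lincomb u c v) (lincomb u c v) = defl u u + 2 * c * defl u v + c ^+ 2 * defl v v.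
Proof.
move=> lu lv; have luv := l2_lincomb c lu lv.
rewrite defl_lincomb // (deflC u) (deflC v) !defl_lincomb // (deflC v u); ring.
Qed.

Lemma Bf_sqr_lincomb u c v : l2 h z u -> l2 h z v ->
  Bf (lincomb u c v) (lincomb u c v) = Bf u u + 2 * c * Bf u v + c ^+ 2 * Bf v v.
Proof.
move=> lu lv; have luv := l2_lincomb c lu lv.
rewrite Bf_lincomb // (BfC u) (BfC v) !Bf_lincomb // (BfC v u); ring.
Qed.

Lemma defl_scale c u : l2 h z u -> defl (fun n => c * u n) (fun n => c * u n) = c ^+ 2 * defl u u.
Proof.
move=> lu; have lcu := l2_scale c lu.
rewrite /defl Sf_scale // SfC Sf_scale // mulrBr mulr_sumr; congr (_ - _); first by ring.
by rewrite !big_seq; apply: eq_bigr => mu ms; rewrite (Bf_scale c lu (lY ms)); ring.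
Qed.

Lemma within_cont_defl : {within ball, continuous (fun u : {ptws int -> R} => defl u u)}.
Proof.
move=> u; apply: cvgB; first exact: within_cont_Sf.
exact: within_cont_sum lY u.
Qed.

Lemma defl_orth w : (forall mu, mu \in s -> Bf w (Y mu) = 0) -> defl w w = Sf A w w.
Proof.
move=> ow; rewrite /defl big_seq big1 ?subr0 // => mu ms; rewrite ow //; ring.
Qed.

Lemma next_eigenvector x c : l2 h z x -> (forall mu, mu \in s -> Bf x (Y mu) = 0) -> 0 <= c ->
  c * Bf x x < Sf A x x ->
  exists nu y, [/\ eigvec h z A nu y, c < nu, forall mu, mu \in s -> Bf y (Y mu) = 0 &
    forall w, l2 h z w -> (forall mu, mu \in s -> Bf w (Y mu) = 0) -> Sf A w w <= nu * Bf w w].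
Proof.
move=> lx ox c0 cx.
have ball0 : ball !=set0.
  exists (fun=> 0) => N; rewrite (_ : psum _ N = 0) // /psum big1 // => i _.
  by rewrite /Bt; ring.
have [y yb ymax] := compact_EVT_max ball0 compact_ball within_cont_defl.
rewrite inE in yb; have ly := ball_l2 yb.
set nu := defl y y in ymax.
have Hmax w : l2 h z w -> defl w w <= nu * Bf w w.
  move=> lw; have [w0|w0] := pselect (exists n, w n != 0); last first.
    by rewrite (not_nonzero w0) (defl_scale 0 lw) (Bf_sqr_scale 0 lw) expr0n !mul0r mulr0.
  have t0 := Bf_gt0 lw w0; pose r := (Num.sqrt (Bf w w))^-1.
  have r2 : r ^+ 2 * Bf w w = 1.
    by rewrite /r exprVn sqr_sqrtr ?(ltW t0) // mulVf // gt_eqF.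
  have bw : ball (fun n => r * w n).
    move=> N; rewrite -r2; apply: le_trans (psum_Bt_le N (l2_scale r lw)) _.
    by rewrite (Bf_sqr_scale r lw) lexx.
  have := ymax (fun n => r * w n); rewrite inE => /(_ bw); rewrite (defl_scale r lw) => H.
  have r0 : 0 < r ^+ 2 by rewrite -(pmulr_lgt0 _ t0) r2.
  by rewrite -(ler_pM2l r0) mulrCA r2 mulr1.
have x0 : exists n, x n != 0.
  apply: contrapT => H; move: cx.
  by rewrite (not_nonzero H) (Bf_sqr_scale 0 lx) (Sf_sqr_scale A 0 lx) expr0n !mul0r mulr0 ltxx.
have cnu : c < nu.
  have := Hmax _ lx; rewrite defl_orth // => H.
  by have := lt_le_trans cx H; rewrite ltr_pM2r //; exact: Bf_gt0.
have nu0 : 0 < nu by exact: le_lt_trans cnu.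
(* Since nu > 0, a maximiser strictly inside the ball could be scaled up. *)
have By1 : Bf y y = 1.
  apply/eqP; rewrite eq_le; apply/andP; split; first by apply: isum_le; [exact: smb_Bt|].
  by have := Hmax _ ly; rewrite -/nu -[leLHS]mulr1 ler_pM2l.
(* Deflation removes the orthogonality constraints, so variations in all directions e are
   allowed. *)
have var e : l2 h z e -> defl y e = nu * Bf y e.
  move=> le; apply/eqP; rewrite -subr_eq0; apply/eqP.
  apply: (@quadratic_vanish _ (defl e e - nu * Bf e e)) => t.
  have := Hmax _ (l2_lincomb t ly le).
  by rewrite defl_sqr_lincomb // Bf_sqr_lincomb // -/nu By1; lra.
(* Tested on a known eigenvector the form gives mu B(y, Y mu), which the deflation cancels exactly;
   what remains is nu B(y, Y mu) = 0. *)
have oy mu : mu \in s -> Bf y (Y mu) = 0.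
  move=> ms; have := var _ (lY ms); rewrite /defl (eigvec_Sf (s0 ms) (eY ms) ly).
  rewrite (bigD1_seq mu) //= Y1 // mulr1 big1_seq ?addr0; last first.
    move=> mu' /andP[mm ms']; rewrite (eigvec_orth (s0 ms) (s0 ms') _ (eY ms) (eY ms')) ?mulr0 //.
    by rewrite eq_sym.
  rewrite subrr => /esym/eqP; rewrite mulf_eq0 gt_eqF //= => /eqP //.
exists nu, y; split => //; last by move=> w lw ow; rewrite -defl_orth //; exact: Hmax.
split => //.
  apply: contrapT => H; move: By1.
  by rewrite (not_nonzero H) (Bf_sqr_scale 0 ly) expr0n mul0r => /eqP; rewrite eq_sym oner_eq0.
(* Testing on a unit vector turns the weak equation into the recurrence at m. *)
move=> m; have := var _ (l2_delta m); rewrite /defl Sf_delta // Bf_delta.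
rewrite big_seq big1 ?subr0; last by move=> mu ms; rewrite oy //; ring.
rewrite -/(ch m); lra.
Qed.

End Maximum.
End Forms.

(** * Counting eigenvalues and comparing parameters and sites *)

Section Counting.
Variables (R : realType) (h : R).
Hypothesis h0 : 0 < h.

Section FixedSite.
Variable z : R.
Implicit Types (A mu : R) (w : int -> R) (s : seq R).

Definition comb (I : Type) (r : seq I) (v : I -> int -> R) (a : I -> R) : int -> R :=
  fun n => \sum_(i <- r) a i * v i n.

Lemma comb_cons (I : Type) (i : I) r v a : comb (i :: r) v a = lincomb (comb r v a) (a i) (v i).
Proof. by apply/funext => n; rewrite /comb /lincomb big_cons addrC. Qed.

Lemma l2_comb (I : Type) (r : seq I) v a : (forall i, l2 h z (v i)) -> l2 h z (comb r v a).
Proof.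
move=> lv; elim: r => [|i r IH]; last by rewrite comb_cons; exact: l2_lincomb.
exists 0 => N; rewrite /psum big1 // => i _.
by rewrite /comb !big_nil expr0n /= !mulr0 addr0.
Qed.

Lemma Bf_comb (I : Type) (r : seq I) v a w : (forall i, l2 h z (v i)) -> l2 h z w ->
  Bf h z (comb r v a) w = \sum_(i <- r) a i * Bf h z (v i) w.
Proof.
move=> lv lw; elim: r => [|i r IH].
  rewrite big_nil /Bf (_ : Bt _ _ _ _ = fun n => 0 * Bt h z w w n) ?isumZ ?mul0r //.
    exact: smb_Bt.
  by apply/funext => n; rewrite /Bt /comb big_nil mulr0 !mul0r.
by rewrite comb_cons big_cons (Bf_lincomb (a i) (l2_comb r a lv) (lv i) lw) IH addrC.
Qed.

Lemma Sf_comb A (I : Type) (r : seq I) v a w : (forall i, l2 h z (v i)) -> l2 h z w ->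
  Sf A (comb r v a) w = \sum_(i <- r) a i * Sf A (v i) w.
Proof.
move=> lv lw; elim: r => [|i r IH].
  rewrite big_nil /Sf (_ : St _ _ _ = fun n => 0 * St A w w n) ?isumZ ?mul0r //.
    exact: (smb_St A lw lw).
  by apply/funext => n; rewrite /St /comb !big_nil; ring.
by rewrite comb_cons big_cons (Sf_lincomb A (a i) (l2_comb r a lv) (lv i) lw) IH addrC.
Qed.

Lemma Bf_comb_diag m (v : 'I_m -> int -> R) a (b : 'I_m -> R) : (forall i, l2 h z (v i)) ->
  (forall i j, Bf h z (v i) (v j) = (i == j)%:R * b i) ->
  Bf h z (comb (index_enum 'I_m) v a) (comb (index_enum 'I_m) v a) = \sum_i a i ^+ 2 * b i.
Proof.
move=> lv o; have lc := l2_comb (index_enum 'I_m) a lv.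
rewrite (Bf_comb _ a lv lc); apply: eq_bigr => i _.
rewrite BfC (Bf_comb _ a lv (lv i)) (bigD1 i) //= o eqxx mul1r big1 ?addr0;
  first by rewrite expr2 mulrA.
by move=> j ji; rewrite o (negbTE ji) mul0r mulr0.
Qed.

Lemma Sf_comb_diag A m (v : 'I_m -> int -> R) a (b : 'I_m -> R) : (forall i, l2 h z (v i)) ->
  (forall i j, Sf A (v i) (v j) = (i == j)%:R * b i) ->
  Sf A (comb (index_enum 'I_m) v a) (comb (index_enum 'I_m) v a) = \sum_i a i ^+ 2 * b i.
Proof.
move=> lv o; have lc := l2_comb (index_enum 'I_m) a lv.
rewrite (Sf_comb A _ a lv lc); apply: eq_bigr => i _.
rewrite SfC (Sf_comb A _ a lv (lv i)) (bigD1 i) //= o eqxx mul1r big1 ?addr0;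
  first by rewrite expr2 mulrA.
by move=> j ji; rewrite o (negbTE ji) mul0r mulr0.
Qed.

(** There are fewer orthogonality conditions than coefficients, so the matrix of the conditions has
    a nonzero kernel vector. *)
Lemma orthogonal_comb m (v : 'I_m -> int -> R) s (Y : R -> int -> R) : (size s < m)%N ->
  (forall i, l2 h z (v i)) -> (forall mu, mu \in s -> l2 h z (Y mu)) ->
  exists2 a : 'I_m -> R, exists i, a i != 0 &
    forall mu, mu \in s -> Bf h z (comb (index_enum 'I_m) v a) (Y mu) = 0.
Proof.
move=> sm lv lY; pose M := \matrix_(i < m, j < size s) Bf h z (v i) (Y (nth 0 s j)).
have : kermx M != 0.
  rewrite kermx_eq0 /row_free neq_ltn; apply/orP; left.
  exact: leq_ltn_trans (rank_leq_col M) sm.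
case/rowV0Pn => a /sub_kermxP aM a0; exists (a ord0).
  apply: contrapT => H; case/eqP: a0; apply/rowP => i; rewrite mxE.
  by apply/eqP/negPn/negP => ai; apply: H; exists i.
move=> mu ms; have js : (index mu s < size s)%N by rewrite index_mem.
have := congr1 (fun X : 'rV_(size s) => X ord0 (Ordinal js)) aM; rewrite !mxE => E.
rewrite (Bf_comb _ _ lv (lY _ ms)) -[RHS]E; apply: eq_bigr => i _.
by rewrite mxE /= nth_index.
Qed.

Lemma next_eigval A (c : R) m (v : 'I_m -> int -> R) s : (size s < m)%N -> uniq s -> 0 <= c ->
  (forall mu, mu \in s -> 0 < mu /\ eigval h z A mu) ->
  (forall i, l2 h z (v i)) ->
  (forall a x, (exists i, a i != 0) -> x = comb (index_enum 'I_m) v a ->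
     c * Bf h z x x < Sf A x x) ->
  exists nu, [/\ nu \notin s, c < nu, eigval h z A nu &
    forall mu, 0 < mu -> eigval h z A mu -> mu \notin s -> mu <= nu].
Proof.
move=> sm us c0 es lv pos.
have [Y HY] : {Y : R -> int -> R & forall mu, mu \in s ->
    eigvec h z A mu (Y mu) /\ Bf h z (Y mu) (Y mu) = 1}.
  apply: (@choice _ _ (fun mu y => mu \in s -> eigvec h z A mu y /\ Bf h z y y = 1)) => mu.
  have [ms|_] := boolP (mu \in s); last by exists (fun=> 0).
  by have [y Hy] := eigval_unit (es _ ms).2; exists y.
have s0 mu (ms : mu \in s) := (es mu ms).1.
have eY mu (ms : mu \in s) := (HY mu ms).1.
have Y1 mu (ms : mu \in s) := (HY mu ms).2.
have lY mu (ms : mu \in s) : l2 h z (Y mu) by have [] := eY mu ms.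
have [a a0 oa] := orthogonal_comb sm lv lY.
have [nu [y [ey cnu oy ymax]]] :=
  next_eigenvector h0 us s0 eY Y1 (l2_comb (index_enum 'I_m) a lv) oa c0 (pos a _ a0 erefl).
have nu0 : 0 < nu := le_lt_trans c0 cnu.
exists nu; split => //; last 2 first.
- by exists y.
- move=> mu mu0 [w ew] ms; have [w0 lw _] := ew.
  have ow mu' : mu' \in s -> Bf h z w (Y mu') = 0.
    move=> ms'; apply: (eigvec_orth h0 mu0 (s0 _ ms') _ ew (eY _ ms')).
    by apply: contraNneq ms => ->.
  have := ymax w lw ow; rewrite (eigvec_Sf h0 mu0 ew lw) ler_pM2r //; exact: Bf_gt0.
(* Eigenvalues are simple: an eigenvector with eigenvalue in s would be proportional to the known
   one, yet it is orthogonal to it. *)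
apply/negP => ns; have [y0 ly sy] := ey; have [Y0 lYn sY] := eY _ ns.
have [My Hy] := l2_bounded ly; have [MY HY'] := l2_bounded lYn.
have [k Hk] := sol_proportional h0 nu0 sy sY y0 Hy (fun N => HY' _).
have := oy _ ns; rewrite (_ : Y nu = fun n => k * y n); last by apply/funext.
rewrite BfC (Bf_scale k ly ly) => /eqP; rewrite mulf_eq0 [Bf _ _ _ _ == 0]gt_eqF ?orbF;
  last exact: Bf_gt0.
move=> /eqP k0; have [n] := Y0; by rewrite Hk k0 mul0r eqxx.
Qed.

(** Courant-Fischer in counting form, by repeated extraction of the largest remaining eigenvalue.
    The strict inequality for all nonzero coefficients already forces the v i to be independent. *)
Lemma top_eigvals A (c : R) m (v : 'I_m -> int -> R) k : (k <= m)%N -> 0 <= c ->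
  (forall i, l2 h z (v i)) ->
  (forall a x, (exists i, a i != 0) -> x = comb (index_enum 'I_m) v a ->
     c * Bf h z x x < Sf A x x) ->
  exists s, [/\ uniq s, size s = k, forall mu, mu \in s -> c < mu /\ eigval h z A mu &
    forall mu, 0 < mu -> eigval h z A mu -> mu \notin s -> forall nu, nu \in s -> mu <= nu].
Proof.
move=> km c0 lv pos; elim: k km => [|k IH] km; first by exists [::].
have [s [us ss es tops]] := IH (ltnW km).
have sm : (size s < m)%N by rewrite ss.
have es' mu : mu \in s -> 0 < mu /\ eigval h z A mu.
  by move=> /es[cm em]; split => //; exact: le_lt_trans cm.
have [nu [ns cnu en topn]] := next_eigval sm us c0 es' lv pos.
exists (nu :: s); split => /=; rewrite ?ns ?us ?ss //.
  by move=> mu; rewrite inE => /orP[/eqP->|/es].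
move=> mu mu0 em; rewrite inE negb_or => /andP[mn ms] nu'.
rewrite inE => /orP[/eqP->|]; [exact: topn|exact: tops].
Qed.

(* Moving the diagonal parameter by [A' - A] changes the Rayleigh quotient by
   [(A' - A) t] with [t = Uf / Bf] in [(0, 1]]. *)
Lemma transfer A A' s (c c' : R) : uniq s -> 0 <= c' -> 0 < c ->
  (forall mu, mu \in s -> c <= mu /\ eigval h z A mu) ->
  (forall t : R, 0 < t -> t <= 1 -> c' < c + (A' - A) * t) ->
  exists s', [/\ uniq s', size s' = size s & forall mu, mu \in s' -> c' < mu /\ eigval h z A' mu].
Proof.
move=> us c0' c0 es H; pose m := size s.
have [Y HY] : {Y : 'I_m -> int -> R & forall i : 'I_m,
    eigvec h z A (nth 0 s i) (Y i) /\ Bf h z (Y i) (Y i) = 1}.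
  apply: (@choice _ _ (fun (i : 'I_m) y => eigvec h z A (nth 0 s i) y /\ Bf h z y y = 1)) => i.
  apply: eigval_unit; exact: (es _ (mem_nth 0 (ltn_ord i))).2.
have p i : 0 < nth 0 s (i : 'I_m) := lt_le_trans c0 (es _ (mem_nth 0 (ltn_ord i))).1.
have lY i : l2 h z (Y i) by have [] := (HY i).1.
have B i j : Bf h z (Y i) (Y j) = (i == j)%:R * 1.
  have [->|ij] := eqVneq i j; first by rewrite (HY j).2 mulr1.
  rewrite mul0r; apply: (eigvec_orth h0 (p i) (p j) _ (HY i).1 (HY j).1).
  by rewrite nth_uniq.
have S i j : Sf A (Y i) (Y j) = (i == j)%:R * nth 0 s i.
  rewrite (eigvec_Sf h0 (p j) (HY j).1 (lY i)) B mulr1 mulrC.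
  by have [->|_] := eqVneq i j; rewrite ?mul0r.
have [s' [us' ss' es' _]] : exists s', [/\ uniq s', size s' = m,
    forall mu, mu \in s' -> c' < mu /\ eigval h z A' mu &
    forall mu, 0 < mu -> eigval h z A' mu -> mu \notin s' -> forall nu, nu \in s' -> mu <= nu].
  apply: (top_eigvals (v := Y)) => // a x [i0 a0] xa.
    have lx : l2 h z x by rewrite xa; exact: l2_comb.
  have Bx : Bf h z x x = \sum_i a i ^+ 2 * 1 by rewrite xa; exact: Bf_comb_diag.
  have Sx : Sf A x x = \sum_i a i ^+ 2 * nth 0 s i.
    by rewrite xa; exact: Sf_comb_diag.
  have B0 : 0 < Bf h z x x.
    rewrite Bx (bigD1 i0) //= ltr_pwDl //; first by rewrite mulr1 exprn_even_gt0.
    by apply: sumr_ge0 => i _; rewrite mulr1 sqr_ge0.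
  have SB : c * Bf h z x x <= Sf A x x.
    rewrite Bx Sx mulr_sumr; apply: ler_sum => i _; rewrite mulr1 mulrC.
    by apply: ler_wpM2l; [exact: sqr_ge0|exact: (es _ (mem_nth 0 (ltn_ord i))).1].
  have x0 : exists n, x n != 0.
    by apply: contrapT => x0; move: B0; rewrite (not_nonzero x0) (Bf_sqr_scale 0 lx) expr0n mul0r
      ltxx.
  rewrite (Sf_shiftA A A' lx).
  have U0 := Uf_gt0 lx x0; have U1 := Uf_le_Bf lx.
  have := H (Uf x x / Bf h z x x); rewrite ler_pdivrMr // mul1r => /(_ (divr_gt0 U0 B0) U1).
  rewrite -(ltr_pM2r B0) mulrDl -mulrA divfK ?gt_eqF // => H'.
  by apply: (lt_le_trans H'); rewrite lerD2r.
by exists s'.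
Qed.

(* The supports are pairwise not adjacent, so that [Sf 0] is the identity on the
   span of these test functions. *)
Definition pairfun m (i : 'I_m) : int -> R :=
  lincomb (fun n => (n == (3 * i)%N%:Z)%:R) 1 (fun n => (n == (3 * i)%N%:Z + 1)%:R).

Lemma l2_pairfun m (i : 'I_m) : l2 h z (pairfun i).
Proof. by apply: l2_lincomb; exact: l2_delta. Qed.

Lemma Sf_pairfun m (i j : 'I_m) : Sf 0 (pairfun i) (pairfun j) = (i == j)%:R * 1.
Proof.
have li := l2_pairfun i; rewrite SfC [pairfun j]/pairfun.
rewrite (Sf_lincomb 0 1 (l2_delta h z _) (l2_delta h z _) li).
rewrite SfC (Sf_delta 0 _ li) SfC (Sf_delta 0 _ li) /pairfun /lincomb.
have -> : ((3 * j)%N%:Z - 1 == (3 * i)%N%:Z) = false by lia.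
have -> : ((3 * j)%N%:Z - 1 == (3 * i)%N%:Z + 1) = false by lia.
have -> : ((3 * j)%N%:Z + 1 == (3 * i)%N%:Z) = false by lia.
have -> : ((3 * j)%N%:Z + 1 == (3 * i)%N%:Z + 1) = (i == j) by rewrite -val_eqE /=; lia.
have -> : ((3 * j)%N%:Z + 1 - 1 == (3 * i)%N%:Z) = (i == j) by rewrite -val_eqE /=; lia.
have -> : ((3 * j)%N%:Z + 1 - 1 == (3 * i)%N%:Z + 1) = false by lia.
have -> : ((3 * j)%N%:Z + 1 + 1 == (3 * i)%N%:Z) = false by lia.
have -> : ((3 * j)%N%:Z + 1 + 1 == (3 * i)%N%:Z + 1) = false by lia.
by case: (i == j) => /=; field.
Qed.

(** Here lam is the eigenvalue following the n top ones. It lies strictly below them because the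
    extracted eigenvalues are distinct. *)
Lemma top_eigvals0 n : exists s lam, [/\ uniq s, size s = n,
   (forall mu, mu \in s -> lam < mu /\ eigval h z 0 mu), 0 < lam &
   forall mu, 0 < mu -> eigval h z 0 mu -> mu \notin s -> mu <= lam].
Proof.
have pos (a : 'I_n.+1 -> R) (x : int -> R) : (exists i, a i != 0) ->
    x = comb (index_enum 'I_n.+1) (@pairfun n.+1) a -> 0 * Bf h z x x < Sf 0 x x.
  move=> [i0 a0] ->; rewrite mul0r.
  rewrite (Sf_comb_diag a (@l2_pairfun n.+1) (@Sf_pairfun n.+1)) (bigD1 i0) //= ltr_pwDl //.
    by rewrite mulr1 exprn_even_gt0.
  by apply: sumr_ge0 => i _; rewrite mulr1 sqr_ge0.
have [s [us ss es tops]] := top_eigvals (leqnSn n) (lexx 0) (@l2_pairfun n.+1) pos.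
have sn : (size s < n.+1)%N by rewrite ss.
have [nu [ns nu0 en topn]] := next_eigval sn us (lexx 0) es (@l2_pairfun n.+1) pos.
exists s, nu; split => // mu ms; split; last by have [] := es _ ms.
rewrite lt_neqAle (tops _ nu0 en ns _ ms) andbT; apply: contraNneq ns => ->; exact: ms.
Qed.

End FixedSite.

(** At A = 0 the parameter is its own negative, so F + G Phi = F - G Phi, hence G = 0 and the
    determinant does not see the site. *)
Lemma eigval0_site z z' (mu : R) : 0 < mu -> eigval h z 0 mu -> eigval h z' 0 mu.
Proof.
move=> mu0 /(eigval_D0 h0 mu0) Dz; apply: (D0_eigval h0 mu0).
have b0 : 0 < (2 * mu)^-1 by rewrite invr_gt0 mulr_gt0.
have [F [G FG]] := D_affine h0 b0 0; have [e1 e2] := FG z; have [e3 _] := FG z'.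
rewrite oppr0 Dz in e2; rewrite Dz in e1; rewrite e3.
have p := Phi_gt0 h0 z.
have G0 : G = 0.
  apply/eqP; have : G * Phi h z == 0 by apply/eqP; lra.
  by rewrite mulf_eq0 [Phi _ _ == 0]gt_eqF // orbF.
by move: e1; rewrite G0 !mul0r addr0.
Qed.

(* [D] is affine in [Phi] with slope odd and intercept even in [A], so between
   two sites with [Phi z2 < Phi z1] the sign of [D] at [z1] changes as the
   parameter runs over [-A, A]. *)
Lemma eigval_crossing A z1 z2 (mu : R) : 0 < A -> 0 < mu -> 0 <= z1 -> z1 < z2 -> z2 <= h / 2 ->
  eigval h z2 A mu -> exists A', [/\ - A <= A', A' < A & eigval h z1 A' mu].
Proof.
move=> A0 mu0 z10 z12 z2h /(eigval_D0 h0 mu0) Dz.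
have b0 : 0 < (2 * mu)^-1 by rewrite invr_gt0 mulr_gt0.
have [F [G FG]] := D_affine h0 b0 A; have [e2 _] := FG z2; have [e1 e1'] := FG z1.
have P2 := Phi_gt0 h0 z2; have P12 := Phi_lt h0 z10 z12 z2h.
(* If the determinant also vanishes at z1, an affine function of Phi has two zeros, so F = G = 0 and
   - A serves. Excluding this case keeps the intermediate value from being A itself. *)
rewrite Dz in e2; have [DA|DA] := eqVneq (D h (2 * mu)^-1 A z1) 0.
  exists (- A); split => //; first lra.
  apply: (D0_eigval h0 mu0); rewrite e1'; rewrite DA in e1.
  have G0 : G = 0.
    apply/eqP; have : G * (Phi h z1 - Phi h z2) == 0 by apply/eqP; lra.
    by rewrite mulf_eq0 subr_eq0 [Phi h z1 == _]gt_eqF // orbF.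
  by move: e1; rewrite G0 !mul0r subr0 addr0.
have cD : {within `[- A, A], continuous (fun A => D h (2 * mu)^-1 A z1)}.
  by apply: continuous_subspaceT; exact: continuous_D.
have [||c cA Dc] := IVT (v := 0) _ cD; first lra.
  rewrite e1 e1'; have Fe : F = - (G * Phi h z2) by lra.
  rewrite Fe; have [G0|G0] := leP 0 G.
    have k1 : G * Phi h z2 <= G * Phi h z1 by rewrite ler_wpM2l // ltW.
    have k2 : 0 <= G * Phi h z2 by rewrite mulr_ge0 // ltW.
    rewrite ge_min le_max; move: k1 k2; move: (G * _) (G * _) => p q k1 k2.
    by clear -k1 k2; apply/andP; split; apply/orP; [left|right]; lra.
  have k1 : G * Phi h z1 <= G * Phi h z2 by rewrite ler_wnM2l // ltW.
  have k2 : G * Phi h z2 <= 0 by rewrite mulr_le0_ge0 // ltW.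
  rewrite ge_min le_max; move: k1 k2; move: (G * _) (G * _) => p q k1 k2.
  by clear -k1 k2; apply/andP; split; apply/orP; [right|left]; lra.
move: cA; rewrite in_itv /= => /andP[c1 c2]; exists c; split => //.
  by rewrite lt_neqAle c2 andbT; apply: contraNneq DA => <-; rewrite Dc.
exact: (D0_eigval h0 mu0).
Qed.

Definition eig_enum z A (e : nat -> R) := [/\ forall j, 0 < e j, forall j, e j.+1 < e j &
  forall mu, 0 < mu -> eigval h z A mu <-> exists j, e j = mu].

Lemma eig_enum_lt z A e i j : eig_enum z A e -> (i < j)%N -> e j < e i.
Proof.
move=> [_ d _]; elim: j => // j IH; rewrite ltnS leq_eqVlt => /orP[/eqP->|/IH]; first exact: d.
exact: lt_trans.
Qed.

(** Pigeonhole: if e n <= c, the n + 1 members of s would all be among e 0, ..., e (n - 1). *)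
Lemma eig_enum_gt z A e s n (c : R) : eig_enum z A e -> uniq s -> size s = n.+1 ->
  0 <= c -> (forall mu, mu \in s -> c < mu /\ eigval h z A mu) -> c < e n.
Proof.
move=> He us ss c0 es; rewrite ltNge; apply/negP => ec.
have [_ _ ev] := He.
have : (size s <= size (map e (iota 0 n)))%N.
  apply: uniq_leq_size => // mu /es[cm /(ev mu (le_lt_trans c0 cm))[j ej]].
  apply/mapP; exists j => //; rewrite mem_iota /= add0n ltnNge; apply/negP => nj.
  move: cm; rewrite -ej; apply/negP; rewrite -leNgt; apply: le_trans ec.
  by move: nj; rewrite leq_eqVlt => /orP[/eqP->//|/(eig_enum_lt He)/ltW].
by rewrite size_map size_iota ss ltnn.
Qed.

Lemma eig_enum_head z A e n : eig_enum z A e ->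
  [/\ uniq (map e (iota 0 n)), size (map e (iota 0 n)) = n &
      forall mu, mu \in map e (iota 0 n) -> e n < mu /\ eigval h z A mu].
Proof.
move=> He; have [e0 _ ev] := He; split.
- rewrite map_inj_uniq ?iota_uniq // => i j ij.
  by case: (ltngtP i j) => // /(eig_enum_lt He); rewrite ij ltxx.
- by rewrite size_map size_iota.
- move=> mu /mapP[j]; rewrite mem_iota add0n => /andP[_ jn] ->.
  by split; [exact: eig_enum_lt He jn|apply/ev => //; exists j].
Qed.

Lemma gap_below (s : seq R) (lam : R) : (forall mu, mu \in s -> lam < mu) ->
  exists2 d, 0 < d & forall mu, mu \in s -> lam + d <= mu.
Proof.
elim: s => [|nu s IH] H; first by exists 1.
have [mu ms|d d0 Hd] := IH; first by apply: H; rewrite inE ms orbT.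
have ln : lam < nu by apply: H; rewrite inE eqxx.
exists (Num.min d (nu - lam)); first by rewrite lt_min d0 subr_gt0.
move=> mu; rewrite inE => /orP[/eqP->|/Hd]; first by rewrite -lerBrDl ge_min lexx orbT.
by apply: le_trans; rewrite lerD2l ge_min lexx.
Qed.

Theorem eig_enum_decreasing n : exists2 d : R, 0 < d & forall A : R, 0 < A -> A < d ->
  forall (z1 z2 : R) e1 e2, 0 <= z1 -> z1 < z2 -> z2 <= h / 2 ->
    eig_enum z1 A e1 -> eig_enum z2 A e2 -> e2 n < e1 n.
Proof.
(* The gap is taken at site 0 and parameter 0; as that spectrum is the same at every site, one d
   serves all z1 and z2. *)
have [s [lam [us ss es lam0 tops]]] := top_eigvals0 0 n.
have [d d0 Hd] := gap_below (fun mu ms => (es mu ms).1).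
(* The bound 2 A < d is used because e2 n may exceed lam by A, and the n eigenvalues above the gap
   may lose A on the way to A'. *)
exists (d / 2); first by rewrite divr_gt0.
move=> A A0 Ad z1 z2 e1 e2 z10 z12 z2h He1 He2.
have [p2 _ ev2] := He2; have en0 := p2 n.
(* Otherwise moving from A to 0 would leave n + 1 eigenvalues above lam, where there are only n. *)
have ele : e2 n <= lam + A.
  rewrite leNgt; apply/negP => elt.
  have [us2 ss2 es2] := eig_enum_head n.+1 He2.
  have es2' mu : mu \in map e2 (iota 0 n.+1) -> e2 n <= mu /\ eigval h z2 A mu.
    move=> ms; split; last by have [] := es2 _ ms.
    move/mapP: ms => [j]; rewrite mem_iota /= add0n ltnS leq_eqVlt => /orP[/eqP->->//|jn ->].
    exact/ltW/(eig_enum_lt He2).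
  have [|s3 [us3 ss3 es3]] := @transfer z2 A 0 _ (e2 n) lam us2 (ltW lam0) en0 es2'.
    move=> t t0 t1; have := ler_wpM2l (ltW A0) t1.
    by rewrite mulr1 sub0r mulNr; move: elt; clear; lra.
  have : (size s3 <= size s)%N.
    apply: uniq_leq_size => // mu /es3[lm em]; apply: contraLR lm => ms.
    rewrite -leNgt; have [m0|m0] := ltP 0 mu; last exact: le_trans m0 (ltW lam0).
    exact: (tops _ m0 (eigval0_site 0 m0 em) ms).
  by rewrite ss3 ss2 ss ltnn.
have em2 : eigval h z2 A (e2 n) by apply/ev2 => //; exists n.
have [A' [A'1 A'2 em1]] := eigval_crossing A0 en0 z10 z12 z2h em2.
have es1 mu : mu \in s -> lam + d <= mu /\ eigval h z1 0 mu.
  move=> ms; split; first exact: Hd.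
  by have [l1 em] := es _ ms; apply: eigval0_site em; exact: lt_trans l1.
have [t t0 t1|s1 [us1 ss1 es1']] :=
    @transfer z1 0 A' s (lam + d) (e2 n) us (ltW en0) ltac:(lra) es1.
  rewrite subr0; have : - A * t <= A' * t by rewrite ler_pM2r.
  have := ler_wpM2l (ltW A0) t1; rewrite mulr1 mulNr.
  by move: Ad ele; clear; lra.
(* At (z1, A') the value e2 n is itself an eigenvalue and lies below the n in s1. These n + 1 values
   are at least e2 n, and the move up to A makes the inequality strict. *)
have us4 : uniq (e2 n :: s1).
  by rewrite /= us1 andbT; apply/negP => /es1'[]; rewrite ltxx.
have es4 mu : mu \in e2 n :: s1 -> e2 n <= mu /\ eigval h z1 A' mu.
  by rewrite inE => /orP[/eqP->//|/es1'[/ltW]].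
have [t t0 t1|s5 [us5 ss5 es5]] := @transfer z1 A' A _ (e2 n) (e2 n) us4 (ltW en0) en0 es4.
  by rewrite ltrDl mulr_gt0 // subr_gt0.
by apply: (eig_enum_gt He1 us5 _ (ltW en0) es5); rewrite ss5 /= ss1 ss.
Qed.

End Counting.

(** * The infinite product of cosh *)

Section Derivatives.
Variable R : realType.
Implicit Types (f g : R -> R) (x c df dg : R).

Lemma der_add f g x df dg : is_derive x 1 f df -> is_derive x 1 g dg ->
  is_derive x 1 (fun t => f t + g t) (df + dg).
Proof. exact: is_deriveD. Qed.

Lemma der_opp f x df : is_derive x 1 f df -> is_derive x 1 (fun t => - f t) (- df).
Proof. exact: is_deriveN. Qed.

Lemma der_mul f g x df dg : is_derive x 1 f df -> is_derive x 1 g dg ->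
  is_derive x 1 (fun t => f t * g t) (f x * dg + g x * df).
Proof. exact: is_deriveM. Qed.

Lemma der_scale c f x df : is_derive x 1 f df -> is_derive x 1 (fun t => c * f t) (c * df).
Proof. by move=> d; have := der_mul (is_derive_cst c x 1) d; rewrite mulr0 addr0. Qed.

Lemma der_comp f g x a df : is_derive (g x) 1 f a -> is_derive x 1 g df ->
  is_derive x 1 (fun t => f (g t)) (a * df).
Proof. exact: is_derive1_comp. Qed.

Lemma der_expR f x df : is_derive x 1 f df -> is_derive x 1 (fun t => expR (f t)) (expR (f x) *
  df).
Proof. exact: der_comp (is_derive_expR _). Qed.

Lemma der_cos f x df : is_derive x 1 f df -> is_derive x 1 (fun t => cos (f t)) (- sin (f x) *
  df).
Proof. exact: der_comp (is_derive_cos _). Qed.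

Lemma der_sin f x df : is_derive x 1 f df -> is_derive x 1 (fun t => sin (f t)) (cos (f x) * df).
Proof. exact: der_comp (is_derive_sin _). Qed.

Lemma der_exp f n x df : is_derive x 1 f df ->
  is_derive x 1 (fun t => f t ^+ n.+1) (n.+1%:R * f x ^+ n * df).
Proof.
move=> d; elim: n => [|n IH]; first by rewrite mul1r mul1r.
rewrite (_ : (fun t => _) = fun t => f t * f t ^+ n.+1); last by apply/funext => t; rewrite exprS.
apply: (is_derive_eq (der_mul d IH)).
by rewrite -[n.+2%:R]natr1 !exprS; ring.
Qed.

Lemma der_cosh f x df : is_derive x 1 f df ->
  is_derive x 1 (fun t => coshR (f t)) (sinhR (f x) * df).
Proof.
move=> d; rewrite (_ : (fun t => _) = fun t => 2^-1 * (expR (f t) + expR (- f t))); last first.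
  by apply/funext => t; rewrite /coshR mulrC.
apply: (is_derive_eq (der_scale _ (der_add (der_expR d) (der_expR (der_opp d))))).
by rewrite /sinhR; field.
Qed.

Lemma der_sinh f x df : is_derive x 1 f df ->
  is_derive x 1 (fun t => sinhR (f t)) (coshR (f x) * df).
Proof.
move=> d; rewrite (_ : (fun t => _) = fun t => 2^-1 * (expR (f t) + - expR (- f t))); last first.
  by apply/funext => t; rewrite /sinhR mulrC.
apply: (is_derive_eq (der_scale _ (der_add (der_expR d) (der_opp (der_expR (der_opp d)))))).
by rewrite /coshR; field.
Qed.

Lemma der_continuous f x df : is_derive x 1 f df -> {for x, continuous f}.
Proof. by move=> d; apply/differentiable_continuous/derivable1_diffP. Qed.

Lemma FTC_segment f F (a b : R) : a < b ->
  (forall x, a <= x <= b -> {for x, continuous f}) ->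
  (forall x, a <= x <= b -> is_derive x 1 F (f x)) ->
  (\int[lebesgue_measure]_(x in `[a, b]) (f x)%:E = (F b - F a)%:E)%E.
Proof.
move=> ab cf dF; rewrite (@continuous_FTC2 _ f F) //.
- apply: continuous_in_subspaceT => x; rewrite inE /= in_itv /=; exact: cf.
- split.
  + move=> x; rewrite in_itv /= => /andP[ax xb].
    by have := dF x; rewrite !ltW // => /(_ isT) [].
  + by apply: cvg_at_right_filter; apply: der_continuous (dF a _); rewrite lexx ltW.
  + by apply: cvg_at_left_filter; apply: der_continuous (dF b _); rewrite lexx ltW.
- move=> x; rewrite in_itv /= => /andP[ax xb]; rewrite derive1E.
  by have := dF x; rewrite !ltW // => /(_ isT) [].
Qed.

Lemma sin_mean (x : R) : 0 < x -> exists2 c, 0 < c < x & sin x = cos c * x.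
Proof.
move=> x0.
have cs : {within `[0, x], continuous (@sin R)} by apply: continuous_subspaceT;
  exact: continuous_sin.
have [c] := MVT x0 (fun t _ => is_derive_sin t) cs.
by rewrite in_itv /= sin0 !subr0 => cx ->; exists c.
Qed.

Lemma cos_ge (x : R) : 1 - x ^+ 2 / 2 <= cos x.
Proof.
have H (u : R) : 0 < u -> 1 - u ^+ 2 / 2 <= cos u.
  move=> u0; have u2 : 0 < u / 2 by rewrite divr_gt0.
  have [c _ sc] := sin_mean u2.
  have : sin (u / 2) ^+ 2 <= (u / 2) ^+ 2.
    by rewrite sc exprMn ler_piMl ?sqr_ge0 // cos2sin2 gerBl sqr_ge0.
  have -> : cos u = 1 - 2 * sin (u / 2) ^+ 2.
    rewrite (_ : u = u / 2 *+ 2) ?cos_mulr2n; last by rewrite -mulr_natr divfK.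
    by rewrite -[u / 2 *+ 2]mulr_natr divfK // cos2sin2 -mulr_natr; ring.
  by move: (sin _) => q; clear; lra.
have [x0|] := ltP 0 x; first exact: H.
rewrite le_eqVlt => /orP[/eqP->|x0]; first by rewrite cos0 expr0n mul0r subr0.
by have := H (- x); rewrite oppr_gt0 cosN sqrrN; apply.
Qed.

Lemma theta_cos_le_sin (x : R) : 0 <= x -> x <= pi / 2 -> x * cos x <= sin x.
Proof.
rewrite le_eqVlt => /orP[/eqP<-|x0] xp; first by rewrite mul0r sin0.
have [c /andP[c0 cx] ->] := sin_mean x0; rewrite mulrC ler_wpM2r ?(ltW x0) //.
have p0 := pi_gt0 R.
rewrite le_eqVlt ltr_cos ?cx ?orbT // in_itv /=; apply/andP; split; lra.
Qed.

Lemma cosh_sub1_le (u : R) : 0 <= u -> coshR u - 1 <= u ^+ 2 / 2 * expR u.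
Proof.
move=> u0; pose p := expR (u / 2); pose q := expR (- (u / 2)).
have pq : p * q = 1 by exact: expRNK.
have Ep : expR u = p ^+ 2 by rewrite expr2 -expRD -splitr.
have Eq : expR (- u) = q ^+ 2 by rewrite expr2 -expRD -opprD -splitr.
have p0 : 0 < p := expR_gt0 _.
have qp : p * (1 - u) <= q.
  have -> : q = p * expR (- u) by rewrite Eq expr2 mulrA pq mul1r.
  by rewrite ler_pM2l //; have := expR_ge1Dx (- u); lra.
have qp' : q <= p by rewrite ler_expR; move: u0; clear; lra.
have h : (p - q) ^+ 2 <= (u * p) ^+ 2.
  by rewrite ler_sqr ?nnegrE ?subr_ge0 ?mulr_ge0 ?(ltW p0) //; move: qp; clear; lra.
rewrite /coshR Ep Eq; move: h; rewrite sqrrB pq exprMn; clear; lra.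
Qed.

End Derivatives.

Section CoshProduct.
Variable R : realType.
Let P : set R := `[0, pi / 2]%classic.
Let pi2 : 0 < pi / 2 :> R. Proof. by rewrite divr_gt0 // pi_gt0. Qed.

(** Wallis integrals with a hyperbolic factor; their recursion in n generates Euler's product for
    cosh. *)
Definition Ic (v : R) n : R := \int[lebesgue_measure]_(x in P) (coshR (v * x) * cos x ^+ n).

Lemma der_line (v x : R) : is_derive x 1 (fun t => v * t) v.
Proof. by have := der_scale v (is_derive_id x 1); rewrite mulr1. Qed.

Lemma continuous_Ic (v : R) n (x : R) : {for x, continuous (fun t : R => coshR (v * t) * cos t ^+
  n)}.
Proof.
case: n => [|n]; last exact: der_continuous (der_mul (der_cosh (der_line v x)) (der_exp n
  (is_derive_cos x))).
rewrite (_ : (fun t => _) = fun t => coshR (v * t));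
  first exact: der_continuous (der_cosh (der_line v x)).
by apply/funext => t; rewrite expr0 mulr1.
Qed.

Lemma integrable_seg (f : R -> R) : continuous f -> lebesgue_measure.-integrable P (EFin \o f).
Proof.
move=> cf; apply: continuous_compact_integrable; first exact: segment_compact.
exact: continuous_subspaceT.
Qed.

Lemma seg_sub (f g : R -> R) : continuous f -> continuous g ->
  \int[lebesgue_measure]_(x in P) (f x - g x) =
  \int[lebesgue_measure]_(x in P) f x - \int[lebesgue_measure]_(x in P) g x.
Proof. by move=> cf cg; apply: RintegralB; [exact: measurable_itv|exact: integrable_seg|exact:
  integrable_seg]. Qed.

Lemma seg_add (f g : R -> R) : continuous f -> continuous g ->
  \int[lebesgue_measure]_(x in P) (f x + g x) =
  \int[lebesgue_measure]_(x in P) f x + \int[lebesgue_measure]_(x in P) g x.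
Proof. by move=> cf cg; apply: RintegralD; [exact: measurable_itv|exact: integrable_seg|exact:
  integrable_seg]. Qed.

Lemma seg_scale c (f : R -> R) : continuous f ->
  \int[lebesgue_measure]_(x in P) (c * f x) = c * \int[lebesgue_measure]_(x in P) f x.
Proof. by move=> cf; apply: RintegralZl; [exact: measurable_itv|exact: integrable_seg]. Qed.

Lemma seg_le (f g : R -> R) : continuous f -> continuous g -> (forall x, P x -> f x <= g x) ->
  \int[lebesgue_measure]_(x in P) f x <= \int[lebesgue_measure]_(x in P) g x.
Proof. by move=> cf cg fg; apply: (@le_Rintegral _ _ _ lebesgue_measure P f g (measurable_itv _)
  (integrable_seg cf) (integrable_seg cg)). Qed.

Lemma Ic_rec v n : (n.+2%:R ^+ 2 + v ^+ 2) * Ic v n.+2 = n.+2%:R * n.+1%:R * Ic v n.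
Proof.
(* The primitive from integrating by parts twice; it vanishes at 0 through sin and sinh, and at pi /
   2 through cos. *)
pose F t := n.+2%:R * (coshR (v * t) * (cos t ^+ n.+1 * sin t)) + v * (sinhR (v * t) * cos t ^+
  n.+2).
pose f t := (n.+2%:R ^+ 2 + v ^+ 2) * (coshR (v * t) * cos t ^+ n.+2) -
  n.+2%:R * n.+1%:R * (coshR (v * t) * cos t ^+ n).
have dF (x : R) : is_derive x 1 F (f x).
  have dc := is_derive_cos x; have l := der_line v x.
  apply: (is_derive_eq (der_add (der_scale n.+2%:R (der_mul (der_cosh l)
    (der_mul (der_exp n dc) (is_derive_sin x)))) (der_scale v (der_mul (der_sinh l) (der_exp n.+1
      dc))))).
  rewrite /f; have := cos2Dsin2 x; rewrite !(exprS _ n.+1) !(exprS _ n) -[n.+2%:R]natr1.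
  move: (cos x) (sin x) (n.+1%:R : R) (coshR _) (sinhR _) => c s m a b cs.
  apply/eqP; rewrite -subr_eq0; apply/eqP.
  transitivity ((m + 1) * m * a * c ^+ n * (1 - (c ^+ 2 + s ^+ 2))); first by ring.
  by rewrite cs subrr mulr0.
have cf (x : R) : {for x, continuous f}.
  apply: cvgB; apply: cvgM; (exact: cvg_cst || exact: continuous_Ic).
have FF : \int[lebesgue_measure]_(x in P) f x = 0.
  rewrite /Rintegral (FTC_segment pi2 (fun x _ => cf x) (fun x _ => dF x)) /=.
  by rewrite /F !sin0 /sinhR !mulr0 oppr0 subrr cos_pihalf !expr0n /= !(mulr0, mul0r) !addr0
    subr0.
apply/eqP; rewrite -subr_eq0 -[X in _ == X]FF; apply/eqP.
rewrite /Ic -(seg_scale _ (@continuous_Ic v n.+2)) -(seg_scale _ (@continuous_Ic v n)) -seg_sub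
  //.
  by move=> x; apply: cvgM; [exact: cvg_cst|exact: continuous_Ic].
by move=> x; apply: cvgM; [exact: cvg_cst|exact: continuous_Ic].
Qed.

Lemma Ic1 v : (1 + v ^+ 2) * Ic v 1 = coshR (v * (pi / 2)).
Proof.
pose F t := coshR (v * t) * sin t + v * (sinhR (v * t) * cos t).
pose f t := (1 + v ^+ 2) * (coshR (v * t) * cos t ^+ 1).
have dF (x : R) : is_derive x 1 F (f x).
  have dc := is_derive_cos x; have l := der_line v x.
  apply: (is_derive_eq (der_add (der_mul (der_cosh l) (is_derive_sin x))
    (der_scale v (der_mul (der_sinh l) dc)))).
  by rewrite /f expr1; ring.
have cf (x : R) : {for x, continuous f} by apply: cvgM; [exact: cvg_cst|exact: continuous_Ic].
have FF : \int[lebesgue_measure]_(x in P) f x = coshR (v * (pi / 2)).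
  rewrite /Rintegral (FTC_segment pi2 (fun x _ => cf x) (fun x _ => dF x)) /=.
  by rewrite /F !sin0 /sinhR !mulr0 oppr0 subrr cos_pihalf sin_pihalf !(mulr0, mul0r) mulr1
    !addr0 subr0.
by rewrite -FF -(seg_scale _ (@continuous_Ic v 1)).
Qed.

Lemma Ic_gt0 n : 0 < Ic 0 n.*2.+1.
Proof.
elim: n => [|n IH].
  have := Ic1 0; rewrite mul0r cosh0 expr0n addr0 mul1r => ->; exact: ltr01.
have := Ic_rec 0 n.*2.+1; rewrite expr0n addr0 => E.
have p : 0 < (n.*2.+3%:R : R) by rewrite ltr0n.
by rewrite doubleS -(pmulr_rgt0 _ (exprn_gt0 2 p)) E !mulr_gt0 ?ltr0n.
Qed.

(** Since cosh (v x) - 1 <= K x^2 and x cos x <= sin x, the excess over v = 0 is at most K cos^n x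
    (1 - cos^2 x). *)
Lemma Ic_bounds v n : 0 <= v ->
  Ic 0 n <= Ic v n /\ Ic v n.+2 <= Ic 0 n.+2 + v ^+ 2 / 2 * expR (v * (pi / 2)) * (Ic 0 n - Ic 0
    n.+2).
Proof.
move=> v0.
have cos0 x : P x -> 0 <= cos x.
  rewrite /P /= in_itv /= => /andP[x0 xp]; apply: cos_ge0_pihalf; apply/andP; split => //.
  by apply: le_trans x0; rewrite oppr_le0 ltW.

split.
  apply: seg_le; [exact: continuous_Ic|exact: continuous_Ic|] => x Px;
    rewrite mul0r cosh0 mul1r ler_peMl ?cosh_ge1 // exprn_ge0 //; exact: cos0.
pose K := v ^+ 2 / 2 * expR (v * (pi / 2)).
rewrite -/K /Ic -(seg_sub (@continuous_Ic 0 n) (@continuous_Ic 0 n.+2)).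
have cB : continuous (fun t : R => coshR (0 * t) * cos t ^+ n - coshR (0 * t) * cos t ^+ n.+2).
  by move=> t; apply: cvgB; exact: continuous_Ic.
have cK : continuous (fun t : R => K * (coshR (0 * t) * cos t ^+ n - coshR (0 * t) * cos t ^+
  n.+2)).
  by move=> t; apply: cvgM; [exact: cvg_cst|exact: cB].
rewrite -(seg_scale K cB) -(seg_add (@continuous_Ic 0 n.+2) cK).
apply: seg_le; [exact: continuous_Ic| |].
  by move=> t; apply: cvgD; [exact: continuous_Ic|exact: cK].
move=> x Px; have c0 := cos0 x Px.
move: Px; rewrite /P /= in_itv /= => /andP[x0 xp].
rewrite !mul0r cosh0 !mul1r; have := theta_cos_le_sin x0 xp.
have e : coshR (v * x) - 1 <= K * x ^+ 2.
  have vx : 0 <= v * x by rewrite mulr_ge0.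
  apply: (le_trans (cosh_sub1_le vx)).
  rewrite [leRHS](_ : _ = (v * x) ^+ 2 / 2 * expR (v * (pi / 2))); last by rewrite /K; ring.
  by rewrite ler_wpM2l ?divr_ge0 ?sqr_ge0 // ler_expR ler_wpM2l.
move=> h.
have h2 : (x * cos x) ^+ 2 <= 1 - cos x ^+ 2.
  rewrite -[_ - _]sin2cos2 ler_sqr // nnegrE ?mulr_ge0 //.
  by apply: le_trans h; rewrite mulr_ge0.
have cn : 0 <= cos x ^+ n by rewrite exprn_ge0.
have K0 : 0 <= K by rewrite mulr_ge0 ?expR_ge0 // divr_ge0 ?sqr_ge0.
have := ler_wpM2r (exprn_ge0 n.+2 c0) e; have := ler_wpM2l (mulr_ge0 K0 cn) h2.
rewrite !(exprS _ n.+1) !(exprS _ n); move: (cos x ^+ n) => p.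
by move: (cos x) (coshR _); clearbody K; clear => c a; lra.
Qed.

(** At v = 0 the recursion gives I_n / I_(n+2) = (n + 2) / (n + 1), so the excess is a vanishing
    fraction of I_(n+2). *)
Lemma Ic_ratio v : 0 <= v -> Ic v n.*2.+1 / Ic 0 n.*2.+1 @[n --> \oo] --> (1 : R).
Proof.
move=> v0; pose K := v ^+ 2 / 2 * expR (v * (pi / 2)).
have K0 : 0 <= K by rewrite mulr_ge0 ?expR_ge0 // divr_ge0 ?sqr_ge0.
rewrite -cvg_shiftS /=.
apply: (@squeeze_cvgr _ _ _ _ (fun=> 1) (fun n => 1 + K * n.+1%:R^-1)).
- apply: nearW => n; have p := Ic_gt0 n.+1; have [lo _] := Ic_bounds n.+1.*2.+1 v0.
  rewrite (ler_pdivlMr _ _ p) mul1r lo /= (ler_pdivrMr _ _ p).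
  have [_ hi] := Ic_bounds n.*2.+1 v0; apply: (le_trans hi); rewrite -/K -doubleS mulrDl mul1r.
  rewrite lerD2l -[leRHS]mulrA; apply: ler_wpM2l => //.
  have := Ic_rec 0 n.*2.+1; rewrite expr0n addr0 expr2 -mulrA -[RHS]mulrA => /mulfI E.
  have {}E := E ltac:(by rewrite pnatr_eq0).
  have q : 0 < (n.*2.+2%:R : R) by rewrite ltr0n.
  have -> : Ic 0 n.*2.+1 = n.*2.+3%:R / n.*2.+2%:R * Ic 0 n.*2.+3.
    by rewrite mulrAC E mulrC mulKf // gt_eqF.
  rewrite doubleS -{2}[Ic 0 n.*2.+3]mul1r -mulrBl; apply: ler_wpM2r;
    first by rewrite doubleS in p; exact: ltW.
  rewrite -[n.*2.+3%:R]natr1 mulrDl divff ?gt_eqF // addrC addKr mul1r.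
  by rewrite lef_pV2 ?posrE ?ltr0n // ler_nat; lia.
- exact: cvg_cst.
- rewrite -[X in _ --> X]addr0 -(mulr0 K); apply: cvgD; first exact: cvg_cst.
  by apply: cvgM; [exact: cvg_cst|exact: cvg_harmonic].
Qed.

Definition cosh_prod (y : R) N : R := \prod_(j < N) (1 + y ^+ 2 / (j%:R + 2^-1) ^+ 2).

(** The parameter v = 2 y fits odd exponents: (2 w)^2 + (2 y)^2 with w = N + 3/2 gives the factor 1
    + y^2 / w^2. *)
Lemma cosh_prodE y N :
  coshR (pi * y) = cosh_prod y N.+1 * (Ic (2 * y) N.*2.+1 / Ic 0 N.*2.+1).
Proof.
elim: N => [|N IH].
  have := Ic1 0; rewrite mul0r cosh0 expr0n addr0 mul1r => ->.
  have := Ic1 (2 * y); rewrite (_ : 2 * y * (pi / 2) = pi * y) => [<-|]; last by field.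
  rewrite /cosh_prod big_ord_recl big_ord0 /= divr1 mulr1; congr (_ * _); by field.
rewrite IH /cosh_prod [in RHS]big_ord_recr /= -mulrA; congr (_ * _).
have p := Ic_gt0 N; have p' := Ic_gt0 N.+1.
have E := Ic_rec (2 * y) N.*2.+1; have E0 := Ic_rec 0 N.*2.+1.
rewrite -doubleS in E E0; rewrite expr0n addr0 in E0.
have k : (N.*2.+3%:R : R) = 2 * (N.+1%:R + 2^-1) by rewrite -doubleS -addn1 natrD -mul2n natrM;
  field.
have m0 : 0 < (N.*2.+2%:R : R) by rewrite ltr0n.
have w0 : 0 < (N.+1%:R + 2^-1 : R) by rewrite addr_gt0 ?ltr0n ?invr_gt0.
move: E E0; rewrite k; move: (N.+1%:R + 2^-1) w0 (N.*2.+2%:R : R) m0 => w w0 m m0 E E0.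
have wm : 2 * w * m != 0 by rewrite !mulf_neq0 ?gt_eqF.
have -> : Ic (2 * y) N.*2.+1 = ((2 * w) ^+ 2 + (2 * y) ^+ 2) * Ic (2 * y) N.+1.*2.+1 / (2 * w *
  m).
  by rewrite E mulrAC divff // mul1r.
have -> : Ic 0 N.*2.+1 = (2 * w) ^+ 2 * Ic 0 N.+1.*2.+1 / (2 * w * m).
  by rewrite E0 mulrAC divff // mul1r.
by field; rewrite !gt_eqF.
Qed.

End CoshProduct.

(** * The Gamma function on the line Re z = 1/2 *)

Section ImproperIntegral.
Variable R : realType.
Implicit Types (f g F : R -> R) (t : R).
Let mu := @lebesgue_measure R.
Let P : set R := `]0, +oo[%classic.
Let S (n : nat) : set R := `[expR (- n.+1%:R), expR n.+1%:R]%classic.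

Let mP : measurable (P : set (measurableTypeR R)). Proof. exact: measurable_itv. Qed.
Let mS n : measurable (S n : set (measurableTypeR R)). Proof. exact: measurable_itv. Qed.

Lemma segments_exhaust : \bigcup_n S n = P.
Proof.
apply/seteqP; split => t.
  by case=> n _; rewrite /S /P /= !in_itv /= andbT => /andP[+ _]; apply: lt_le_trans;
    exact: expR_gt0.
rewrite /P /= in_itv /= andbT => t0.
have [n Hn] : exists n : nat, `|ln t| <= n%:R.
  by exists (Num.truncn `|ln t|).+1; apply/ltW/truncnS_gt.
exists n => //; rewrite /S /= in_itv /= -{1 2}[t]lnK ?posrE // !ler_expR.
have : `|ln t| <= n.+1%:R by apply: le_trans Hn _; rewrite ler_nat.
by rewrite ler_norml.
Qed.

Lemma segments_nondecreasing : {homo S : n m / (n <= m)%N >-> (n <= m)%O}.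
Proof.
move=> n m nm; apply/subsetPset; apply: subset_itvScc.
  by rewrite bnd_simp ler_expR lerN2 ler_nat ltnS.
by rewrite bnd_simp ler_expR ler_nat ltnS.
Qed.

Lemma measurable_continuous f : (forall t, 0 < t -> {for t, continuous f}) -> measurable_fun P f.
Proof.
move=> cf; apply: open_continuous_measurable_fun; first exact: interval_open.
by move=> t; rewrite inE /P /= in_itv /= andbT; exact: cf.
Qed.

Lemma ge0_segment_cvg f : (forall t, 0 < t -> 0 <= f t) -> measurable_fun P f ->
  (\int[mu]_(t in S n) (f t)%:E)%E @[n --> \oo] --> (\int[mu]_(t in P) (f t)%:E)%E.
Proof.
move=> f0 mf; rewrite -segments_exhaust.
have sub n t : S n t -> 0 < t.
  by rewrite /S /= in_itv /= => /andP[+ _]; apply: lt_le_trans; exact: expR_gt0.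
apply: ge0_nondecreasing_set_cvg_integral.
- exact: segments_nondecreasing.
- exact: mS.
- move=> n; apply/measurable_EFinP; apply: measurable_funS mf => // t /sub.
  by rewrite /P /= in_itv /= andbT.
- by move=> n t /sub /f0; rewrite lee_fin.
Qed.

Section Primitive.
Variables (f F : R -> R) (l0 l1 : R).
Hypothesis cf : forall t, 0 < t -> {for t, continuous f}.
Hypothesis dF : forall t, 0 < t -> is_derive t 1 F (f t).
Hypothesis F0 : F (expR (- n.+1%:R)) @[n --> \oo] --> l0.
Hypothesis F1 : F (expR n.+1%:R) @[n --> \oo] --> l1.

Lemma segment_FTC n : (\int[mu]_(t in S n) (f t)%:E = (F (expR n.+1%:R) - F (expR (-
  n.+1%:R)))%:E)%E.
Proof.
apply: FTC_segment.
- by rewrite ltr_expR gt0_cp // ltr0n.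
- by move=> t /andP[+ _] => h; apply: cf; apply: lt_le_trans h; exact: expR_gt0.
- by move=> t /andP[+ _] => h; apply: dF; apply: lt_le_trans h; exact: expR_gt0.
Qed.

Lemma cvg_primitive : (F (expR n.+1%:R) - F (expR (- n.+1%:R)))%:E @[n --> \oo] --> (l1 - l0)%:E.
Proof. by apply: cvg_EFin; [exact: nearW|exact: cvgB]. Qed.

Lemma ge0_primitive_integrable : (forall t, 0 < t -> 0 <= f t) -> mu.-integrable P (EFin \o f).
Proof.
move=> f0; have mf := measurable_continuous cf.
apply/integrableP; split; first exact/measurable_EFinP.
have E : (\int[mu]_(t in P) (f t)%:E = (l1 - l0)%:E)%E.
  have := ge0_segment_cvg f0 mf.
  rewrite (_ : (fun n => _) = fun n => (F (expR n.+1%:R) - F (expR (- n.+1%:R)))%:E); last first.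
    by apply/funext => n; exact: segment_FTC.
  by move=> c; exact: (cvg_unique _ c cvg_primitive).
rewrite (@eq_integral _ _ _ mu P (fun t => (f t)%:E)) ?E ?ltry // => t.
by rewrite inE /P /= in_itv /= andbT => /f0 ft; rewrite ger0_norm.
Qed.

(** Monotone convergence along the segments handles only nonnegative functions, so it is applied to
    the positive and negative parts and the limits are subtracted. *)
Lemma integrable_primitive : mu.-integrable P (EFin \o f) -> \int[mu]_(t in P) f t = l1 - l0.
Proof.
move=> fi; have mf := measurable_continuous cf.
have p0 := @ge0_segment_cvg f^\+ (fun t _ => funrpos_ge0 f t) (measurable_funrpos mf).
have n0 := @ge0_segment_cvg f^\- (fun t _ => funrneg_ge0 f t) (measurable_funrneg mf).
have fp := integrable_fin_num mP (integrable_funrpos mP fi).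
have ad : ((\int[mu]_(t in P) (f^\+ t)%:E) +? - (\int[mu]_(t in P) (f^\- t)%:E))%E.
  by apply: fin_num_adde_defr; exact: fp.
have c := cvgeB ad p0 n0.
have e (Q : set R) : (\int[mu]_(t in Q) (f t)%:E =
    \int[mu]_(t in Q) (f^\+ t)%:E - \int[mu]_(t in Q) (f^\- t)%:E)%E.
  by rewrite integralE (funerpos f) (funerneg f).
have E : (\int[mu]_(t in P) (f t)%:E = (l1 - l0)%:E)%E.
  rewrite e; apply: (cvg_unique _ (c _) _) => //.
  rewrite (_ : (fun n => _) = fun n => (F (expR n.+1%:R) - F (expR (- n.+1%:R)))%:E).
    exact: cvg_primitive.
  by apply/funext => n; rewrite -segment_FTC e.
by rewrite /Rintegral E.
Qed.

End Primitive.
End ImproperIntegral.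

(** * Recursion and bounds for the modulus of Gamma on vertical lines *)

Section GammaIntegrals.
Variable R : realType.
Implicit Types (a c s y t : R).
Let mu := @lebesgue_measure R.
Let P : set R := `]0, +oo[%classic.
Let mP : measurable (P : set (measurableTypeR R)). Proof. exact: measurable_itv. Qed.
Let P0 t : P t -> 0 < t. Proof. by rewrite /P /= in_itv /= andbT. Qed.

Lemma cvg_dist_le (u v : nat -> R) (l : R) : (forall n, `|u n - l| <= v n) ->
  v @ \oo --> (0 : R) -> u @ \oo --> l.
Proof.
move=> uv v0; apply/subr_cvg0; apply/norm_cvg0P.
apply: (@squeeze_cvgr _ _ _ _ (fun=> 0) v) => //; last exact: cvg_cst.
by apply: nearW => n; rewrite normr_ge0 uv.
Qed.

Lemma cvg_expR_geo a : 0 < a -> expR (- (a * n.+1%:R)) @[n --> \oo] --> (0 : R).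
Proof.
move=> a0; rewrite (_ : (fun n => _) = fun n => expR (- a) ^+ n.+1); last first.
  by apply/funext => n; rewrite -mulNr expRM_natr.
rewrite (cvg_shiftS (fun n => expR (- a) ^+ n)).
by apply: cvg_expr; rewrite ger0_norm ?expR_ge0 // -expR0 ltr_expR oppr_lt0.
Qed.

Lemma der_inv (f : R -> R) x df : f x != 0 -> is_derive x 1 f df ->
  is_derive x 1 (fun t => (f t)^-1) (- (f x) ^- 2 * df).
Proof. exact: is_deriveV. Qed.

Lemma der_lnM a t : 0 < t -> is_derive t 1 (fun t => a * ln t) (a / t).
Proof. by move=> t0; exact/der_scale/is_derive1_ln. Qed.

(* Integrable majorant of the Gamma integrand, with primitive - 1 / (1 + t^a). *)
Definition gref a t := a * (expR (a * ln t) * ((1 + expR (a * ln t)) ^+ 2)^-1 * t^-1).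

Lemma gref_integrable a : 0 < a -> mu.-integrable P (EFin \o gref a).
Proof.
move=> a0; pose E t := expR (a * ln t).
have E0 t : 0 < E t := expR_gt0 _.
have E1 t : 1 + E t != 0 by rewrite gt_eqF // addr_gt0.
have dE t : 0 < t -> is_derive t 1 (fun t => 1 + E t) (E t * (a / t)).
  move=> t0; have := der_add (is_derive_cst (1 : R) t 1) (der_expR (der_lnM a t0)).
  by rewrite add0r.
apply: (@ge0_primitive_integrable R (gref a) (fun t => - (1 + E t)^-1) (-1) 0).
- move=> t t0; apply: cvgM; first exact: cvg_cst.
  apply: cvgM; last by apply: cvgV; [rewrite gt_eqF|exact: cvg_id].
  have cE : {for t, continuous E} by apply: der_continuous (der_expR (der_lnM a t0)).
  apply: cvgM; first exact: cE.
  apply: cvgV; first by rewrite expf_neq0.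
  by rewrite /= (_ : (fun _ => _) = fun t => (1 + E t) * (1 + E t)) //; apply: cvgM;
    apply: cvgD; (exact: cvg_cst || exact: cE).
- move=> t t0; apply: (is_derive_eq (der_opp (der_inv (f := fun t => 1 + E t) (E1 t) (dE t t0)))).
  by rewrite /gref -/(E t) mulNr opprK -exprVn; ring.
- apply: (@cvg_dist_le _ (fun n => expR (- (a * n.+1%:R)))); last exact: cvg_expR_geo.
  move=> n; rewrite opprK addrC /E expRK mulrN; set e := expR _.
  have e0 : 0 < e := expR_gt0 _.
  have -> : 1 - (1 + e)^-1 = e / (1 + e) by field; rewrite gt_eqF // addr_gt0.
  by rewrite ger0_norm ?divr_ge0 ?addr_ge0 ?(ltW e0) // ler_pdivrMr ?addr_gt0 // ler_peMr ?(ltW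
    e0) // lerDl ltW.
- apply: (@cvg_dist_le _ (fun n => expR (- (a * n.+1%:R)))); last exact: cvg_expR_geo.
  move=> n; rewrite subr0 normrN /E expRK expRN; set e := expR _.
  have e0 : 0 < e := expR_gt0 _.
  by rewrite ger0_norm ?invr_ge0 ?addr_ge0 ?(ltW e0) // lef_pV2 ?posrE ?addr_gt0 // lerDr.
- by move=> t t0; rewrite !mulr_ge0 ?invr_ge0 ?sqr_ge0 ?(ltW a0) ?(ltW t0) ?(ltW (E0 t)).
Qed.

(** The Gamma weight t^(a-1) exp (- t) for t > 0, with the power kept inside the exponential so that
    derivatives are elementary. *)
Definition gweight a t := expR (a * ln t - t) / t.

Lemma gweight_ge0 a t : 0 < t -> 0 <= gweight a t.
Proof. by move=> t0; rewrite divr_ge0 ?expR_ge0 ?ltW. Qed.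

Lemma ln_bound a t : 0 < a -> 0 < t -> a * ln t - t <= a * ln a.
Proof.
move=> a0 t0; have ta : 0 < t / a by rewrite divr_gt0.
have := @le_ln1Dx R (t / a - 1); rewrite ltrBrDr addNr ta addrC subrK => /(_ isT).
rewrite ln_div ?posrE // -(ler_pM2l a0) !mulrBr mulr1 mulrCA divff ?gt_eqF // mulr1.
by move: (a * ln t) (a * ln a) => p q; move: a0; clear; lra.
Qed.

(** With E = t^a one has (1 + E)^2 <= 2 + 2 E^2, and E^2 exp (- t) <= (2 a)^(2 a). *)
Lemma gweight_le a : 0 < a -> exists2 K, 0 < K & forall t, 0 < t -> gweight a t <= K * gref a t.
Proof.
move=> a0; pose C := expR (2 * a * ln (2 * a)).
have C0 : 0 < C := expR_gt0 _.
exists ((2 + 2 * C) / a); first by rewrite divr_gt0 // addr_gt0 // mulr_gt0.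
move=> t t0; rewrite /gref /gweight expRD; set E := expR (a * ln t); set d := expR (- t).
have E0 : 0 < E := expR_gt0 _; have d0 : 0 < d := expR_gt0 _.
have d1 : d <= 1 by rewrite -expR0 ler_expR oppr_le0 ltW.
have Ed : E ^+ 2 * d <= C.
  rewrite expr2 -!expRD ler_expR; have := ln_bound (mulr_gt0 (ltr0Sn R 1) a0) t0.
  by rewrite -[2 * a * ln t]mulrA; move: (a * ln t) (2 * a * ln _) => p q; clear; lra.
have key : (1 + E) ^+ 2 * d <= 2 + 2 * C.
  have := mulr_ge0 (ltW d0) (sqr_ge0 (1 - E)); move: Ed d1; clear; nra.
have p0 : 0 < (1 + E) ^+ 2 by rewrite exprn_gt0 // addr_gt0.
have -> : (2 + 2 * C) / a * (a * (E * ((1 + E) ^+ 2)^-1 * t^-1)) =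
    (2 + 2 * C) * (E / ((1 + E) ^+ 2 * t)).
  by field; rewrite !gt_eqF // addr_gt0.
have -> : E * d / t = (1 + E) ^+ 2 * d * (E / ((1 + E) ^+ 2 * t)).
  by field; rewrite !gt_eqF // addr_gt0.
by apply: ler_wpM2r key; rewrite divr_ge0 ?(ltW E0) // mulr_ge0 ?ltW.
Qed.

Definition gosc c s y t := c * cos (y * ln t) + s * sin (y * ln t).

Lemma gosc_le c s y t : `|gosc c s y t| <= `|c| + `|s|.
Proof.
apply: le_trans (ler_normD _ _) _; rewrite !normrM; apply: lerD.
  by rewrite ler_piMr // ler_norml cos_geN1 cos_le1.
by rewrite ler_piMr // ler_norml sin_geN1 sin_le1.
Qed.

Lemma der_gosc c s y t : 0 < t -> is_derive t 1 (gosc c s y) (y / t * gosc s (- c) y t).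
Proof.
move=> t0; have l := der_lnM y t0.
apply: (is_derive_eq (der_add (der_scale c (der_cos l)) (der_scale s (der_sin l)))).
by rewrite /gosc; ring.
Qed.

Lemma der_expln a t : 0 < t -> is_derive t 1 (fun t => expR (a * ln t - t)) (expR (a * ln t - t)
  * (a / t - 1)).
Proof. by move=> t0; apply: der_expR; exact: (der_add (der_lnM a t0) (der_opp (is_derive_id t
  1))). Qed.

Lemma gweight_continuous a t : 0 < t -> {for t, continuous (gweight a)}.
Proof.
move=> t0; apply: cvgM; first exact: der_continuous (der_expln a t0).
by apply: cvgV; [rewrite gt_eqF|exact: cvg_id].
Qed.

Lemma gosc_continuous c s y t : 0 < t -> {for t, continuous (gosc c s y)}.
Proof. by move=> t0; exact: der_continuous (der_gosc c s y t0). Qed.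

Lemma gamma_integrable a c s y : 0 < a ->
  mu.-integrable P (EFin \o (fun t => gweight a t * gosc c s y t)).
Proof.
move=> a0; have [K K0 HK] := gweight_le a0.
pose M := (`|c| + `|s|) * K.
have M0 : 0 <= M by rewrite mulr_ge0 ?addr_ge0 ?(ltW K0).
apply: (@le_integrable _ _ _ mu P mP _ (EFin \o (fun t => M * gref a t))).
- apply/measurable_EFinP; apply: measurable_continuous => t t0.
  by apply: cvgM; [exact: gweight_continuous|exact: gosc_continuous].
- move=> t /P0 t0; rewrite /= lee_fin normrM (ger0_norm (gweight_ge0 a t0)).
  have g0 : 0 <= gref a t.
    by rewrite !mulr_ge0 ?invr_ge0 ?sqr_ge0 ?expR_ge0 ?(ltW a0) ?(ltW t0).
  rewrite [leRHS](ger0_norm (mulr_ge0 M0 g0)).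
  have -> : M * gref a t = (`|c| + `|s|) * (K * gref a t) by rewrite [RHS]mulrA.
  rewrite mulrC.
  by apply: ler_pM => //; [exact: gweight_ge0|exact: gosc_le|exact: HK].
- exact: (integrableZl mP M (gref_integrable a0)).
Qed.

(* [GI a c s y] is the real part of (c - i s) Gamma(a + i y). *)
Definition GI a c s y : R := \int[mu]_(t in P) (gweight a t * gosc c s y t).

Lemma GI_linear a c s y : 0 < a -> GI a c s y = c * GI a 1 0 y + s * GI a 0 1 y.
Proof.
move=> a0; rewrite /GI -(RintegralZl c mP (gamma_integrable 1 0 y a0)).
rewrite -(RintegralZl s mP (gamma_integrable 0 1 y a0)) -RintegralD //.
- by apply: eq_Rintegral => t _; rewrite /gosc; ring.
- exact: (integrableZl mP c (gamma_integrable 1 0 y a0)).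
- exact: (integrableZl mP s (gamma_integrable 0 1 y a0)).
Qed.

Lemma gweightS a t : 0 < t -> gweight (a + 1) t = expR (a * ln t - t).
Proof.
move=> t0; rewrite /gweight mulrDl mul1r addrAC expRD lnK ?posrE // mulfK //.
by rewrite gt_eqF.
Qed.

(** The functional equation Gamma(a + 1 + iy) = (a + iy) Gamma(a + iy), by parts with boundary
    function t^a exp (- t) times the oscillating factor. *)
Lemma GI_rec a c s y : 0 < a -> GI (a + 1) c s y = a * GI a c s y + y * GI a s (- c) y.
Proof.
move=> a0; have a1 : 0 < a + 1 by rewrite addr_gt0.
pose F t := expR (a * ln t - t) * gosc c s y t.
pose f t := (a * (gweight a t * gosc c s y t) + y * (gweight a t * gosc s (- c) y t)) -
  gweight (a + 1) t * gosc c s y t.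
have i1 := gamma_integrable c s y a0; have i2 := gamma_integrable s (- c) y a0.
have i3 := gamma_integrable c s y a1.
have i4 := integrableZl mP a i1; have i5 := integrableZl mP y i2.
have i6 := integrableD mP i4 i5.
have cc b p q t : 0 < t -> {for t, continuous (fun t => gweight b t * gosc p q y t)}.
  by move=> t0; apply: cvgM; [exact: gweight_continuous|exact: gosc_continuous].
have : \int[mu]_(t in P) f t = 0 - 0.
  apply: (@integrable_primitive R f F 0 0).
  - move=> t t0; apply: cvgB; last exact: cc.
    by apply: cvgD; apply: cvgM; (exact: cvg_cst || exact: cc).
  - move=> t t0; apply: (is_derive_eq (der_mul (der_expln a t0) (der_gosc c s y t0))).
    by rewrite /f gweightS // /gweight; ring.
  - apply: (@cvg_dist_le _ (fun n => (`|c| + `|s|) * expR (- (a * n.+1%:R)))); last first.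
      by rewrite -(mulr0 (`|c| + `|s|)); apply: cvgM; [exact: cvg_cst|exact: cvg_expR_geo].
    move=> n; rewrite subr0 normrM mulrC expRK; apply: ler_pM => //; first exact: gosc_le.
    by rewrite ger0_norm ?expR_ge0 // ler_expR mulrN gerDl oppr_le0 expR_ge0.
  - pose C := expR (2 * a * ln (2 * a)).
    apply: (@cvg_dist_le _ (fun n => (`|c| + `|s|) * (C * expR (- (a * n.+1%:R))))); last first.
      rewrite -(mulr0 (`|c| + `|s|)); apply: cvgM; first exact: cvg_cst.
      by rewrite -(mulr0 C); apply: cvgM; [exact: cvg_cst|exact: cvg_expR_geo].
    move=> n; rewrite subr0 normrM mulrC; apply: ler_pM => //; first exact: gosc_le.
    rewrite ger0_norm ?expR_ge0 // -expRD ler_expR.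
    have := ln_bound (mulr_gt0 (ltr0Sn R 1) a0) (expR_gt0 n.+1%:R);
      rewrite expRK -[2 * a * n.+1%:R]mulrA.
    by rewrite /C; move: (a * n.+1%:R) (expR _) (2 * a * ln _) => p e q; clear; lra.
  - exact: (integrableB mP i6 i3).
rewrite subr0 /f (RintegralB mP i6 i3) (RintegralD mP i4 i5) (RintegralZl a mP i1) (RintegralZl y
  mP i2).
by move/eqP; rewrite subr_eq0 => /eqP H; exact: esym H.
Qed.

Definition G0 a := GI a 1 0 0.

Lemma gosc0 t : gosc 1 0 0 t = 1.
Proof. by rewrite /gosc !mul0r cos0 mulr1 addr0. Qed.

Lemma G0_rec a : 0 < a -> G0 (a + 1) = a * G0 a.
Proof. by move=> a0; rewrite /G0 GI_rec // mul0r addr0. Qed.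

Definition gsq a y := GI a 1 0 y ^+ 2 + GI a 0 1 y ^+ 2.

Lemma gsq_rec a y : 0 < a -> gsq (a + 1) y = (a ^+ 2 + y ^+ 2) * gsq a y.
Proof.
by move=> a0; rewrite /gsq !GI_rec // (GI_linear 0 (-1) y a0) (GI_linear 1 (- 0) y a0); ring.
Qed.

Lemma GI_le a c s y a' c' s' y' (k : R) : 0 < a -> 0 < a' ->
  (forall t, 0 < t -> gweight a t * gosc c s y t <= k * (gweight a' t * gosc c' s' y' t)) ->
  GI a c s y <= k * GI a' c' s' y'.
Proof.
move=> a0 a0' H; have i := gamma_integrable c s y a0; have i' := gamma_integrable c' s' y' a0'.
rewrite /GI -(RintegralZl k mP i'); apply: (@le_Rintegral _ _ _ mu P _ _ mP i (integrableZl mP k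
  i')).
by move=> t /P0; exact: H.
Qed.

(** Multiplying Gamma by its own conjugate aligns its phase: |Gamma|^2 becomes one integral, whose
    oscillating factor is at most |Gamma| by Cauchy-Schwarz. *)
Lemma gsq_le a y : 0 < a -> Num.sqrt (gsq a y) <= G0 a.
Proof.
move=> a0; set r := Num.sqrt _.
have r0 : 0 <= r := sqrtr_ge0 _.
have r2 : r ^+ 2 = gsq a y by rewrite sqr_sqrtr // addr_ge0 ?sqr_ge0.
pose c := GI a 1 0 y; pose s := GI a 0 1 y.
have H : GI a c s y <= r * G0 a.
  apply: GI_le => // t t0; rewrite gosc0 mulr1 mulrC; apply: ler_wpM2r; first exact: gweight_ge0.
  apply: le_trans (ler_norm _) _; rewrite -ler_sqr ?nnegrE // real_normK ?num_real // r2 /gsq -/c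
    -/s.
  have := sqr_ge0 (c * sin (y * ln t) - s * cos (y * ln t)); have := cos2Dsin2 (y * ln t).
  rewrite /gosc; move: (cos _) (sin _) => p q e.
  rewrite -[X in _ -> _ <= X]mulr1 -e; move: c s => c s; clear; lra.
rewrite GI_linear // -!expr2 -/(gsq a y) -r2 expr2 in H.
have [->|rn] := eqVneq r 0; last by rewrite ler_pM2l // lt_neqAle eq_sym rn in H.
by apply: Rintegral_ge0 => t /P0 t0; rewrite gosc0 mulr1 gweight_ge0.
Qed.

Lemma G0_half_gt0 : 0 < G0 2^-1.
Proof.
have h0 : 0 < 2^-1 :> R by rewrite invr_gt0.
pose F t : R := - (2^-1 * expR (- 2 * t)).
have dl t := der_scale (- 2) (is_derive_id t 1).
have cf t : 0 < t -> {for t, continuous (fun t => expR (- 2 * t) : R)}.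
  by move=> _; exact: der_continuous (der_expR (dl t)).
have dF t : 0 < t -> is_derive t 1 F (expR (- 2 * t)).
  move=> _; apply: (is_derive_eq (der_opp (der_scale 2^-1 (der_expR (dl t))))).
  by rewrite mulr1; field.
have e1 := @cvg_expR_geo 1 ltr01.
have F0 : F (expR (- n.+1%:R)) @[n --> \oo] --> (- 2^-1 : R).
  apply: (@cvg_dist_le _ _ _ _ e1) => n; rewrite /F mul1r; set e := expR (- _).
  have e0 : 0 < e := expR_gt0 _.
  have h1 : expR (- 2 * e) <= 1 by rewrite -expR0 ler_expR mulNr oppr_le0 mulr_ge0 // ltW.
  have h2 := expR_ge1Dx (- 2 * e).
  by clearbody e; move: (expR (- 2 * e)) h1 h2 => w h1 h2; rewrite ger0_norm; lra.
have F1 : F (expR n.+1%:R) @[n --> \oo] --> (0 : R).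
  apply: (@cvg_dist_le _ _ _ _ e1) => n; rewrite /F mul1r subr0 normrN.
  rewrite ger0_norm ?mulr_ge0 ?expR_ge0 // ?invr_ge0 //.
  apply: (@le_trans _ _ (expR (- 2 * expR n.+1%:R))).
    by rewrite ler_piMl ?expR_ge0 // invf_le1 // ler1n.
  rewrite ler_expR; have := expR_ge1Dx (n.+1%:R : R); have : 0 <= n.+1%:R :> R by [].
  by lra.
have i := ge0_primitive_integrable cf dF F0 F1 (fun t _ => expR_ge0 _).
have E := integrable_primitive cf dF F0 F1 i.
have H t : 0 < t -> - 2 * t + ln t <= 2^-1 * ln t - t.
  by move=> t0; have := ln_sublinear t0; lra.
have : \int[mu]_(t in P) expR (- 2 * t) <= G0 2^-1.
  apply: (@le_Rintegral _ _ _ mu P _ _ mP i (gamma_integrable 1 0 0 h0)) => t /P0 t0.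
  rewrite gosc0 mulr1 /gweight ler_pdivlMr // -{2}[t]lnK ?posrE // -expRD ler_expR.
  exact: H.
by rewrite E sub0r opprK; apply: lt_le_trans.
Qed.

(** With v = (ln x) / 2 this is |v| <= |exp v - exp (- v)| squared. Only x and 1 / x occur on the
    right, so its integrals against a Gamma weight are again Gamma values. *)
Lemma ln_sqr_le (x : R) : 0 < x -> (ln x) ^+ 2 <= 4 * (x - 2 + x^-1).
Proof.
move=> x0; pose v := ln x / 2; pose p := expR v; pose q := expR (- v).
have pq : p * q = 1 by exact: expRNK.
have Ex : x = p ^+ 2 by rewrite expr2 -expRD -splitr lnK.
have Exi : x^-1 = q ^+ 2 by rewrite expr2 -expRD -opprD -splitr expRN lnK.
have -> : ln x = 2 * v by rewrite /v mulrC divfK.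
have -> : 4 * (x - 2 + x^-1) = (2 * (p - q)) ^+ 2 
  by rewrite Exi Ex; move: pq; clearbody p q; clear => pq; ring: pq.
have H (u : R) : 0 <= u -> u <= expR u - expR (- u).
  move=> u0; have := expR_ge1Dx u; have : expR (- u) <= 1 by rewrite -expR0 ler_expR oppr_le0.
  by move: (expR _) (expR _) => w w'; lra.
clearbody v; have [v0|v0] := leP 0 v.
  rewrite ler_sqr ?nnegrE ?mulr_ge0 //; first by rewrite ler_pM2l //; exact: H.
  exact: le_trans v0 (H _ v0).
rewrite -[leLHS]sqrrN -[leRHS]sqrrN -!mulrN opprB.
have := H (- v); rewrite oppr_ge0 ltW // opprK => /(_ isT) h.
have nv : 0 <= - v by rewrite oppr_ge0 ltW.
by rewrite ler_sqr ?nnegrE ?mulr_ge0 ?(le_trans nv h) // ler_pM2l.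
Qed.

(** Rotate by the phase of b^(- iy), b = a + 1, so that the integrand has cos (y ln (t / b)). From
    cos w >= 1 - w^2 / 2 and the bound on ln^2, the loss is 2 y^2 times the mean of t / b - 2 + b /
    t, which equals 1 / a. *)
Lemma gsq_ge a y : 0 < a -> (1 - 2 * y ^+ 2 / a) * G0 (a + 1) <= Num.sqrt (gsq (a + 1) y).
Proof.
move=> a0; have a1 : 0 < a + 1 by rewrite addr_gt0.
have a2 : 0 < a + 1 + 1 by rewrite addr_gt0.
pose b := a + 1; pose th := y * ln b.
have i0 := gamma_integrable 1 0 0 a0; have i1 := gamma_integrable 1 0 0 a1.
have i2 := gamma_integrable 1 0 0 a2.
have it := gamma_integrable (cos th) (sin th) y a1.
have j0 := integrableZl mP b i0; have j2 := integrableZl mP b^-1 i2.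
have j1 := integrableZl mP (1 + 4 * y ^+ 2) i1.
have j3 := integrableZl mP (2 * y ^+ 2) (integrableD mP j0 j2).
have H : (1 + 4 * y ^+ 2) * G0 b - (2 * y ^+ 2) * (b * G0 a + b^-1 * G0 (b + 1)) <= GI b (cos th)
  (sin th) y.
  rewrite /G0 /GI -(RintegralZl _ mP i1) -(RintegralZl _ mP i0) -(RintegralZl _ mP i2).
  rewrite -(RintegralD mP j0 j2) -(RintegralZl _ mP (integrableD mP j0 j2)) -(RintegralB mP j1
    j3).
  apply: (@le_Rintegral _ _ _ mu P _ _ mP (integrableB mP j1 j3) it) => t /P0 t0.
  have b0 : 0 < b := a1.
  rewrite !gosc0 !mulr1 (_ : gweight a t = gweight b t / t); last first.
    by rewrite gweightS.
  rewrite (_ : gweight (b + 1) t = gweight b t * t); last first.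
    by rewrite [gweight (b + 1) t]gweightS // /gweight divfK // gt_eqF.
  rewrite (_ : _ - _ = gweight b t * (1 - 2 * y ^+ 2 * (t / b - 2 + (t / b)^-1))); last first.
    by field; rewrite !gt_eqF.
  apply: ler_wpM2l; first exact: gweight_ge0.
  have -> : gosc (cos th) (sin th) y t = cos (y * ln (t / b)).
    by rewrite ln_div ?posrE // mulrBr cosB /gosc mulrC [sin th * _]mulrC.
  apply: le_trans (cos_ge _); rewrite lerD2l lerN2 exprMn -mulrA ler_pdivrMr //.
  have := ler_wpM2l (sqr_ge0 y) (ln_sqr_le (divr_gt0 t0 b0)); move: (_ - 2 + _) => w.
  by clear; lra.
have E : (1 + 4 * y ^+ 2) * G0 b - (2 * y ^+ 2) * (b * G0 a + b^-1 * G0 (b + 1)) =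
    (1 - 2 * y ^+ 2 / a) * G0 b.
  rewrite G0_rec // /b G0_rec //; field; rewrite !gt_eqF //.
rewrite E in H; apply: (le_trans H); rewrite GI_linear // /gsq.
move: (GI _ _ _ _) (GI _ _ _ _) => c s.
apply: le_trans (ler_norm _) _; rewrite -sqrtr_sqr; apply: ler_wsqrtr.
have := sqr_ge0 (cos th * c - sin th * s); have := cos2Dsin2 th.
move: (cos _) (sin _) => p q e; rewrite -[X in _ -> _ <= X]mul1r -e; clear; lra.
Qed.

Lemma gsqN a y : 0 < a -> gsq a (- y) = gsq a y.
Proof.
move=> a0; have H c s : GI a c s (- y) = GI a c (- s) y.
  by apply: eq_Rintegral => t _; rewrite /gosc mulNr cosN sinN mulrN mulNr.
by rewrite /gsq !H oppr0 (GI_linear 0 (-1) y a0); ring.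
Qed.

Let ahalf N : 0 < N%:R + 2^-1 :> R.
Proof. by rewrite ltr_wpDl // invr_gt0. Qed.

Lemma G0_gt0 N : 0 < G0 (N%:R + 2^-1).
Proof.
elim: N => [|N IH]; first by rewrite add0r; exact: G0_half_gt0.
by rewrite -[N.+1%:R]natr1 addrAC G0_rec // mulr_gt0.
Qed.

Lemma gsq_cosh_prod y N : gsq (N%:R + 2^-1) y / G0 (N%:R + 2^-1) ^+ 2 =
  cosh_prod y N * (gsq 2^-1 y / G0 2^-1 ^+ 2).
Proof.
elim: N => [|N IH]; first by rewrite /cosh_prod big_ord0 add0r mul1r.
rewrite /cosh_prod big_ord_recr /= -/(cosh_prod y N) mulrAC -IH.
rewrite -[N.+1%:R]natr1 addrAC gsq_rec // G0_rec //.
have := ahalf N; have := G0_gt0 N; move: (N%:R + 2^-1) => a g a0.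
by field; rewrite !gt_eqF.
Qed.

Lemma gsq_ratio y : gsq (N.+1%:R + 2^-1) y / G0 (N.+1%:R + 2^-1) ^+ 2 @[N --> \oo] --> (1 : R).
Proof.
pose q N := Num.sqrt (gsq (N.+1%:R + 2^-1) y) / G0 (N.+1%:R + 2^-1).
rewrite (_ : (fun N => _) = fun N => q N * q N); last first.
  apply/funext => N; rewrite /q -expr2 expr_div_n sqr_sqrtr //.
  by rewrite addr_ge0 ?sqr_ge0.
suff cq : q @ \oo --> (1 : R) by rewrite -[X in _ --> X]mulr1; exact: cvgM.
apply: (@cvg_dist_le _ (fun N => 2 * y ^+ 2 * (2 * N.+1%:R^-1))); last first.
  rewrite -(mulr0 (2 * y ^+ 2)); apply: cvgM; first exact: cvg_cst.
  by rewrite -(mulr0 2); apply: cvgM; [exact: cvg_cst|exact: cvg_harmonic].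
move=> N; have g := G0_gt0 N.+1; have a0 := ahalf N.
have lo := gsq_ge y a0; have hi := gsq_le y (ahalf N.+1).
rewrite addrAC natr1 in lo; rewrite -(ler_pdivlMr _ _ g) -/(q N) in lo.
have {}hi : q N <= 1 by rewrite (ler_pdivrMr _ _ g) mul1r.
have k : 2 * y ^+ 2 / (N%:R + 2^-1) <= 2 * y ^+ 2 * (2 * N.+1%:R^-1).
  apply: ler_wpM2l; first by rewrite mulr_ge0 ?sqr_ge0.
  have -> : 2 * N.+1%:R^-1 = (N.+1%:R / 2)^-1 :> R by rewrite invfM invrK mulrC.
  rewrite lef_pV2 ?posrE ?divr_gt0 ?ltr0n // -natr1.
  by have : 0 <= N%:R :> R by []; lra.
set A := 2 * y ^+ 2 / (N%:R + 2^-1) in lo k; set B := 2 * y ^+ 2 * (2 / N.+1%:R) in k *.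
clearbody A B; move: (q N) lo hi => p lo hi.
by rewrite ler_norml; apply/andP; split; lra.
Qed.

Theorem gsq_half y : gsq 2^-1 y * coshR (pi * y) = G0 2^-1 ^+ 2.
Proof.
have h0 : 0 < 2^-1 :> R by rewrite invr_gt0.
wlog y0 : y / 0 <= y.
  move=> W; have [/W//|y0] := leP 0 y.
  by rewrite -coshN -mulrN -(gsqN y h0); apply: W; rewrite oppr_ge0 ltW.
have y20 : 0 <= 2 * y by rewrite mulr_ge0.
(* Both ratios tend to 1, while their product is constant in N because the finite products of the
   two recursions coincide. *)
have c := cvgM (gsq_ratio y) (Ic_ratio y20); rewrite mulr1 in c.
have E : gsq 2^-1 y / G0 2^-1 ^+ 2 * coshR (pi * y) = 1.
  have {}c := c _; rewrite (_ : _ \* _ = fun=> gsq 2^-1 y / G0 2^-1 ^+ 2 * coshR (pi * y)) in c.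
    by apply: (cvg_unique _ (cvg_cst _) (c _)).
  apply/funext => N /=; rewrite gsq_cosh_prod (cosh_prodE y N); ring.
have := congr1 ( *%R^~ (G0 2^-1 ^+ 2)) E.
by rewrite mul1r mulrAC divfK // expf_neq0 // gt_eqF // G0_half_gt0.
Qed.

End GammaIntegrals.

(** * The fiber operators *)

Section Bridge.
Variable R : realType.

Lemma GammaC_half (y : R) : GammaC (Complex 2^-1 y) = Complex (GI 2^-1 1 0 y) (GI 2^-1 0 1 y).
Proof.
have E (t : R) : 0 < t -> powR t (2^-1 - 1) * expR (- t) = gweight 2^-1 t.
  move=> t0; have ti : t^-1 = expR (- ln t) by rewrite expRN lnK.
  by rewrite /powR gt_eqF // /gweight ti -!expRD; congr expR; ring.
rewrite /GammaC /=; congr Complex; apply: eq_Rintegral => t.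
  by rewrite inE /= in_itv /= andbT => t0; rewrite E // /gosc mul1r mul0r addr0.
by rewrite inE /= in_itv /= andbT => t0; rewrite E // /gosc mul1r mul0r add0r.
Qed.

Lemma sqmod_GammaC_half (y : R) : sqmod (GammaC (Complex 2^-1 y)) = G0 2^-1 ^+ 2 / coshR (pi * y).
Proof. by rewrite GammaC_half /sqmod /= -/(gsq 2^-1 y) -(gsq_half y) mulfK // cosh_neq0. Qed.

Variable T : R.
Hypothesis T0 : 0 < T.
Let h := pi * omega T.
Let C : R := G0 2^-1 ^+ 2.
Let C0 : 0 < C. Proof. exact: exprn_gt0 (G0_half_gt0 R). Qed.
Variables A k : R.
Let z := pi * k.
Let ch n := coshR (z + n%:~R * h).
Let ga n := gammaMH T k n.

Lemma h_gt0 : 0 < h.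
Proof. by rewrite mulr_gt0 ?pi_gt0 // divr_gt0 // mulr_gt0 // pi_gt0. Qed.

Lemma sqmod_gamma n : sqmod (ga n) = C / ch n.
Proof. by rewrite sqmod_GammaC_half /ch /z /h; congr (_ / coshR _); ring. Qed.

Lemma HapplyE x n : Happly T A k x n = (conjc (ga n) *
  (A%:C * (ga n * x n) + (2^-1)%:C * (ga (n - 1) * x (n - 1) + ga (n + 1) * x (n + 1))))%C.
Proof.
rewrite /Happly !big_cons big_nil addr0 /Hmat -/(ga _) addr0.
have -> : sMH A (n - (n - 1)) = 2^-1 by rewrite (_ : n - (n - 1) = 1) //; lia.
have -> : sMH A (n - n) = A by rewrite subrr.
have -> : sMH A (n - (n + 1)) = 2^-1 by rewrite (_ : n - (n + 1) = -1) //; lia.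
rewrite -!/(ga _); ring.
Qed.

Lemma sqmodM (a b : R[i]) : sqmod (a * b) = sqmod a * sqmod b.
Proof. by case: a b => [a1 a2] [b1 b2]; rewrite /sqmod /=; ring. Qed.

Lemma mul_conjc_sqmod (a : R[i]) : a * conjc a = (sqmod a)%:C%C.
Proof. by case: a => a1 a2; rewrite /sqmod /=; apply/eqP; rewrite eq_complex /=; apply/andP;
  split; apply/eqP; ring. Qed.

Lemma sqmod_ge0 (a : R[i]) : 0 <= sqmod a.
Proof. by rewrite addr_ge0 ?sqr_ge0. Qed.

Lemma sqmod_eq0 (a : R[i]) : sqmod a = 0 -> a = 0.
Proof.
case: a => a1 a2 /eqP; rewrite /sqmod /= paddr_eq0 ?sqr_ge0 // !sqrf_eq0.
by move=> /andP[/eqP-> /eqP->].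
Qed.

Lemma l2Z_bsum (x : int -> R[i]) : l2Z x <-> bsum (fun n => sqmod (x n)).
Proof.
have E : series (fun n : nat => sqmod (x n%:Z) + sqmod (x (- (n.+1)%:Z))) = psum (fun n => sqmod
  (x n)).
  by apply/funext => N; rewrite /series /psum /=.
rewrite /l2Z E; split => [c|b]; last first.
  by apply: bsum_cvg => // n; exact: sqmod_ge0.
exists (limn (psum (fun n => sqmod (x n)))) => N.
by apply: nondecreasing_cvgn_le => //; apply: psum_nondecreasing => n; exact: sqmod_ge0.
Qed.

Lemma eigvec_of_is_eigvec lam x : 0 < lam -> is_eigvec T A k lam x -> (exists n, x n != 0) ->
  eigval h z A (lam / C).
Proof.
move=> lam0 [lx ex] [m xm]; pose v n := ga n * x n.
have v2 n : sqmod (v n) = C / ch n * sqmod (x n) by rewrite sqmodM sqmod_gamma.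
have c0 n : 0 < ch n := cosh_gt0 _.
have ev n : (A%:C * v n + (2^-1)%:C * (v (n - 1) + v (n + 1)) = (lam / C * ch n)%:C * v n)%C.
  have := congr1 ( *%R (ga n)) (ex n); rewrite HapplyE -!/(v _) mulrA mul_conjc_sqmod sqmod_gamma.
  rewrite [RHS]mulrCA -/(v n) => H.
  have c1 : ((ch n / C)%:C * (C / ch n)%:C = 1 :> R[i])%C.
    by rewrite -rmorphM /= mulrA divfK ?divff // gt_eqF.
  have := congr1 ( *%R (ch n / C)%:C%C) H; rewrite mulrA c1 mul1r => ->.
  by rewrite mulrA -rmorphM /=; congr (_%:C%C * _); ring.
(* The recurrence for gamma_n x_n has real coefficients, so real and imaginary parts solve it
   separately, and one of them is nonzero. *)
have real p : (p = @complex.Re R \/ p = @complex.Im R) -> (exists n, p (v n) != 0) ->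
    eigval h z A (lam / C).
  move=> Hp pv; exists (fun n => p (v n)); split => //.
  - have /l2Z_bsum bx := lx.
    apply: (bsum_le (g := fun n => C * sqmod (x n))); last by apply: bsumZ;
      [exact: ltW|exact: bx].
    move=> n; rewrite -/(ch n); have := v2 n; rewrite mulrAC => v2'.
    have -> : C * sqmod (x n) = ch n * sqmod (v n) by rewrite v2' [RHS]mulrC divfK // (gt_eqF (c0
      n)).
    rewrite ler_pM2l // /sqmod.
    by case: Hp => ->; [rewrite lerDl|rewrite lerDr]; exact: sqr_ge0.
  - move=> n; rewrite -/(ch n).
    have := ev n; case: (v n) (v (n - 1)) (v (n + 1)) => [a1 a2] [b1 b2] [d1 d2].
    move/eqP; rewrite eq_complex /= => /andP[/eqP e1 /eqP e2].
    by case: Hp => -> /=; lra.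
have vm : v m != 0.
  apply/eqP => vm; have := v2 m; rewrite vm {1}/sqmod /= expr0n /= addr0 => /esym/eqP.
  rewrite mulf_eq0 (gt_eqF (divr_gt0 C0 (c0 m))) /= => /eqP/sqmod_eq0 x0.
  by rewrite x0 eqxx in xm.
have [r0|r0] := eqVneq (complex.Re (v m)) 0.
  apply: (real (@complex.Im R)); first by right.
  by exists m; apply: contra vm => /eqP i0; rewrite eq_complex r0 i0 eqxx.
by apply: (real (@complex.Re R)); [left|exists m].
Qed.

(** The inverse substitution x_n = u_n / gamma_n, written with the conjugate since 1 / gamma_n =
    conj(gamma_n) cosh (z + n h) / C. *)
Lemma is_eigvec_of_eigvec mu u : eigvec h z A mu u ->
  exists x, is_eigvec T A k (mu * C) x /\ exists n, x n != 0.
Proof.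
move=> [[m um] lu su]; pose x n : R[i] := (conjc (ga n) * (u n * ch n / C)%:C)%C.
have c0 n : 0 < ch n := cosh_gt0 _.
have gx n : ga n * x n = (u n)%:C%C.
  rewrite mulrA mul_conjc_sqmod sqmod_gamma -rmorphM /=; congr (_%:C%C).
  by field; rewrite !gt_eqF.
exists x; split; last first.
  exists m; apply/eqP => xm; have := gx m; rewrite xm mulr0 => /eqP.
  by rewrite eq_complex /= eq_sym (negbTE um).
split.
  apply/l2Z_bsum; apply: (bsum_le (g := fun n => C^-1 * (ch n * u n ^+ 2))); last first.
    by apply: bsumZ; [rewrite invr_ge0 ltW|exact: lu].
  move=> n; rewrite sqmodM.
  have -> : sqmod (conjc (ga n)) = C / ch n.
    by rewrite -sqmod_gamma; case: (ga n) => a b; rewrite /sqmod /= sqrrN.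
  rewrite {1}/sqmod /= expr0n addr0; rewrite le_eqVlt; apply/orP; left; apply/eqP.
  by field; rewrite !gt_eqF.
move=> n; rewrite HapplyE !gx; have := su n; rewrite -/(ch n) => s.
rewrite -!rmorphD -!rmorphM -rmorphD /= /x mulrCA -rmorphM /=; congr (_ * _%:C%C).
have -> : mu * C * (u n * ch n / C) = mu * ch n * u n by field; rewrite gt_eqF.
by move: s; clear; lra.
Qed.

Lemma eig_mult1 lam : 0 < lam -> eig_mult_ge T A k lam 1 <-> eigval h z A (lam / C).
Proof.
move=> lam0; split.
  move=> [v [ev iv]]; apply: (eigvec_of_is_eigvec lam0 (ev ord0)).
  apply: contrapT => H; have z0 n : \sum_(i < 1) 1 * v i n = 0.
    by rewrite big_ord1 mul1r; apply/eqP/negPn/negP => vn; apply: H; exists n.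
  by have /eqP := iv (fun=> 1) z0 ord0; rewrite oner_eq0.
move=> [u /is_eigvec_of_eigvec[x [ex [n xn]]]]; exists (fun=> x); split.
  by move=> _; rewrite divfK ?gt_eqF // in ex.
move=> c /(_ n); rewrite big_ord1 => /eqP; rewrite mulf_eq0 (negbTE xn) orbF => /eqP c0 i.
by rewrite ord1.
Qed.

(** Multiplicity at least 1 identifies the band values at k with the positive eigenvalues; division
    by C passes from lambda to mu. *)
Lemma band_eig_enum E : positive_band_enum T A E -> eig_enum h z A (fun j => E j k / C).
Proof.
move=> [_ Epos Edec Eev]; split.
- by move=> j; rewrite divr_gt0.
- by move=> j; rewrite ltr_pM2r ?invr_gt0.
move=> mu mu0; have l0 : 0 < mu * C by rewrite mulr_gt0.
have := eig_mult1 l0; rewrite mulfK ?gt_eqF // => <-; rewrite (Eev k _ l0 1); split.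
  by move=> [f [_ fE]]; exists (f ord0); rewrite fE mulfK // gt_eqF.
move=> [j <-]; exists (fun=> j); split; first by move=> a b _; rewrite !ord1.
by rewrite divfK // gt_eqF.
Qed.

End Bridge.

Theorem theorem8p8 (R : realType) (T : R) (hT : 0 < T)
    (E : R -> nat -> R -> R) :
  (forall A : R, 0 < A < 1 -> positive_band_enum T A (E A)) ->
  forall n : nat, exists An : R, 0 < An /\
    forall A : R, 0 < A < An -> A < 1 ->
      forall k1 k2 : R, 0 < k1 -> k1 < k2 -> k2 < omega T / 2 ->
        E A n k2 < E A n k1.
Proof.
move=> HE n; have [d d0 H] := eig_enum_decreasing (h_gt0 hT) n.
exists d; split => // A /andP[A0 Ad] A1 k1 k2 k10 k12 k2T.
have hA : positive_band_enum T A (E A) by apply: HE; rewrite A0.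
have p := pi_gt0 R.
have := H A A0 Ad (pi * k1) (pi * k2) _ _ _ _ _ (band_eig_enum hT k1 hA) (band_eig_enum hT k2 hA).
rewrite ltr_pM2r ?invr_gt0 ?exprn_gt0 ?G0_half_gt0 //; apply.
- by rewrite mulr_ge0 // ltW.
- by rewrite ltr_pM2l.
- by rewrite -mulrA ler_pM2l // ltW.
Qed.
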